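(* Assume that $Z$ is a densely defined linear operator in a complete (Hausdorff) locally convex space $\mathbf{X}$ and $t>0$. Assume also that there exists a function $F:[0,\infty)\to\mathcal{L}(\mathbf{X})$ such that: (i) $F\in\mathcal{F}_{\mathbf{X}}$; (ii) $\mathcal{D}(F'_{ef}(0))\supset\mathcal{D}(Z)$ and $F'_{ef}(0)g=Zg$ for $g\in\mathcal{D}(Z)$; (iii) $\mathcal{D}({F^*}'(0))$ is *-dense in $\mathbf{X}^*$. Then the operator $Z$ possesses a closure and its closure is the generator of an $lC_0$-semigroup if and only if there exists a dense linear subspace $\mathbf{A}\subseteq\mathcal{D}(Z)$ of $\mathbf{X}$ such that for any $f\in\mathbf{A}$ and $s\ge0$ there exists a sequence $\{f_n^s\}_{n=1}^\infty$, $f_n^s\in\mathcal{D}(\overline{Z})$, satisfying the following conditions: (a) $w\text{-}\lim_{n\to\infty}\left(F(\tfrac tn)^{[ns/t]}f-f_n^s\right)=0$; (b) every subsequence of the sequence $\{\overline{Z}f_n^s\}_{n=1}^\infty$ has a weakly convergent subsequence; (c) every subsequence of the sequence $\{f_n^s\}_{n=1}^\infty$ has a weakly convergent subsequence.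
   Context: $\mathbf{X}$ is over $\mathbb{T}\in\{\mathbb{R},\mathbb{C}\}$ with topology generated by semi-norms $\|\cdot\|_\alpha$, $\alpha\in\Omega$. $\mathcal{L}(\mathbf{X})$ is the space of bounded linear operators in $\mathbf{X}$ with the topology of pointwise convergence; $I$ is the identity; $\mathcal{D}(C)$ is the domain of $C$; $[\cdot]$ is the integer part; $w\text{-}\lim$ is the limit in the weak topology $\sigma(\mathbf{X},\mathbf{X}^* )$. A family $G_\beta\in\mathcal{L}(\mathbf{X})$, $\beta\in\Gamma$, is equicontinuous if for any $\alpha\in\Omega$ there are finitely many $\alpha_1,\dots,\alpha_n\in\Omega$ and $b_1,\dots,b_n>0$ with $\sup_\beta\|G_\beta x\|_\alpha\le\sum_i b_i\|x\|_{\alpha_i}$ for all $x\in\mathbf{X}$. For $F:[0,\infty)\to\mathcal{L}(\mathbf{X})$ and $s\ge0$ put $\mathbf{B}^F_s=\{F(\tfrac dn)^m : md/n\le s,\ n,m\in\mathbb{N},\ d\ge0\}$. $\mathcal{E}_{\mathbf{X}}$ is the set of $F:[0,\infty)\to\mathcal{L}(\mathbf{X})$ with $F(0)=I$ and $\mathbf{B}^F_s$ equicontinuous for every $s\ge0$. Many-valued effective derivative: $\mathcal{D}(F'_{mef}(0))$ is the set of $f\in\mathbf{X}$ for which there is a family $\{f_s\}_{s\ge0}$ in $\mathbf{X}$ such that $\lim_{h\to0}f_h=f$ and $\lim_{h\to0}h^{-1}(F(h)-F(0))f_h$ exists (limits as $h\to 0$, $h>0$); $F'_{mef}(0)f$ is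 the set of all $g\in\mathbf{X}$ arising as the second limit for some such family. $\mathcal{F}_{\mathbf{X}}$ is the set of $F\in\mathcal{E}_{\mathbf{X}}$ with $\mathcal{D}(F'_{mef}(0))$ dense in $\mathbf{X}$. For $F\in\mathcal{F}_{\mathbf{X}}$ each $F'_{mef}(0)f$ consists of one element, and the effective derivative $F'_{ef}(0):\mathcal{D}(F'_{mef}(0))\to\mathbf{X}$ is the linear map with $F'_{ef}(0)f\in F'_{mef}(0)f$. A linear operator is closable (possesses a closure) if the closure of its graph in $\mathbf{X}\times\mathbf{X}$ is the graph of a linear operator, its closure $\overline{Z}$; conditions (i)–(ii) imply that $Z$ is closable. $\mathbf{X}^*$ is the space of continuous linear functionals with the strong topology (semi-norms $f\mapsto\sup_{x\in A}|f(x)|$, $A\subset\mathbf{X}$ bounded). $F^*(s)=(F(s))^*$. The strong derivative at $0$ of $S:[0,\infty)\to\mathcal{L}(\mathbf{E})$ is $S'(0)\psi=\lim_{h\to0}h^{-1}(S(h)\psi-S(0)\psi)$ with domain $\mathcal{D}(S'(0))$ the set of $\psi\in\mathbf{E}$ for which the limit exists; for $S=F^*$ one takes $\mathbf{E}=\mathbf{X}^*$. A set $A\subset\mathbf{X}^*$ is *-dense in $\mathbf{X}^*$ if for each $\phi\in\mathbf{X}^*$ there is a sequence $\phi_k\in A$ with $\lim_k\phi_k(x)=\phi(x)$ for each $x$ in the completion of $\mathbf{X}$. An $lC_0$-semigroup is a continuous function $T:[0,\infty)\to\mathcal{L}(\mathbf{X})$ with $T(0)=I$, $T(l+m)=T(l)T(m)$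 for $l,m\ge0$, and $T\in\mathcal{E}_{\mathbf{X}}$. Its generator is its strong derivative $T'(0)$. *)

(* Defs.v *)
From HB Require Import structures.
From mathcomp Require Import all_boot all_order all_algebra.
From mathcomp Require Import all_classical all_reals all_analysis.
From mathcomp Require Import complex.

Set Implicit Arguments.
Unset Strict Implicit.
Unset Printing Implicit Defensive.
Import Order.TTheory GRing.Theory Num.Theory.
Import numFieldNormedType.Exports.
Local Open Scope classical_set_scope.
Local Open Scope ring_scope.

Inductive scalar_kind := RealScalars | ComplexScalars.

Definition scalar_field (R : realType) (k : scalar_kind) : numFieldType :=
  match k with RealScalars => R | ComplexScalars => R[i] end.

Definition of_real (R : realType) (k : scalar_kind) : R -> scalar_field R k :=
  match k with RealScalars => id | ComplexScalars => @real_complex R end.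
Arguments of_real {R k}.

Section LinearOperators.
Context {K : numFieldType}.

Definition linear_subspace (E : lmodType K) (A : set E) :=
  A 0 /\ forall a x y, A x -> A y -> A (a *: x + y).

(* A possibly unbounded operator: [app] is only meaningful on [dom], so two
   operators are identified when their graphs coincide. *)
Record operator (E : lmodType K) := Operator { dom : set E; app :> E -> E }.

Definition linear_operator (E : lmodType K) (Z : operator E) :=
  linear_subspace (dom Z) /\
  forall a x y, dom Z x -> dom Z y -> Z (a *: x + y) = a *: Z x + Z y.

Definition graph (E : lmodType K) (Z : operator E) : set (E * E) :=
  [set u | dom Z u.1 /\ u.2 = Z u.1].

(* The operator with graph [G], when the relation [G] is single-valued. *)
Definition operator_of (E : lmodType K) (G : set (E * E)) : operator E :=
  {| dom := [set x | exists y, G (x, y)];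
     app := fun x => xget 0 [set y | G (x, y)] |}.

Definition closable (E : tvsType K) (Z : operator E) :=
  exists W : operator E, linear_operator W /\ closure (graph Z) = graph W.

Definition operator_closure (E : tvsType K) (Z : operator E) : operator E :=
  operator_of (closure (graph Z)).

End LinearOperators.

Section LocallyConvexSpaces.
Context {K : numFieldType} {X : tvsType K}.

(* Seminorms take their values in the nonnegative elements of K, as norms of
   [normedModType K] do. *)
Definition seminorm (p : X -> K) :=
  [/\ forall x, 0 <= p x,
      forall x y, p (x + y) <= p x + p y
    & forall a x, p (a *: x) = `|a| * p x].

Definition generates_topology {Omega : Type} (p : Omega -> X -> K) :=
  forall (x : X) (U : set X), nbhs x U <->
    exists (n : nat) (alpha : 'I_n -> Omega) (e : K), 0 < e /\
      [set y | forall i, p (alpha i) (y - x) < e] `<=` U.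

(* Cauchy filters are taken for the translation-invariant uniformity. The
   uniform structure carried by a [tvsType] is only required to induce its
   topology, so [completeType] would be a different notion. *)
Definition tvs_cauchy (F : set_system X) :=
  forall U : set X, nbhs 0 U ->
    exists2 A, F A & forall x y, A x -> A y -> U (x - y).

Definition tvs_complete :=
  forall F : set_system X, ProperFilter F -> tvs_cauchy F ->
    exists x : X, F --> x.

Definition equicontinuous_family {Omega : Type} (p : Omega -> X -> K)
    (B : set (X -> X)) :=
  forall a : Omega,
    exists (n : nat) (alpha : 'I_n -> Omega) (b : 'I_n -> K),
      (forall i, 0 < b i) /\
      forall G x, B G -> p a (G x) <= \sum_(i < n) b i * p (alpha i) x.

Definition bounded_subset {Omega : Type} (p : Omega -> X -> K) (A : set X) :=
  forall a : Omega, exists M : K, forall x, A x -> p a x <= M.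

Definition bounded_operator {Omega : Type} (p : Omega -> X -> K)
    (T : X -> X) :=
  linear T /\ forall A, bounded_subset p A -> bounded_subset p (T @` A).

Definition dual : set (X -> K^o) :=
  [set phi | linear phi /\ continuous phi].

Definition star_dense (A : set (X -> K^o)) :=
  forall phi, dual phi -> exists phi_ : nat -> X -> K^o,
    (forall k, A (phi_ k)) /\ forall x, phi_ k x @[k --> \oo] --> phi x.

Definition dual_eval (x : X) : {ptws dual -> K^o} := fun phi => val phi x.

(* X with the topology sigma(X, X^* ). *)
Definition weak_space := initial_topology dual_eval.

Definition weak_cvg (u : nat -> X) (l : X) :=
  (u : nat -> weak_space) @ \oo --> (l : weak_space).

Definition weakly_subseq_compact (u : nat -> X) :=
  forall sigma : nat -> nat, {homo sigma : m n / (m < n)%N} ->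
    exists2 tau : nat -> nat, {homo tau : m n / (m < n)%N}
      & exists l : X, weak_cvg (u \o sigma \o tau) l.

End LocallyConvexSpaces.
Arguments tvs_complete {K} X.
Arguments dual {K} X.

(* Functions on [0, oo) are functions on R of which only the values at
   nonnegative arguments are used; limits at 0 are taken along h > 0. *)
Section OperatorFunctions.
Context {R : realType} {k : scalar_kind}.
Local Notation K := (scalar_field R k).

Definition difference_quotient (E : lmodType K) (S : R -> E -> E) (x : E)
    (h : R) : E :=
  (of_real h)^-1 *: (S h x - S 0 x).

Context {X : tvsType K} {Omega : Type} (p : Omega -> X -> K).

Definition iterates (F : R -> X -> X) (s : R) : set (X -> X) :=
  [set G | exists (d : R) (n m : nat),
     [/\ 0 <= d, (0 < n)%N, (0 < m)%N, m%:R * d / n%:R <= s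
       & G = iter m (F (d / n%:R))]].

Definition class_E (F : R -> X -> X) :=
  [/\ forall s, 0 <= s -> bounded_operator p (F s),
      F 0 = id
    & forall s, 0 <= s -> equicontinuous_family p (iterates F s)].

Definition mef_derivative (F : R -> X -> X) : set (X * X) :=
  [set u | exists f_ : R -> X,
     f_ h @[h --> 0^'+] --> u.1 /\
     difference_quotient F (f_ h) h @[h --> 0^'+] --> u.2].

Definition effective_derivative (F : R -> X -> X) : operator X :=
  operator_of (mef_derivative F).

Definition class_F (F : R -> X -> X) :=
  class_E F /\ dense (dom (effective_derivative F)).

Definition strong_derivative (S : R -> X -> X) : operator X :=
  operator_of
    [set u | difference_quotient S u.1 h @[h --> 0^'+] --> u.2].

Definition adjoint_function (F : R -> X -> X) (s : R) (psi : X -> K^o) :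
    X -> K^o :=
  psi \o F s.

(* The strong derivative at 0 of F^* in X^* with its strong topology, that of
   uniform convergence on bounded sets. *)
Definition adjoint_strong_derivative (F : R -> X -> X) :
    operator (X -> K^o) :=
  operator_of
    [set u | [/\ dual X u.1, dual X u.2
       & {family bounded_subset p,
            difference_quotient (adjoint_function F) u.1 h @[h --> 0^'+]
              --> u.2}]].

Definition lC0_semigroup (T : R -> X -> X) :=
  [/\ {within `[0, +oo[, continuous (T : R -> {ptws X -> X})},
      T 0 = id,
      forall l m, 0 <= l -> 0 <= m -> T (l + m) = T l \o T m
    & class_E T].

Definition generator (T : R -> X -> X) : operator X := strong_derivative T.

End OperatorFunctions.

(* Main.v *)
(* Chernoff's telescoping argument works with the effective derivative: if a
   curve [v] satisfies [v' = Z v + g] for the closure of [Z], then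
   [F(h)^[s/h] (v 0) + h * \sum_(j < [s/h]) F(h)^j g] tends to [v s].  With
   [v = T(.) f] and [g = 0] this gives (a), (b), (c) for the constant sequences
   [T(s) f].  Conversely, a diagonal extraction yields a weak limit [u] of the
   orbits [F(h)^[s/h] f], with values in the domain of the closure of [Z].  The
   derivative of [xi \o u] is known for [xi] in the domain of the strong
   derivative of [F^*]; *-density, uniform boundedness and dominated convergence
   extend this to every [xi] in the domain of the adjoint of [Z], so that by
   Hahn-Banach [U s = \int_0^s u] satisfies [U' = Z U + f].  Hence the sums
   [h * \sum_(j < [s/h]) F(h)^j f] converge strongly, and so do the products
   [F(h)^[s/h] f] for [f] in the domain of [Z]. *)
From HB Require Import structures.
From mathcomp Require Import all_boot all_order all_algebra.
From mathcomp Require Import all_classical all_reals all_analysis.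
From mathcomp Require Import measurable_realfun complex ring lra.
Require Import Defs.

Set Implicit Arguments.
Unset Strict Implicit.
Unset Printing Implicit Defensive.
Import Order.TTheory GRing.Theory Num.Theory.
Import numFieldNormedType.Exports.
Local Open Scope classical_set_scope.
Local Open Scope ring_scope.

(** The analysis is done over the reals for an abstract family [Q] of seminorms; complex scalars
    enter afterwards, through real parts. A weak limit of orbits carries no semigroup law and may
    depend on the subsequence. This is harmless because the integrated orbit solves an inhomogeneous
    equation, to which Chernoff's estimate applies whichever limit was chosen. The obstacle is that
    equation: *-density gives [psi_k] tending pointwise to [xi], but says nothing of the derivatives
    [psi'_k] of the [psi_k]. Two facts replace this. On the orbit, [psi'_k (u a) = psi_k (w a)],
    where [w a] is the value at [u a] of the closure of Z, so the pointwise limit is [xi (w a)]; no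
    regularity of [w] is at hand and [w] is never integrated. Moreover the difference quotients of
    [u] stay in one bounded disc, on which the [psi_k] are uniformly bounded, so the [psi'_k (u a)]
    are bounded in [k] and [a]. Only scalar Lipschitz functions are integrated. *)

Section LinearExpressions.
Variables (R : pzRingType) (V : lmodType R).

(** Syntax for vectors built from the module operations, with opaque scalars. It proves vector
    identities by reflection: equality reduces to one scalar equation per atom, which [ring]
    solves. *)
Inductive lexp := LAtom of nat | LZero | LAdd of lexp & lexp | LOpp of lexp
  | LScale of R & lexp.

Fixpoint leval (env : seq V) e : V :=
  match e with
  | LAtom n => nth 0 env n
  | LZero => 0
  | LAdd e f => leval env e + leval env f
  | LOpp e => - leval env e
  | LScale a e => a *: leval env e
  end.

Fixpoint lcoef e (i : nat) : R :=
  match e with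
  | LAtom n => if eqn n i then 1 else 0
  | LZero => 0
  | LAdd e f => lcoef e i + lcoef f i
  | LOpp e => - lcoef e i
  | LScale a e => a * lcoef e i
  end.

(** A nested conjunction, so that after simplification [split] exposes one ring equation per
    atom. *)
Fixpoint lagree e f (n : nat) : Prop :=
  if n is m.+1 then lcoef e m = lcoef f m /\ lagree e f m else True.

Lemma levalE env e : leval env e = \sum_(i < size env) lcoef e i *: env`_i.
Proof.
elim: e => [n||e IHe f IHf|e IH|a e IH] /=.
- have [nenv|envn] := ltnP n (size env).
    rewrite (bigD1 (Ordinal nenv))//= big1 ?addr0; first by rewrite eqnE eqxx scale1r.
    by move=> i; rewrite -val_eqE/= eqnE eq_sym => /negPf ->; rewrite scale0r.
  rewrite nth_default// big1// => i _; rewrite eqnE gtn_eqF ?scale0r//.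
  exact: leq_trans (ltn_ord i) envn.
- by rewrite big1// => i _; rewrite scale0r.
- by rewrite IHe IHf -big_split; apply: eq_bigr => i _; rewrite scalerDl.
- by rewrite IH -sumrN; apply: eq_bigr => i _; rewrite scaleNr.
- by rewrite IH scaler_sumr; apply: eq_bigr => i _; rewrite scalerA.
Qed.

Lemma leval_eq env e f : lagree e f (size env) -> leval env e = leval env f.
Proof.
move=> ef; rewrite !levalE; apply: eq_bigr => -[i /= ienv] _; congr (_ *: _).
elim: (size env) ienv ef => //= n IH; rewrite ltnS leq_eqVlt => /orP[/eqP -> [//]|].
by move=> /IH h [_ /h].
Qed.

End LinearExpressions.

Ltac lmod_index x env k :=
  match env with
  | x :: _ => k O
  | _ :: ?env' => lmod_index x env' ltac:(fun n => k (S n))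
  end.
Ltac lmod_mem x env :=
  match env with
  | x :: _ => constr:(true)
  | _ :: ?env' => lmod_mem x env'
  | _ => constr:(false)
  end.
Ltac lmod_atoms env t :=
  match t with
  | (?a + ?b)%R => let env := lmod_atoms env a in lmod_atoms env b
  | (- ?a)%R => lmod_atoms env a
  | (_ *: ?a)%R => lmod_atoms env a
  | 0%R => env
  | _ => match lmod_mem t env with
         | true => env
         | false => constr:(t :: env)
         end
  end.
Ltac lmod_reify R env t k :=
  match t with
  | (?a + ?b)%R => lmod_reify R env a ltac:(fun e =>
                   lmod_reify R env b ltac:(fun f => k (LAdd e f)))
  | (- ?a)%R => lmod_reify R env a ltac:(fun e => k (LOpp e))
  | (?c *: ?a)%R => lmod_reify R env a ltac:(fun e => k (LScale c e))
  | 0%R => k (LZero R)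
  | _ => lmod_index t env ltac:(fun n => k (LAtom R n))
  end.
(* Proves identities between linear combinations of vectors with scalars in R
   by comparing the coefficients of each atom. *)
Ltac lmod R :=
  match goal with
  | |- @eq ?V ?a ?b =>
    let env := lmod_atoms (@nil V) a in
    let env := lmod_atoms env b in
    lmod_reify R env a ltac:(fun e => lmod_reify R env b ltac:(fun f =>
      let H := fresh in
      have H := @leval_eq R _ env e f;
      apply: H; rewrite /=; repeat split; ring))
  end.
Section LinearMaps.
Variables (K : pzRingType) (U W : lmodType K) (f : U -> W).
Hypothesis f_linear : linear f.

Lemma linear_fun0 : f 0 = 0.
Proof.
have := f_linear (-1) 0 0.
by rewrite scaler0 addr0 scaleN1r addNr.
Qed.

Lemma linear_funD x y : f (x + y) = f x + f y.
Proof. by have := f_linear 1 x y; rewrite !scale1r. Qed.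

Lemma linear_funZ a x : f (a *: x) = a *: f x.
Proof. by have := f_linear a x 0; rewrite !addr0 linear_fun0 addr0. Qed.

Lemma linear_funN x : f (- x) = - f x.
Proof. by rewrite -scaleN1r linear_funZ scaleN1r. Qed.

Lemma linear_funB x y : f (x - y) = f x - f y.
Proof. by rewrite linear_funD linear_funN. Qed.

Lemma linear_fun_sum (I : Type) (r : seq I) (P : pred I) (E : I -> U) :
  f (\sum_(i <- r | P i) E i) = \sum_(i <- r | P i) f (E i).
Proof. exact: (big_morph f linear_funD linear_fun0). Qed.

End LinearMaps.

Lemma iter_linear (K : pzRingType) (U : lmodType K) (f : U -> U) m :
  linear f -> linear (iter m f).
Proof.
move=> fl; elim: m => // m IH a x y.
by rewrite !iterS IH fl.
Qed.

(** Telescoping. With [f = F h] it turns the displacement of an orbit into a Riemann sum of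
    difference quotients. *)
Lemma iter_subE (K : pzRingType) (U : lmodType K) (f : U -> U) m x :
  linear f -> iter m f x - x = \sum_(j < m) iter j f (f x - x).
Proof.
move=> fl; elim: m => [|m IH]; first by rewrite big_ord0 subrr.
rewrite big_ord_recr /= -IH (linear_funB (iter_linear m fl)) -iterSr iterS.
by rewrite [RHS]addrC addrA subrK.
Qed.

(** * The Hahn-Banach theorem *)

Section HahnBanach.
Variables (R : realType) (V : lmodType R) (q : V -> R).
Hypothesis q_tri : forall x y, q (x + y) <= q x + q y.
Hypothesis q_hom : forall a x, q (a *: x) = `|a| * q x.

(** Partial functionals are represented by their graphs, so that a chain is bounded by its union;
    single-valuedness follows from domination by [q]. The last clause admits the empty graph, which
    is the union of the empty chain, and forces the value at [x0] on any other. *)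
Let dominated_graph (x0 : V) (G : set (V * R)) :=
  [/\ forall a x y r s, G (x, r) -> G (y, s) -> G (a *: x + y, a * r + s),
      forall x r, G (x, r) -> r <= q x
    & G !=set0 -> G (x0, q x0)].

Let dominated_graph_functional x0 G r : dominated_graph x0 G -> G (0, r) -> r = 0.
Proof.
case=> Gl Gq _ G0.
have q00 : q 0 = 0 by rewrite -(scale0r (0 : V)) q_hom normr0 mul0r.
have r_le0 : r <= 0 by rewrite -q00; exact: Gq.
have := Gl (-2) _ _ _ _ G0 G0; rewrite scaler0 addr0 => /Gq; rewrite q00.
lra.
Qed.

(** The value [c] at [x] must lie above every [r - q (y - x)] and below every [q (y + x) - r] over
    the graph. Subadditivity of [q] makes the two sides compatible, and homogeneity reduces a
    nonzero [a] to 1 or -1. *)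
Let dominated_graph_extend x0 G x : dominated_graph x0 G -> G !=set0 ->
  exists c, forall y r a, G (y, r) -> r + a * c <= q (y + a *: x).
Proof.
move=> [Gl Gq _] Gn0.
have G0 : G (0, 0).
  have [[y r] Gy] := Gn0.
  by have := Gl (-1) _ _ _ _ Gy Gy; rewrite scaleN1r mulN1r !addNr.
have Gsc a y r : G (y, r) -> G (a *: y, a * r).
  by move=> Gy; have := Gl a _ _ _ _ Gy G0; rewrite !addr0.
pose S : set R := [set c | exists y r, G (y, r) /\ c = r - q (y - x)].
have Sub y2 r2 : G (y2, r2) -> ubound S (q (y2 + x) - r2).
  move=> G2 _ [y1 [r1 [G1 ->]]].
  have := Gl 1 _ _ _ _ G1 G2; rewrite scale1r mul1r => /Gq.
  have := q_tri (y1 - x) (y2 + x).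
  have -> : y1 - x + (y2 + x) = y1 + y2 by rewrite addrCA subrK addrC.
  lra.
have Sn0 : S !=set0 by exists (0 - q (0 - x)); exists 0, 0.
have Ssup : has_sup S by split=> //; exists (q (0 + x) - 0); exact: Sub.
exists (sup S) => y r a Gy.
have [a0|a0|->] := ltgtP a 0; last first.
- by rewrite mul0r scale0r !addr0; exact: Gq.
- have a0' : a != 0 by rewrite gt_eqF.
  have /Gsc-/(_ a^-1) G1 := Gy.
  have := ge_sup Sn0 (Sub _ _ G1).
  have -> : y + a *: x = a *: (a^-1 *: y + x) by rewrite scalerDr scalerA divff// scale1r.
  rewrite q_hom gtr0_norm// => h.
  have -> : r + a * sup S = a * (sup S + a^-1 * r).
    by rewrite mulrDr mulrA divff// mul1r addrC.
  by rewrite ler_pM2l//; lra.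
- have a0' : a != 0 by rewrite lt_eqF.
  have /Gsc-/(_ (-a^-1)) G1 := Gy.
  have : - a^-1 * r - q (- a^-1 *: y - x) <= sup S.
    by apply: ub_le_sup; [exact: Ssup.2 | exists (- a^-1 *: y), (- a^-1 * r)].
  have -> : y + a *: x = (- a) *: (- a^-1 *: y - x).
    by rewrite scalerBr scalerA mulrNN divff// scale1r scaleNr opprK.
  rewrite q_hom gtr0_norm ?oppr_gt0// => h.
  have -> : r + a * sup S = (-a) * (- a^-1 * r - sup S).
    by rewrite mulrBr mulrA mulrNN divff// mul1r mulNr opprK.
  by rewrite ler_pM2l ?oppr_gt0//; lra.
Qed.

Theorem hahn_banach (x0 : V) :
  exists phi : V -> R^o,
    [/\ linear phi, forall x, phi x <= q x & phi x0 = q x0].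
Proof.
have q00 : q 0 = 0 by rewrite -(scale0r (0 : V)) q_hom normr0 mul0r.
have qN x : q (- x) = q x by rewrite -scaleN1r q_hom normrN1 mul1r.
have q_ge0 x : 0 <= q x.
  by have := q_tri x (- x); rewrite subrr q00 qN; lra.
have [|G [PG Gmax]] := @Zorn_bigcup _ (dominated_graph x0).
  move=> F FP totF; split.
  - move=> a x y r s [A FA Ax] [B FB By].
    have [sAB|sBA] := totF _ _ FA FB.
      by exists B => //; have [Bl _ _] := FP _ FB; apply: Bl => //; exact: sAB.
    by exists A => //; have [Al _ _] := FP _ FA; apply: Al => //; exact: sBA.
  - by move=> x r [A FA Ax]; have [_ Aq _] := FP _ FA; exact: Aq.
  - by move=> [u [A FA Au]]; exists A => //; have [_ _ A0] := FP _ FA; apply: A0; exists u.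
have Gn0 : G !=set0.
  apply/set0P/negP => /eqP G0.
  (* The line through [x0] with slope [q x0] is admissible, so the empty graph is not maximal. *)
  pose B : set (V * R) := [set u | exists a, u = (a *: x0, a * q x0)].
  have B1 : B (x0, q x0) by exists 1; rewrite scale1r mul1r.
  apply: (Gmax B).
    by rewrite G0; split=> // /(_ _ B1).
  split=> //.
    move=> a x y r s [b [-> ->]] [c [-> ->]]; exists (a * b + c).
    by rewrite scalerDl mulrDl scalerA mulrA.
  move=> x r [a [-> ->]]; rewrite q_hom.
  by rewrite ler_wpM2r// ler_norm.
have [Gl Gq Gx0] := PG.
have G0 : G (0, 0).
  have [[y r] Gy] := Gn0.
  by have := Gl (-1) _ _ _ _ Gy Gy; rewrite scaleN1r mulN1r !addNr.
have Gtot x : exists r, G (x, r).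
  apply: contrapT => nGx.
  have [c Gc] := dominated_graph_extend x PG Gn0.
  pose B : set (V * R) := [set u | exists y r a, G (y, r) /\ u = (y + a *: x, r + a * c)].
  have BG : G `<=` B by move=> [y r] Gy; exists y, r, 0; rewrite scale0r mul0r !addr0.
  apply: (Gmax B).
    split=> // /(_ (x, c)) BGx; apply: nGx; exists c; apply: BGx.
    by exists 0, 0, 1; rewrite scale1r mul1r !add0r.
  split.
  - move=> a _ _ _ _ [y [r [b [Gy [-> ->]]]]] [z [s [d [Gz [-> ->]]]]].
    exists (a *: y + z), (a * r + s), (a * b + d); split; first exact: Gl.
    rewrite !scalerDr !scalerDl !mulrDr !mulrDl scalerA !mulrA.
    by congr pair; rewrite addrACA.
  - by move=> _ _ [y [r [a [Gy [-> ->]]]]]; exact: Gc.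
  - by move=> _; apply: BG; exact: Gx0.
have Gfun x r s : G (x, r) -> G (x, s) -> r = s.
  move=> Gr Gs; apply/eqP; rewrite -subr_eq0; apply/eqP.
  apply: (dominated_graph_functional PG).
  by have := Gl (-1) _ _ _ _ Gs Gr; rewrite scaleN1r mulN1r addNr addrC.
have [phi Gphi] := choice Gtot.
exists phi; split.
- by move=> a x y; apply: (Gfun (a *: x + y)) => //; exact: Gl.
- by move=> x; exact: Gq.
- exact: (Gfun x0) (Gphi _) (Gx0 _).
Qed.

End HahnBanach.

(** * Real vector spaces with a system of seminorms *)

Section SeminormedSpaces.
Variables (R : realType) (V : lmodType R).
Implicit Types (Q : set (V -> R)) (G : set (V * V)).

Definition tends Q (T : Type) (Fl : set_system T) (u : T -> V) (l : V) :=
  forall q e, Q q -> 0 < e -> \forall x \near Fl, q (u x - l) < e.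

(** Stability under sums and scaling lets a single seminorm do the work of finitely many in every
    estimate. Completeness is that of sequences. *)
Record seminorm_system Q : Prop := SeminormSystem {
  sem_tri : forall q x y, Q q -> q (x + y) <= q x + q y;
  sem_hom : forall q a x, Q q -> q (a *: x) = `|a| * q x;
  sem_add : forall q1 q2, Q q1 -> Q q2 -> Q (fun x => q1 x + q2 x);
  sem_scale : forall c q, 0 <= c -> Q q -> Q (fun x => c * q x);
  sem_sep : forall x, (forall q, Q q -> q x = 0) -> x = 0;
  sem_complete : forall u : nat -> V,
    (forall q e, Q q -> 0 < e -> \forall m \near \oo,
      forall n, (m <= n)%N -> q (u n - u m) < e) ->
    exists l, tends Q \oo u l }.

Definition functional Q (phi : V -> R) :=
  (forall a x y, phi (a *: x + y) = a * phi x + phi y) /\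
  exists2 q, Q q & forall x, phi x <= q x.

Definition weakly_tends Q (T : Type) (Fl : set_system T) (u : T -> V) (l : V) :=
  forall phi, functional Q phi -> phi (u x) @[x --> Fl] --> phi l.

(** One seminorm measures both coordinates; as [Q] is stable under sums, this is the closure in the
    product. *)
Definition sem_closure Q G : set (V * V) :=
  [set u | forall q e, Q q -> 0 < e ->
    exists2 v, G v & q (u.1 - v.1) < e /\ q (u.2 - v.2) < e].

Definition sem_dense Q (A : set V) :=
  forall q x e, Q q -> 0 < e -> exists2 a, A a & q (x - a) < e.

Definition subspace_rel G :=
  G (0, 0) /\ forall a x y z w, G (x, y) -> G (z, w) -> G (a *: x + z, a *: y + w).

Variable Q : set (V -> R).
Hypothesis QV : seminorm_system Q.

Lemma sem0 q : Q q -> q 0 = 0.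
Proof. by move=> Qq; rewrite -(scale0r (0 : V)) (sem_hom QV)// normr0 mul0r. Qed.

Lemma semN q x : Q q -> q (- x) = q x.
Proof. by move=> Qq; rewrite -scaleN1r (sem_hom QV)// normrN1 mul1r. Qed.

Lemma sem_ge0 q x : Q q -> 0 <= q x.
Proof.
move=> Qq; have := sem_tri QV x (- x) Qq.
by rewrite subrr sem0// semN//; lra.
Qed.

Lemma semBC q x y : Q q -> q (x - y) = q (y - x).
Proof. by move=> Qq; rewrite -semN// opprB. Qed.

Lemma semB q x y : Q q -> q (x - y) <= q x + q y.
Proof. by move=> Qq; rewrite -[q y]semN//; exact: (sem_tri QV). Qed.

Lemma sem_dist q y x z : Q q -> q (x - z) <= q (x - y) + q (y - z).
Proof. by move=> Qq; rewrite -[x - z](subrKA y); exact: (sem_tri QV). Qed.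

Lemma sem_le q x y : Q q -> q x <= q (x - y) + q y.
Proof. by move=> Qq; rewrite -{1}[x](subrK y); exact: (sem_tri QV). Qed.

Lemma sem_sum q (I : Type) (r : seq I) (P : pred I) (E : I -> V) : Q q ->
  q (\sum_(i <- r | P i) E i) <= \sum_(i <- r | P i) q (E i).
Proof.
move=> Qq; elim/big_ind2 : _ => //; first by rewrite sem0.
by move=> x a y b xa yb; apply: le_trans (sem_tri QV _ _ Qq) _; exact: lerD.
Qed.

Lemma sem_sum_const q (n : nat) (E : 'I_n -> V) c : Q q ->
  (forall i, q (E i) <= c) -> q (\sum_(i < n) E i) <= n%:R * c.
Proof.
move=> Qq Ec; apply: le_trans (sem_sum _ _ _ Qq) _.
apply: le_trans (ler_sum _ (fun i _ => Ec i)) _.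
by rewrite sumr_const card_ord mulr_natl.
Qed.

Lemma tends_unique (T : Type) (Fl : set_system T) {FF : ProperFilter Fl}
    (u : T -> V) l1 l2 : tends Q Fl u l1 -> tends Q Fl u l2 -> l1 = l2.
Proof.
move=> u1 u2; apply/eqP; rewrite -subr_eq0; apply/eqP.
apply: (sem_sep QV) => q Qq; apply/eqP; rewrite -[_ == _]negbK; apply/negP => q0.
have qgt0 : 0 < q (l1 - l2) by rewrite lt_neqAle eq_sym q0 sem_ge0.
have e0 : 0 < q (l1 - l2) / 2 by lra.
have [x [h1 h2]] : exists x, q (u x - l1) < q (l1 - l2) / 2 /\ q (u x - l2) < q (l1 - l2) / 2.
  by apply: (@filter_ex _ Fl); apply: filterI; [exact: u1|exact: u2].
have := sem_dist (u x) l1 l2 Qq; rewrite (semBC l1 (u x))//; lra.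
Qed.

Lemma tends_cst (T : Type) (Fl : set_system T) {FF : Filter Fl} (l : V) :
  tends Q Fl (fun=> l) l.
Proof. by move=> q e Qq e0; near=> x; rewrite subrr sem0.
Unshelve. all: by end_near. Qed.

Lemma tendsD (T : Type) (Fl : set_system T) {FF : Filter Fl} (u v : T -> V) l m :
  tends Q Fl u l -> tends Q Fl v m -> tends Q Fl (fun x => u x + v x) (l + m).
Proof.
move=> ul vm q e Qq e0; near=> x.
have -> : u x + v x - (l + m) = (u x - l) + (v x - m) by rewrite opprD addrACA.
apply: le_lt_trans (sem_tri QV _ _ Qq) _.
have h1 : q (u x - l) < e / 2 by near: x; apply: ul => //; lra.
have h2 : q (v x - m) < e / 2 by near: x; apply: vm => //; lra.
lra.
Unshelve. all: by end_near. Qed.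

Lemma tendsZ (T : Type) (Fl : set_system T) {FF : Filter Fl} (u : T -> V) l a :
  tends Q Fl u l -> tends Q Fl (fun x => a *: u x) (a *: l).
Proof.
move=> ul q e Qq e0; near=> x.
rewrite -scalerBr (sem_hom QV)//.
have a1 : 0 < `|a| + 1 by rewrite ltr_wpDl.
have h1 : q (u x - l) < e / (`|a| + 1) by near: x; apply: ul => //; exact: divr_gt0.
apply: (@le_lt_trans _ _ ((`|a| + 1) * q (u x - l))).
  by rewrite ler_wpM2r ?sem_ge0//; lra.
by rewrite mulrC -ltr_pdivlMr.
Unshelve. all: by end_near. Qed.

Lemma tends_le (T : Type) (Fl : set_system T) {FF : ProperFilter Fl} (u : T -> V) l q c :
  Q q -> tends Q Fl u l -> (\forall x \near Fl, q (u x) <= c) -> q l <= c.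
Proof.
move=> Qq ul uc; apply/ler_addgt0Pr => e e0.
have [x [h1 h2]] : exists x, q (u x - l) < e /\ q (u x) <= c.
  by apply: (@filter_ex _ Fl); apply: filterI => //; exact: ul.
have := sem_le l (u x) Qq; rewrite (semBC l)//; lra.
Qed.

Lemma functional_linear phi : functional Q phi -> linear (phi : V -> R^o).
Proof. by case. Qed.

Lemma functionalB phi x y : functional Q phi -> phi (x - y) = phi x - phi y.
Proof. by move/functional_linear => h; exact: (linear_funB h). Qed.

Lemma functionalZ phi a x : functional Q phi -> phi (a *: x) = a * phi x.
Proof. by move/functional_linear => h; exact: (linear_funZ h). Qed.

Lemma functionalD phi x y : functional Q phi -> phi (x + y) = phi x + phi y.
Proof. by move/functional_linear => h; exact: (linear_funD h). Qed.

Lemma functionalN phi x : functional Q phi -> phi (- x) = - phi x.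
Proof. by move/functional_linear => h; exact: (linear_funN h). Qed.

Lemma functional_abs phi : functional Q phi ->
  exists2 q, Q q & forall x, `|phi x| <= q x.
Proof.
move=> fphi; have [_ [q Qq phiq]] := fphi; exists q => // x.
rewrite ler_norml phiq andbT.
have := phiq (- x); rewrite functionalN// (semN _ Qq); lra.
Qed.

Lemma tends_weakly (T : Type) (Fl : set_system T) {FF : Filter Fl} (u : T -> V) l :
  tends Q Fl u l -> weakly_tends Q Fl u l.
Proof.
move=> ul phi fphi; have [q Qq phiq] := functional_abs fphi.
apply/cvgrPdist_lt => e e0; near=> x.
rewrite distrC -functionalB//; apply: le_lt_trans (phiq _) _.
by near: x; exact: ul.
Unshelve. all: by end_near. Qed.

Lemma functional_norming q x : Q q ->
  exists phi, [/\ functional Q phi, forall y, `|phi y| <= q y & phi x = q x].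
Proof.
move=> Qq.
have [//||phi [pl pq px]] := @hahn_banach R V q _ _ x.
- by move=> *; exact: (sem_tri QV).
- by move=> *; exact: (sem_hom QV).
have fphi : functional Q phi by split => //; exists q.
exists phi; split => // y; rewrite ler_norml pq andbT.
by have := pq (- y); rewrite (functionalN _ fphi) (semN _ Qq); lra.
Qed.

Lemma weakly_tends_unique (T : Type) (Fl : set_system T) {FF : ProperFilter Fl}
    (u : T -> V) l1 l2 :
  weakly_tends Q Fl u l1 -> weakly_tends Q Fl u l2 -> l1 = l2.
Proof.
move=> u1 u2; apply/eqP; rewrite -subr_eq0; apply/eqP.
apply: (sem_sep QV) => q Qq.
have [phi [fphi _ <-]] := functional_norming (l1 - l2) Qq.
rewrite functionalB//; apply/eqP; rewrite subr_eq0; apply/eqP.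
exact: cvg_unique (u1 _ fphi) (u2 _ fphi).
Qed.

(** Seminorms are weakly lower semicontinuous: a functional norming the limit is bounded by [q]
    along the family. *)
Lemma weakly_tends_le (T : Type) (Fl : set_system T) {FF : ProperFilter Fl}
    (u : T -> V) l q c :
  Q q -> weakly_tends Q Fl u l ->
  (forall e, 0 < e -> \forall x \near Fl, q (u x) <= c + e) -> q l <= c.
Proof.
move=> Qq ul uc; apply/ler_addgt0Pr => e e0.
have [phi [fphi phiq <-]] := functional_norming l Qq.
apply: (closed_cvg (fun r => r <= c + e)) (ul _ fphi); first exact: closed_le.
apply: filterS (uc _ e0) => x; apply: le_trans.
exact: le_trans (ler_norm _) (phiq _).
Qed.

(* Hahn-Banach separation in the product, for the distance to [G]. *)
Lemma sem_closure_separation G x y : subspace_rel G ->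
  (forall eta xi, functional Q eta -> functional Q xi ->
    (forall u, G u -> eta u.1 + xi u.2 = 0) -> eta x + xi y = 0) ->
  sem_closure Q G (x, y).
Proof.
move=> [G0 Gl] ann q e Qq e0; apply: contrapT => far.
pose P (u : V * V) := q u.1 + q u.2.
have P_ge0 u : 0 <= P u by rewrite addr_ge0 ?sem_ge0.
have P_tri u v : P (u + v) <= P u + P v.
  rewrite /P/= addrACA; apply: lerD; exact: (sem_tri QV).
have P_hom a u : P (a *: u) = `|a| * P u by rewrite /P/= !(sem_hom QV)// mulrDr.
pose D z := [set P (z - m) | m in G].
have Dn0 z : D z !=set0 by exists (P (z - (0, 0))), (0, 0).
have Dlb z : lbound (D z) 0 by move=> _ [m _ <-]; exact: P_ge0.
(* The distance to [G] measured by [P], a seminorm because [G] is a subspace. *)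
pose d z := inf (D z).
have d_le z m : G m -> d z <= P (z - m).
  by move=> Gm; apply: ge_inf; [exists 0; exact: Dlb | exists m].
have d_ge z c : (forall m, G m -> c <= P (z - m)) -> c <= d z.
  by move=> h; apply: lb_le_inf => // _ [m Gm <-]; exact: h.
have GZ a m : G m -> G (a *: m).
  by case: m => m1 m2 Gm; have := Gl a _ _ _ _ Gm G0; rewrite !addr0.
have GD m n : G m -> G n -> G (m + n).
  by case: m n => m1 m2 [n1 n2] Gm Gn; have := Gl 1 _ _ _ _ Gm Gn; rewrite !scale1r.
have d_tri u v : d (u + v) <= d u + d v.
  rewrite -lerBlDr; apply: (d_ge) => m Gm.
  rewrite lerBlDr [leRHS]addrC -lerBlDr; apply: (d_ge) => n Gn; rewrite lerBlDr.
  apply: le_trans (d_le _ _ (GD _ _ Gn Gm)) _.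
  by rewrite (addrC u) opprD addrACA; exact: P_tri.
have d_hom1 a u : a != 0 -> d (a *: u) <= `|a| * d u.
  move=> a0; rewrite -ler_pdivrMl ?normr_gt0//; apply: (d_ge) => m Gm.
  rewrite ler_pdivrMl ?normr_gt0// -P_hom scalerBr.
  exact: d_le (GZ a m Gm).
have d_hom a u : d (a *: u) = `|a| * d u.
  have [->|a0] := eqVneq a 0.
    rewrite scale0r normr0 mul0r; apply/eqP; rewrite eq_le; apply/andP; split.
      by apply: le_trans (d_le _ _ G0) _; rewrite subr0 /P/= !sem0// addr0.
    by apply: d_ge.
  apply/eqP; rewrite eq_le d_hom1//=.
  rewrite -ler_pdivlMl ?normr_gt0// -normfV.
  by rewrite -{1}[u](scalerK a0); apply: d_hom1; rewrite invr_eq0.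
(* [phi] attains [d] at [(x, y)] and vanishes on [G], as [d] does there. Its two components
   therefore annihilate [G], and the hypothesis yields [d (x, y) = 0], whereas [far] gives
   [e <= d (x, y)]. *)
have [phi [pl pd pxy]] := hahn_banach d_tri d_hom (x, y).
have phiP u : phi u <= P u.
  by apply: le_trans (pd u) _; rewrite -{2}[u]subr0; exact: d_le.
have phi_split a b : phi (a, b) = phi (a, 0) + phi (0, b).
  rewrite -(linear_funD pl); congr phi.
  by apply: (congr2 pair); rewrite /= ?addr0 ?add0r.
have feta : functional Q (fun a => phi (a, 0)).
  split; last by exists q => // a; apply: le_trans (phiP _) _; rewrite /P/= sem0// addr0.
  move=> a u v; rewrite -[RHS]pl; congr phi.
  by apply: (congr2 pair); rewrite //= scaler0 addr0.
have fxi : functional Q (fun b => phi (0, b)).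
  split; last by exists q => // a; apply: le_trans (phiP _) _; rewrite /P/= sem0// add0r.
  move=> a u v; rewrite -[RHS]pl; congr phi.
  by apply: (congr2 pair); rewrite //= scaler0 addr0.
have dG u : G u -> d u <= 0.
  by move=> Gu; apply: le_trans (d_le _ _ Gu) _; rewrite subrr /P/= !sem0// addr0.
have := ann _ _ feta fxi; rewrite -phi_split pxy => dxy0.
have : e <= d (x, y).
  apply: d_ge => -[m1 m2] Gm; rewrite leNgt; apply/negP => lte; apply: far.
  exists (m1, m2) => //=; move: lte; rewrite /P/=.
  have := sem_ge0 (x - m1) Qq; have := sem_ge0 (y - m2) Qq.
  by split; lra.
rewrite dxy0 ?leNgt ?e0// => -[u1 u2] Gu /=; rewrite -phi_split.
apply/eqP; rewrite eq_le (le_trans (pd _) (dG _ Gu))/=.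
have := le_trans (pd _) (dG _ (GZ (-1) _ Gu)).
by rewrite scaleN1r (linear_funN pl) oppr_le0.
Qed.

Lemma sem_closure_idem G : sem_closure Q (sem_closure Q G) `<=` sem_closure Q G.
Proof.
move=> u uG q e Qq e0.
have e20 : 0 < e / 2 by lra.
have [v vG [uv1 uv2]] := uG _ _ Qq e20.
have [w wG [vw1 vw2]] := vG _ _ Qq e20.
exists w => //; split.
  by apply: le_lt_trans (sem_dist v.1 _ _ Qq) _; lra.
by apply: le_lt_trans (sem_dist v.2 _ _ Qq) _; lra.
Qed.

Lemma sem_closure_sub G : G `<=` sem_closure Q G.
Proof. by move=> u Gu q e Qq e0; exists u => //; rewrite !subrr sem0. Qed.

Lemma sem_closure_mono G1 G2 : G1 `<=` G2 -> sem_closure Q G1 `<=` sem_closure Q G2.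
Proof. by move=> G12 u uG q e Qq e0; have [v /G12 Gv] := uG _ _ Qq e0; exists v. Qed.

Lemma sem_closure_subspace G : subspace_rel G -> subspace_rel (sem_closure Q G).
Proof.
move=> [G0 Gl]; split; first exact: sem_closure_sub.
move=> a x y z w xyG zwG q e Qq e0.
have a1 : 0 < `|a| + 1 by rewrite ltr_wpDl.
have e1 : 0 < e / 2 / (`|a| + 1) by rewrite divr_gt0//; lra.
have e2 : 0 < e / 2 by lra.
have [[x' y'] G1 [/= hx hy]] := xyG _ _ Qq e1.
have [[z' w'] G2 [/= hz hw]] := zwG _ _ Qq e2.
exists (a *: x' + z', a *: y' + w'); first exact: Gl.
have aux (b b' c c' : V) : q (b - b') < e / 2 / (`|a| + 1) -> q (c - c') < e / 2 ->
    q (a *: b + c - (a *: b' + c')) < e.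
  move=> hb hc; rewrite opprD addrACA -scalerBr.
  apply: le_lt_trans (sem_tri QV _ _ Qq) _; rewrite (sem_hom QV)//.
  suff : `|a| * q (b - b') <= e / 2 by lra.
  apply: (@le_trans _ _ ((`|a| + 1) * q (b - b'))).
    by rewrite ler_wpM2r ?sem_ge0//; lra.
  by rewrite mulrC -ler_pdivlMr// ltW.
by split; exact: aux.
Qed.

Lemma sem_closure_tends G (T : Type) (Fl : set_system T) {FF : ProperFilter Fl}
    (u v : T -> V) x y : (\forall t \near Fl, sem_closure Q G (u t, v t)) ->
  tends Q Fl u x -> tends Q Fl v y -> sem_closure Q G (x, y).
Proof.
move=> uvG ux vy; apply: sem_closure_idem => q e Qq e0.
have [t [h0 [h1 h2]]] : exists t, sem_closure Q G (u t, v t) /\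
    q (u t - x) < e /\ q (v t - y) < e.
  by apply: (@filter_ex _ Fl); do 2?apply: filterI; [|exact: ux|exact: vy].
by exists (u t, v t); rewrite //= semBC// [q (y - _)]semBC.
Qed.

(** A closed subspace of the product is weakly closed: a pair of functionals annihilating it also
    annihilates the weak limit. *)
Lemma sem_closure_weakly G (T : Type) (Fl : set_system T) {FF : ProperFilter Fl}
    (u v : T -> V) x y : subspace_rel G -> (forall t, sem_closure Q G (u t, v t)) ->
  weakly_tends Q Fl u x -> weakly_tends Q Fl v y -> sem_closure Q G (x, y).
Proof.
move=> Gs uvG ux vy; apply: sem_closure_idem.
apply: sem_closure_separation; first exact: sem_closure_subspace.
move=> eta xi feta fxi ann.
have := cvgD (ux _ feta) (vy _ fxi).
have -> : (fun t => eta (u t)) + (fun t => xi (v t)) = (fun=> 0).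
  by apply/funext => t; exact: (ann (u t, v t)).
move=> h; have h0 : (fun=> 0 : R) @ Fl --> (0 : R) by exact: cvg_cst.
exact: (cvg_unique (@Rhausdorff R) (h _) h0).
Qed.

Lemma sem_closure_functional G eta xi : functional Q eta -> functional Q xi ->
  (forall u, G u -> eta u.1 + xi u.2 = 0) ->
  forall u, sem_closure Q G u -> eta u.1 + xi u.2 = 0.
Proof.
move=> feta fxi ann u uG.
have [q1 Qq1 etaq] := functional_abs feta.
have [q2 Qq2 xiq] := functional_abs fxi.
apply/eqP; rewrite -normr_eq0 eq_le normr_ge0 andbT.
apply/ler_addgt0Pr => e e0; rewrite add0r.
have e2 : 0 < e / 2 by lra.
have [v Gv [/= h1 h2]] := uG _ _ (sem_add QV Qq1 Qq2) e2.
have -> : eta u.1 + xi u.2 = eta (u.1 - v.1) + xi (u.2 - v.2).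
  rewrite !functionalB//; have := ann _ Gv; lra.
apply: le_trans (ler_normD _ _) _.
have := etaq (u.1 - v.1); have := xiq (u.2 - v.2).
have := sem_ge0 (u.1 - v.1) Qq2; have := sem_ge0 (u.2 - v.2) Qq1.
lra.
Qed.

End SeminormedSpaces.

(** * Chernoff approximation by the effective derivative *)

Section Steps.
Variable R : realType.
Implicit Types h s : R.

Definition steps h s := Num.truncn (s / h).

Lemma steps_le h s : 0 < h -> 0 <= s -> (steps h s)%:R * h <= s.
Proof.
move=> h0 s0; rewrite -ler_pdivlMr//.
by have /andP[] := truncn_itv (divr_ge0 s0 (ltW h0)).
Qed.

Lemma steps_gt h s : 0 < h -> 0 <= s -> s < (steps h s)%:R * h + h.
Proof.
move=> h0 s0; have /andP[_] := truncn_itv (divr_ge0 s0 (ltW h0)).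
by rewrite ltr_pdivrMr// -natr1 mulrDl mul1r.
Qed.

Lemma steps0 h : steps h 0 = 0%N.
Proof. by rewrite /steps mul0r truncn0. Qed.

Lemma le_steps h a b : 0 < h -> a <= b -> (steps h a <= steps h b)%N.
Proof. by move=> h0 ab; apply: le_truncn; rewrite ler_pM2r// invr_gt0. Qed.

Lemma stepsB_le h a b : 0 < h -> 0 <= a -> a <= b ->
  (steps h b - steps h a)%:R * h <= b - a + h.
Proof.
move=> h0 a0 ab; rewrite natrB ?le_steps// mulrBl.
have := steps_gt h0 a0; have := steps_le h0 (le_trans a0 ab); lra.
Qed.

Lemma stepsB_dist h a b : 0 < h -> 0 <= a -> a <= b ->
  `|b - a - (steps h b - steps h a)%:R * h| <= h.
Proof.
move=> h0 a0 ab; rewrite natrB ?le_steps// mulrBl ler_norml.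
have := steps_gt h0 a0; have := steps_le h0 a0.
have := steps_gt h0 (le_trans a0 ab); have := steps_le h0 (le_trans a0 ab).
by move=> *; apply/andP; split; lra.
Qed.

End Steps.

Section PowerBoundedFamilies.
Variables (R : realType) (V : lmodType R) (Q : set (V -> R)) (F : R -> V -> V).
Hypothesis QV : seminorm_system Q.

(** Equicontinuity of the iterates in terms of [Q]: one bound for all powers whose total time [m h]
    is at most [S]. *)
Definition power_bounded := forall S q, Q q ->
  exists2 q', Q q' & forall h m x, 0 <= h -> m%:R * h <= S ->
    q (iter m (F h) x) <= q' x.

(** Multiplied by [h], this is the left Riemann sum for the integral of the orbit of [x] over
    [[0, m h]]. *)
Definition geometric_sum h m x := \sum_(j < m) iter j (F h) x.

Definition mef_graph : set (V * V) := [set u | exists2 f_ : R -> V,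
  tends Q 0^'+ f_ u.1 &
  tends Q 0^'+ (fun h => h^-1 *: (F h (f_ h) - f_ h)) u.2].

Hypothesis F_linear : forall h, 0 <= h -> linear (F h).
Hypothesis F_bounded : power_bounded.

Lemma geometric_sumB h m x y : 0 <= h ->
  geometric_sum h m x - geometric_sum h m y = geometric_sum h m (x - y).
Proof.
move=> h0; rewrite /geometric_sum -sumrB; apply: eq_bigr => j _.
by rewrite (linear_funB (iter_linear j (F_linear h0))).
Qed.

Lemma geometric_sum_bounded S q : Q q -> exists2 q', Q q' &
  forall h m x, 0 <= h -> m%:R * h <= S ->
    q (h *: geometric_sum h m x) <= m%:R * h * q' x /\
    q (iter m (F h) x) <= q' x.
Proof.
move=> Qq; have [q' Qq' Fq'] := F_bounded S Qq; exists q' => // h m x h0 mh.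
split; last exact: Fq'.
rewrite (sem_hom QV)// ger0_norm// [_ * h]mulrC -mulrA ler_wpM2l//.
apply: (sem_sum_const QV Qq) => j; apply: Fq' => //.
by apply: le_trans mh; rewrite ler_wpM2r// ler_nat ltnW.
Qed.

Lemma near0_pos : \forall h \near 0^'+, (0 : R) < h.
Proof. exact: nbhs_right_gt. Qed.

(** Telescoping makes the identity exact with [f_ h] and its difference quotient in place of [x] and
    [w]; power boundedness controls both replacements uniformly in [m]. *)
Lemma iter_mef S q e x w : 0 <= S -> mef_graph (x, w) -> Q q -> 0 < e ->
  \forall h \near 0^'+, forall m, m%:R * h <= S ->
    q (iter m (F h) x - x - h *: geometric_sum h m w) <= e.
Proof.
move=> S0 [f_ fx Dw] Qq e0.
have [q' Qq' Fq'] := geometric_sum_bounded S Qq.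
have e3 : 0 < e / 3 by lra.
have eS : 0 < e / 3 / (S + 1) by apply: divr_gt0 => //; lra.
near=> h => m mh.
have h0 : 0 < h by near: h; exact: near0_pos.
have hn0 : h != 0 by rewrite gt_eqF.
have Fl := F_linear (ltW h0).
set D := h^-1 *: (F h (f_ h) - f_ h).
have -> : iter m (F h) x - x - h *: geometric_sum h m w =
    iter m (F h) (x - f_ h) + (f_ h - x) + h *: geometric_sum h m (D - w).
  rewrite -geometric_sumB ?(ltW h0)// scalerBr.
  have -> : h *: geometric_sum h m D = iter m (F h) (f_ h) - f_ h.
    rewrite (iter_subE _ _ Fl) /geometric_sum scaler_sumr; apply: eq_bigr => j _.
    by rewrite -(linear_funZ (iter_linear j Fl)) scalerA divff// scale1r.
  by rewrite (linear_funB (iter_linear m Fl)); lmod R.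
apply: le_trans (sem_tri QV _ _ Qq) _.
have [b1 _] := Fq' h m (D - w) (ltW h0) mh.
have [_ b2] := Fq' h m (x - f_ h) (ltW h0) mh.
have c1 : q (f_ h - x) < e / 3 by near: h; exact: fx.
have c2 : q' (f_ h - x) < e / 3 by near: h; exact: fx.
have c3 : q' (D - w) < e / 3 / (S + 1) by rewrite /D; near: h; exact: Dw.
have c4 : m%:R * h * q' (D - w) <= e / 3.
  apply: (@le_trans _ _ ((S + 1) * q' (D - w))).
    by rewrite ler_wpM2r ?(sem_ge0 QV)//; lra.
  by rewrite mulrC -ler_pdivlMr ?(ltW c3)//; lra.
rewrite (semBC QV) // in c2.
have := sem_tri QV (iter m (F h) (x - f_ h)) (f_ h - x) Qq; lra.
Unshelve. all: by end_near. Qed.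

(** Both sides depend equicontinuously on [(x, w)] over total times at most [S], so the estimate
    survives the closure. This gives [F] a hold on the closure of Z. *)
Lemma iter_mef_closure S q e x w :
  0 <= S -> sem_closure Q mef_graph (x, w) -> Q q -> 0 < e ->
  \forall h \near 0^'+, forall m, m%:R * h <= S ->
    q (iter m (F h) x - x - h *: geometric_sum h m w) <= e.
Proof.
move=> S0 xw Qq e0.
have [q' Qq' Fq'] := geometric_sum_bounded S Qq.
have e4 : 0 < e / 4 by lra.
have eS : 0 < e / 4 / (S + 1) by apply: divr_gt0 => //; lra.
have emin : 0 < Num.min (e / 4) (e / 4 / (S + 1)) by rewrite lt_min e4.
have [[x' w'] M' [/= dx dw]] := xw _ _ (sem_add QV Qq Qq') emin.
near=> h => m mh.
have h0 : 0 < h by near: h; exact: near0_pos.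
have Fl := F_linear (ltW h0).
move: dx dw; rewrite !lt_min => /andP[dx1 dx2] /andP[dw1 dw2].
have -> : iter m (F h) x - x - h *: geometric_sum h m w =
    iter m (F h) (x - x') - (x - x') - h *: geometric_sum h m (w - w') +
    (iter m (F h) x' - x' - h *: geometric_sum h m w').
  by rewrite -geometric_sumB ?(ltW h0)// (linear_funB (iter_linear m Fl)); lmod R.
have /(_ m mh) b0 : forall m, m%:R * h <= S ->
    q (iter m (F h) x' - x' - h *: geometric_sum h m w') <= e / 4.
  by near: h; apply: iter_mef.
have [_ b1] := Fq' h m (x - x') (ltW h0) mh.
have [b2 _] := Fq' h m (w - w') (ltW h0) mh.
have c4 : m%:R * h * q' (w - w') <= e / 4.
  apply: (@le_trans _ _ ((S + 1) * q' (w - w'))).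
    by rewrite ler_wpM2r ?(sem_ge0 QV)//; lra.
  rewrite mulrC -ler_pdivlMr; last lra.
  by have := sem_ge0 QV (w - w') Qq; lra.
apply: le_trans (sem_tri QV _ _ Qq) _.
have := semB QV (iter m (F h) (x - x') - (x - x')) (h *: geometric_sum h m (w - w')) Qq.
have := semB QV (iter m (F h) (x - x')) (x - x') Qq.
have := sem_ge0 QV (x - x') Qq; have := sem_ge0 QV (x - x') Qq'.
lra.
Unshelve. all: by end_near. Qed.

Hypothesis mef_dense : sem_dense Q [set x | exists w, mef_graph (x, w)].

(** For [x'] in the domain the displacement is at most [m h q' w'], up to an error vanishing with
    [h]; density and power boundedness carry this to every [x]. Limits of the iterates inherit
    strong continuity at time 0 from it. *)
Lemma iter_small_time q e x : Q q -> 0 < e ->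
  exists2 d, 0 < d & \forall h \near 0^'+, forall m, m%:R * h <= d ->
    q (iter m (F h) x - x) <= e.
Proof.
move=> Qq e0.
have [q' Qq' Fq'] := geometric_sum_bounded 1 Qq.
have e4 : 0 < e / 4 by lra.
have [x' [w' M'] /= dx] := mef_dense x (sem_add QV Qq Qq') e4.
have w1 : 0 < q' w' + 1 by rewrite ltr_wpDl// (sem_ge0 QV).
exists (Num.min 1 (e / 4 / (q' w' + 1))).
  by rewrite lt_min ltr01/= divr_gt0.
near=> h => m; rewrite le_min => /andP[mh1 mh].
have h0 : 0 < h by near: h; exact: near0_pos.
have Fl := F_linear (ltW h0).
have -> : iter m (F h) x - x = iter m (F h) (x - x') - (x - x') +
    ((iter m (F h) x' - x' - h *: geometric_sum h m w') + h *: geometric_sum h m w').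
  by rewrite (linear_funB (iter_linear m Fl)); lmod R.
have /(_ m mh1) b0 : forall m, m%:R * h <= 1 ->
    q (iter m (F h) x' - x' - h *: geometric_sum h m w') <= e / 4.
  by near: h; apply: iter_mef.
have [_ b1] := Fq' h m (x - x') (ltW h0) mh1.
have [b2 _] := Fq' h m w' (ltW h0) mh1.
have c4 : m%:R * h * q' w' <= e / 4.
  apply: (@le_trans _ _ (m%:R * h * (q' w' + 1))).
    by rewrite ler_wpM2l ?mulr_ge0 ?(ltW h0)//; lra.
  by rewrite -ler_pdivlMr.
apply: le_trans (sem_tri QV _ _ Qq) _.
have := sem_tri QV (iter m (F h) x' - x' - h *: geometric_sum h m w') (h *: geometric_sum h m w') Qq.
have := semB QV (iter m (F h) (x - x')) (x - x') Qq.
have := sem_ge0 QV (x - x') Qq; have := sem_ge0 QV (x - x') Qq'.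
lra.
Unshelve. all: by end_near. Qed.

End PowerBoundedFamilies.

(** * Chernoff's estimate for inhomogeneous equations *)

Section ChernoffApproximation.
Variables (R : realType) (V : lmodType R) (Q : set (V -> R)) (F : R -> V -> V).
Hypothesis QV : seminorm_system Q.
Hypothesis F_linear : forall h, 0 <= h -> linear (F h).
Hypothesis F_bounded : power_bounded Q F.
Hypothesis mef_dense : sem_dense Q [set x | exists w, mef_graph Q F (x, w)].

Let near0 := near0_pos R.

Lemma geometric_sum_near h m q c y : 0 <= h -> Q q ->
  (forall j, (j < m)%N -> q (iter j (F h) y - y) <= c) ->
  q (h *: geometric_sum F h m y - (m%:R * h) *: y) <= m%:R * h * c.
Proof.
move=> h0 Qq yc.
have -> : h *: geometric_sum F h m y - (m%:R * h) *: y =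
    h *: \sum_(j < m) (iter j (F h) y - y).
  by rewrite sumrB sumr_const card_ord scalerBr -(scaler_nat m y) scalerA mulrC.
rewrite (sem_hom QV)// ger0_norm// [_ * h]mulrC -mulrA ler_wpM2l//.
by apply: (sem_sum_const QV Qq) => j; exact: yc.
Qed.

(** When [(0, y)] lies in the closure, the Riemann sum of the orbit of [y] over [[0, d]] tends to 0
    with the step. For small [d] the orbit has hardly moved, so the same sum is close to [(m h) y]
    with [m h] close to [d]; hence [y] vanishes. *)
Lemma mef_closure_functional y : sem_closure Q (mef_graph Q F) (0, y) -> y = 0.
Proof.
move=> yM; apply: (sem_sep QV) => q Qq.
apply/eqP; rewrite eq_le (sem_ge0 QV)// andbT.
apply/ler_addgt0Pr => e e0; rewrite add0r.
have e4 : 0 < e / 4 by lra.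
have [d d0 small] := iter_small_time QV F_linear F_bounded mef_dense y Qq e4.
(* The condition [h <= d / 2] will give [m h >= d / 2], so [d e / 8] is at most [m h e / 4] and is
   absorbed on division by [m h]. *)
have de0 : 0 < d * e / 8 by apply: divr_gt0 => //; exact: mulr_gt0.
have approx := iter_mef_closure QV F_linear F_bounded (ltW d0) yM Qq de0.
have [h [h0 [h1 [h2 h3]]]] : exists h, 0 < h /\ h <= d / 2 /\
    (forall m, m%:R * h <= d -> q (iter m (F h) y - y) <= e / 4) /\
    (forall m, m%:R * h <= d ->
      q (iter m (F h) 0 - 0 - h *: geometric_sum F h m y) <= d * e / 8).
  apply: (@filter_ex _ 0^'+); near=> h; split; [|split; [|split]].
  - by near: h; exact: near0.
  - by near: h; apply: nbhs_right_ltW; lra.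
  - by near: h.
  - by near: h.
set m := steps h d.
have mh := steps_le h0 (ltW d0); have mh' := steps_gt h0 (ltW d0).
have /= := h3 _ mh.
rewrite (linear_fun0 (iter_linear _ (F_linear (ltW h0)))) subr0 sub0r (semN QV)// => c1.
have c2 : q (h *: geometric_sum F h m y - (m%:R * h) *: y) <= m%:R * h * (e / 4).
  apply: geometric_sum_near => //; first exact: ltW.
  move=> j jm; apply: h2; apply: le_trans mh.
  by rewrite ler_wpM2r ?(ltW h0)// ler_nat ltnW.
have c3 := sem_le QV ((m%:R * h) *: y) (h *: geometric_sum F h m y) Qq.
rewrite (semBC QV)// in c2.
rewrite {1}(sem_hom QV)// ger0_norm ?mulr_ge0 ?(ltW h0)// in c3.
have mh2 : d / 2 <= m%:R * h by rewrite /m; lra.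
have : m%:R * h * q y <= m%:R * h * e.
  have : d / 2 * e <= m%:R * h * e by rewrite ler_wpM2r// ltW.
  rewrite -/m in c1 *; lra.
by rewrite ler_pM2l//; lra.
Unshelve. all: by end_near. Qed.

Definition uniformly_continuous S (y : R -> V) := forall q e, Q q -> 0 < e ->
  exists2 d, 0 < d & forall a b, 0 <= a -> a <= b -> b <= S -> b - a <= d ->
    q (y b - y a) <= e.

Lemma ord_lower_bound n (d : 'I_n -> R) : (forall i, 0 < d i) ->
  exists2 c, 0 < c & forall i, c <= d i.
Proof.
move=> d0; exists (\big[Num.min/1]_(i < n) d i).
  by apply: lt_bigmin => // i _; exact: d0.
by move=> i; exact: bigmin_le.
Qed.

(** Uniform continuity reduces the curve to the finitely many points of a mesh, so one neighbourhood
    of [h = 0] serves all times [tau]. *)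
Lemma iter_small_time_curve S y q e : 0 <= S -> uniformly_continuous S y ->
  Q q -> 0 < e ->
  exists2 d, 0 < d & \forall h \near 0^'+, forall m tau, 0 <= tau <= S ->
    m%:R * h <= d -> q (iter m (F h) (y tau) - y tau) <= e.
Proof.
move=> S0 yS Qq e0.
have [q' Qq' Fq'] := geometric_sum_bounded QV F_bounded 1 Qq.
have e4 : 0 < e / 4 by lra.
have [d1 d10 yd1] := yS _ _ (sem_add QV Qq Qq') e4.
pose N := (steps d1 S).+1.
have small (i : 'I_N) := iter_small_time QV F_linear F_bounded mef_dense (y (i%:R * d1)) Qq e4.
have /choice[d dP] : forall i : 'I_N, exists c, 0 < c /\ \forall h \near 0^'+, forall m,
    m%:R * h <= c -> q (iter m (F h) (y (i%:R * d1)) - y (i%:R * d1)) <= e / 4.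
  by move=> i; have [c c0 ?] := small i; exists c.
have [c c0 cd] := ord_lower_bound (fun i => (dP i).1).
exists (Num.min 1 c); first by rewrite lt_min ltr01.
near=> h => m tau /andP[tau0 tauS]; rewrite le_min => /andP[mh1 mhc].
have h0 : 0 < h by near: h; exact: near0.
have iN : (steps d1 tau < N)%N by rewrite ltnS; exact: le_steps.
have all_small : forall (i : 'I_N) m, m%:R * h <= d i ->
    q (iter m (F h) (y (i%:R * d1)) - y (i%:R * d1)) <= e / 4.
  by near: h; apply: filter_forall => i; exact: (dP i).2.
have /= b1 := all_small (Ordinal iN) m (le_trans mhc (cd _)).
have t1 := steps_le d10 tau0; have t2 := steps_gt d10 tau0.
set t := (steps d1 tau)%:R * d1 in b1 t1 t2.
have /= b2 : q (y tau - y t) + q' (y tau - y t) <= e / 4.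
  apply: yd1 => //; last lra.
  by rewrite mulr_ge0// ltW.
have -> : iter m (F h) (y tau) - y tau = iter m (F h) (y tau - y t) - (y tau - y t) +
    (iter m (F h) (y t) - y t).
  by rewrite (linear_funB (iter_linear m (F_linear (ltW h0)))); lmod R.
have [_ b3] := Fq' h m (y tau - y t) (ltW h0) mh1.
apply: le_trans (sem_tri QV _ _ Qq) _.
have := semB QV (iter m (F h) (y tau - y t)) (y tau - y t) Qq; lra.
Unshelve. all: by end_near. Qed.

Definition uniformly_derivable S (v v' : R -> V) := forall q e, Q q -> 0 < e ->
  exists2 d, 0 < d & forall a b, 0 <= a -> a <= b -> b <= S -> b - a <= d ->
    q (v b - v a - (b - a) *: v' a) <= e * (b - a).

Lemma geometric_sumD h m d x : 0 <= h -> geometric_sum F h (m + d) x =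
  iter d (F h) (geometric_sum F h m x) + geometric_sum F h d x.
Proof.
move=> h0; rewrite addnC /geometric_sum big_split_ord/= addrC; congr (_ + _).
rewrite (linear_fun_sum (iter_linear d (F_linear h0))); apply: eq_bigr => j _.
by rewrite -iterD.
Qed.

(* The error is propagated along a coarse mesh [s / N] which is fixed before
   the step [h] of the iteration goes to 0. *)
Theorem chernoff_duhamel s (v w : R -> V) g : 0 <= s ->
  (forall tau, 0 <= tau <= s -> sem_closure Q (mef_graph Q F) (v tau, w tau)) ->
  uniformly_continuous s w ->
  uniformly_derivable s v (fun tau => w tau + g) ->
  tends Q 0^'+ (fun h => iter (steps h s) (F h) (v 0) +
    h *: geometric_sum F h (steps h s) g) (v s).
Proof.
rewrite le_eqVlt => /predU1P[<- _ _ _|s0 vwM wS vS] q e0 Qq e00.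
  near=> h; rewrite steps0 /geometric_sum big_ord0 scaler0 addr0/= subrr.
  by rewrite (sem0 QV).
(* The mesh has [N] steps with error [5 e d] each and [N d = s], which makes [5 e s < e0] in
   total. *)
pose e := e0 / (6 * s).
have e_gt0 : 0 < e by apply: divr_gt0 => //; apply: mulr_gt0.
have es : 6 * s * e = e0 by rewrite /e mulrCA divff ?mulr1// gt_eqF// mulr_gt0.
clearbody e.
have [q' Qq' Fq'] := geometric_sum_bounded QV F_bounded s Qq.
pose y tau := w tau + g.
have yS : uniformly_continuous s y.
  move=> p c Qp c0; have [d d0 wd] := wS _ _ Qp c0; exists d => // a b *.
  by rewrite (_ : y b - y a = w b - w a); [exact: wd|rewrite /y; lmod R].
have [d1 d10 vd1] := vS _ _ Qq' e_gt0.
have [d2 d20 yd2] := iter_small_time_curve (ltW s0) yS Qq' e_gt0.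
(* The mesh size is at most [d1], for the derivative of [v], and at most [d2 / 2]: one mesh step
   takes time [m h <= d + h <= 2 d], which must not exceed [d2]. *)
pose N := (Num.truncn (s / Num.min d1 (d2 / 2))).+1.
have dm0 : 0 < Num.min d1 (d2 / 2) by rewrite lt_min d10 divr_gt0.
have N0 : 0 < N%:R :> R by [].
pose d := s / N%:R.
have d0 : 0 < d by exact: divr_gt0.
have Nd : N%:R * d = s by rewrite /d mulrCA divff ?mulr1// gt_eqF.
have [dd1 dd2] : d <= d1 /\ d <= d2 / 2.
  apply/andP; rewrite -le_min /d ler_pdivrMr// mulrC -ler_pdivrMr// ltW//.
  by have /andP[] := truncn_itv (divr_ge0 (ltW s0) (ltW dm0)).
clearbody d N.
pose t (i : nat) := i%:R * d.
have t_ge0 i : 0 <= t i by rewrite mulr_ge0// ltW.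
have t_le i : (i <= N)%N -> t i <= s.
  by move=> iN; rewrite -[leRHS]Nd ler_wpM2r ?(ltW d0)// ler_nat.
have tS i : t i.+1 = t i + d by rewrite /t -natr1 mulrDl mul1r.
have tB i : t i.+1 - t i = d by rewrite tS addrAC subrr add0r.
have ed : 0 < e * d by exact: mulr_gt0.
near=> h.
have h0 : 0 < h by near: h; exact: near0.
have hd : h <= d by near: h; exact: nbhs_right_ltW.
have approx : forall (i : 'I_N) m, m%:R * h <= s ->
    q' (iter m (F h) (v (t i)) - v (t i) - h *: geometric_sum F h m (w (t i))) <= e * d.
  near: h; apply: filter_forall => i.
  apply: (iter_mef_closure QV F_linear F_bounded (ltW s0) _ Qq' ed).
  by apply: vwM; rewrite t_ge0 t_le// ltnW.
(* Pays for replacing [d] by a multiple of [h], which is off by at most [h]. *)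
have hY : forall i : 'I_N, h * q' (y (t i)) <= e * d.
  near: h; apply: filter_forall => i.
  have Y0 := sem_ge0 QV (y (t i)) Qq'.
  near=> h; have ? : 0 < h by near: h; exact: near0.
  have : h <= e * d / (q' (y (t i)) + 1).
    by near: h; apply: nbhs_right_ltW; apply: divr_gt0 => //; lra.
  by rewrite ler_pdivlMr; lra.
have small : forall m tau, 0 <= tau <= s -> m%:R * h <= d2 ->
    q' (iter m (F h) (y tau) - y tau) <= e by near: h.
have Fl := F_linear (ltW h0).
pose M i := steps h (t i).
pose D i := iter (M i) (F h) (v 0) + h *: geometric_sum F h (M i) g.
(* The local error: [e d] each for the derivative of [v], for the effective derivative and for the
   rounding of [d], and [2 e d] for freezing [y] in the Riemann sum. *)
have step (i : 'I_N) : q' (v (t i.+1) - iter (M i.+1 - M i) (F h) (v (t i)) -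
    h *: geometric_sum F h (M i.+1 - M i) g) <= 5 * (e * d).
  set m := (M i.+1 - M i)%N.
  have tle : t i <= t i.+1 by rewrite tS lerDl ltW.
  have ti_s := t_le _ (ltn_ord i).
  have mh1 : m%:R * h <= d + h.
    have := stepsB_le h0 (t_ge0 i) tle; rewrite -/(M _) -/(M _) -/m tB.
    exact.
  have mhs : m%:R * h <= s.
    apply: le_trans ti_s; apply: le_trans (steps_le h0 (t_ge0 _)).
    by rewrite ler_wpM2r ?(ltW h0)// ler_nat leq_subr.
  have dist : `|d - m%:R * h| <= h.
    by have := stepsB_dist h0 (t_ge0 i) tle; rewrite -/(M _) -/(M _) -/m tB.
  have b1 := approx i m mhs.
  have b2 : q' (v (t i.+1) - v (t i) - d *: y (t i)) <= e * d.
    by have := vd1 (t i) (t i.+1) (t_ge0 i) tle ti_s; rewrite tB; exact.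
  have b3 : q' ((d - m%:R * h) *: y (t i)) <= e * d.
    rewrite (sem_hom QV)//; apply: le_trans (hY i).
    by rewrite ler_wpM2r// (sem_ge0 QV).
  have b4 : q' (h *: geometric_sum F h m (y (t i)) - (m%:R * h) *: y (t i)) <= 2 * (e * d).
    apply: (@le_trans _ _ (m%:R * h * e)).
      apply: (geometric_sum_near (ltW h0)) => // j jm.
      apply: small; first by rewrite t_ge0 t_le// ltnW.
      apply: (@le_trans _ _ (m%:R * h)); last by clear -mh1 hd dd2; lra.
      by rewrite ler_wpM2r ?(ltW h0)// ler_nat ltnW.
    by rewrite [leLHS]mulrC [leRHS]mulrCA ler_pM2l//; clear -mh1 hd; lra.
  have -> : v (t i.+1) - iter m (F h) (v (t i)) - h *: geometric_sum F h m g =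
      (v (t i.+1) - v (t i) - d *: y (t i)) -
      (iter m (F h) (v (t i)) - v (t i) - h *: geometric_sum F h m (w (t i))) +
      ((d - m%:R * h) *: y (t i) -
      (h *: geometric_sum F h m (y (t i)) - (m%:R * h) *: y (t i))).
    have -> : geometric_sum F h m (y (t i)) = geometric_sum F h m (w (t i)) + geometric_sum F h m g.
      rewrite /geometric_sum -big_split; apply: eq_bigr => j _.
      by rewrite (linear_funD (iter_linear j Fl)).
    by lmod R.
  apply: le_trans (sem_tri QV _ _ Qq') _.
  apply: le_trans (lerD (semB QV _ _ Qq') (semB QV _ _ Qq')) _.
  apply: le_trans (lerD (lerD b2 b1) (lerD b3 b4)) _.
  by rewrite le_eqVlt; apply/orP; left; apply/eqP; ring.
(* The error is measured after [j] further iterations. Every local error is thus bounded by [q']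
   once, and the power bound is not compounded over the mesh. *)
have propagate i j : (i <= N)%N -> (M i + j)%:R * h <= s ->
    q (iter j (F h) (v (t i) - D i)) <= i%:R * (5 * (e * d)).
  elim: i j => [|i IH] j iN js.
    rewrite /D /M /t mul0r steps0 /geometric_sum big_ord0 scaler0 addr0/= subrr.
    by rewrite (linear_fun0 (iter_linear j Fl)) (sem0 QV)// mul0r.
  have MS : M i.+1 = (M i + (M i.+1 - M i))%N.
    by rewrite subnKC//; apply: le_steps => //; rewrite tS lerDl ltW.
  have b2 := step (Ordinal iN); move: MS b2 => /=; set m := (M i.+1 - M i)%N => MS b2.
  have -> : v (t i.+1) - D i.+1 = (v (t i.+1) - iter m (F h) (v (t i)) -
      h *: geometric_sum F h m g) + iter m (F h) (v (t i) - D i).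
    have il := iter_linear m Fl.
    rewrite /D MS geometric_sumD ?(ltW h0)// (addnC (M i)) iterD.
    rewrite (linear_funB il) (linear_funD il) (linear_funZ il).
    by lmod R.
  rewrite (linear_funD (iter_linear j Fl)) -iterD.
  apply: le_trans (sem_tri QV _ _ Qq) _.
  have jh : j%:R * h <= s.
    by apply: le_trans js; rewrite ler_wpM2r ?(ltW h0)// ler_nat leq_addl.
  have [_ b1] := Fq' h j (v (t i.+1) - iter m (F h) (v (t i)) -
      h *: geometric_sum F h m g) (ltW h0) jh.
  have b3 : q (iter (j + m) (F h) (v (t i) - D i)) <= i%:R * (5 * (e * d)).
    by apply: IH; [exact: ltnW|rewrite (addnC j) addnA -MS].
  rewrite -natr1 mulrDl mul1r addrC; apply: lerD => //.
  exact: le_trans b1 b2.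
have tN : t N = s by rewrite /t Nd.
have := propagate N 0%N (leqnn _); rewrite addn0 /= (semBC QV)//.
rewrite /D /M tN => /(_ (steps_le h0 (ltW s0))) /le_lt_trans; apply.
rewrite mulrCA mulrA mulrA -mulrA [e * d]mulrC.
have -> : 5 * N%:R * (d * e) = 5 * (N%:R * d) * e by ring.
rewrite Nd -es -subr_gt0 (_ : _ - _ = s * e); last by ring.
exact: mulr_gt0.
Unshelve. all: by end_near. Qed.

End ChernoffApproximation.

(** * Approximation of a given semigroup *)

Section Semigroups.
Variables (R : realType) (V : lmodType R) (Q : set (V -> R)) (F : R -> V -> V).
Hypothesis QV : seminorm_system Q.
Hypothesis F_linear : forall h, 0 <= h -> linear (F h).
Hypothesis F_bounded : power_bounded Q F.
Hypothesis mef_dense : sem_dense Q [set x | exists w, mef_graph Q F (x, w)].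

Lemma near0E (P : R -> Prop) :
  (\forall h \near 0^'+, P h) <-> exists2 d, 0 < d & forall h, 0 < h -> h <= d -> P h.
Proof.
split=> [[d /= d0 dP]|[d d0 dP]].
  exists (d / 2); first by lra.
  move=> h h0 hd; apply: dP => //=; rewrite sub0r normrN gtr0_norm//; lra.
near=> h; apply: dP; first by near: h; exact: near0_pos.
by near: h; exact: nbhs_right_ltW.
Unshelve. all: by end_near. Qed.

Variable T : R -> V -> V.
Hypothesis T_linear : forall s, 0 <= s -> linear (T s).
Hypothesis T_bounded : forall S q, Q q -> exists2 q', Q q' &
  forall s x, 0 <= s <= S -> q (T s x) <= q' x.
Hypothesis T0 : forall x, T 0 x = x.
Hypothesis TD : forall a b x, 0 <= a -> 0 <= b -> T (a + b) x = T a (T b x).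
Hypothesis T_cont0 : forall x, tends Q 0^'+ (fun h => T h x) x.

Lemma semigroup_uniformly_continuous S x : uniformly_continuous Q S (fun s => T s x).
Proof.
move=> q e Qq e0; have [q' Qq' Tq'] := T_bounded S Qq.
have /near0E[d d0 small] := T_cont0 x Qq' e0.
exists d => // a b a0 ab bS bad.
have [<-|/eqP ab'] := eqVneq a b; first by rewrite subrr (sem0 QV)// ltW.
have ba0 : 0 < b - a by rewrite subr_gt0 lt_neqAle ab andbT; apply/eqP.
rewrite -{1}(subrKC a b) (TD _ a0 (ltW ba0)) -(linear_funB (T_linear a0)).
apply: (le_trans (Tq' _ _ _)); first by rewrite a0 (le_trans ab).
by apply: ltW; apply: small.
Qed.

Lemma semigroup_uniformly_derivable S f z :
  tends Q 0^'+ (fun h => h^-1 *: (T h f - f)) z ->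
  uniformly_derivable Q S (fun s => T s f) (fun s => T s z).
Proof.
move=> fz q e Qq e0; have [q' Qq' Tq'] := T_bounded S Qq.
have /near0E[d d0 small] := fz _ _ Qq' e0.
exists d => // a b a0 ab bS bad.
have [<-|/eqP ab'] := eqVneq a b.
  by rewrite !subrr scale0r subrr (sem0 QV)// mulr0.
have ba0 : 0 < b - a by rewrite subr_gt0 lt_neqAle ab andbT; apply/eqP.
rewrite -{1}(subrKC a b) (TD _ a0 (ltW ba0)) -(linear_funB (T_linear a0)).
rewrite -(linear_funZ (T_linear a0)) -(linear_funB (T_linear a0)).
apply: (le_trans (Tq' _ _ _)); first by rewrite a0 (le_trans ab).
have -> : T (b - a) f - f - (b - a) *: z =
    (b - a) *: ((b - a)^-1 *: (T (b - a) f - f) - z).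
  by rewrite scalerBr scalerA divff ?gt_eqF// scale1r.
rewrite (sem_hom QV)// gtr0_norm// mulrC ler_wpM2r//; first exact: ltW.
by apply: ltW; apply: small.
Qed.

(** The orbit of [f] solves the homogeneous equation with derivative [T a z], so the Duhamel
    estimate applies with [g = 0]. *)
Theorem chernoff_semigroup s f z : 0 <= s ->
  tends Q 0^'+ (fun h => h^-1 *: (T h f - f)) z ->
  (forall a, 0 <= a -> sem_closure Q (mef_graph Q F) (T a f, T a z)) ->
  tends Q 0^'+ (fun h => iter (steps h s) (F h) f) (T s f).
Proof.
move=> s0 fz TM.
have H : tends Q 0^'+ (fun h => iter (steps h s) (F h) (T 0 f) +
    h *: geometric_sum F h (steps h s) 0) (T s f).
  apply: (chernoff_duhamel QV F_linear F_bounded mef_dense (v := T^~ f) (w := T^~ z) s0).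
  - by move=> a /andP[a0 _]; exact: TM.
  - exact: semigroup_uniformly_continuous.
  - rewrite (_ : (fun tau => T tau z + 0) = T^~ z); last by apply/funext => a; rewrite addr0.
    exact: semigroup_uniformly_derivable.
move=> q e Qq e0; near=> h.
have h0 : 0 < h by near: h; exact: near0_pos.
have : q (iter (steps h s) (F h) (T 0 f) + h *: geometric_sum F h (steps h s) 0 - T s f) < e.
  by near: h; exact: H.
rewrite T0 /geometric_sum big1 ?scaler0 ?addr0// => j _.
by rewrite (linear_fun0 (iter_linear j (F_linear (ltW h0)))).
Unshelve. all: by end_near. Qed.

End Semigroups.

(** * Bounded convergence, uniform boundedness, diagonal subsequences, primitives *)

Section BoundedConvergence.
Variable R : realType.
Implicit Types (W r : R -> R) (s K : R).

(** A quantitative form of [W' = r] with [r] Lipschitz. For fixed [K] these inequalities pass to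
    pointwise limits, unlike derivability itself. *)
Definition quadratic_primitive s K W r :=
  (forall a b, 0 <= a -> a <= b -> b <= s ->
    `|W b - W a - (b - a) * r a| <= K * (b - a) ^+ 2) /\
  (forall a b, 0 <= a -> a <= b -> b <= s -> `|r b - r a| <= K * (b - a)).

(** Exchanging the end points uses the Lipschitz bound of [r] in addition, whence the factor 2. *)
Lemma quadratic_primitive_dist s K W r x y : 0 <= K -> quadratic_primitive s K W r ->
  0 <= x <= s -> 0 <= y <= s -> `|W y - W x - (y - x) * r x| <= 2 * K * (y - x) ^+ 2.
Proof.
move=> K0 [Wr rK] /andP[x0 xs] /andP[y0 ys].
have [xy|/ltW yx] := leP x y.
  apply: le_trans (Wr _ _ x0 xy ys) _.
  by rewrite ler_wpM2r ?sqr_ge0//; lra.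
have e1 := Wr _ _ y0 yx xs; have e2 := rK _ _ y0 yx xs.
have -> : W y - W x - (y - x) * r x = - (W x - W y - (x - y) * r y) + (x - y) * (r x - r y).
  by ring.
apply: le_trans (ler_normD _ _) _; rewrite normrN normrM ger0_norm ?subr_ge0//.
have : (x - y) * `|r x - r y| <= (x - y) * (K * (x - y)) by rewrite ler_wpM2l// subr_ge0.
have -> : (y - x) ^+ 2 = (x - y) ^+ 2 by ring.
by move: e1; rewrite !expr2; lra.
Qed.

Lemma near_dist (Fl : set_system R) {FF : Filter Fl} (x d : R) : Fl --> x -> 0 < d ->
  \forall y \near Fl, `|x - y| <= d.
Proof.
move=> Flx d0; apply: Flx; exists d => // y /=; exact: ltW.
Qed.

(** The projection onto [[0, s]]; composition with it extends a Lipschitz function on the interval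
    to a continuous function on the line. *)
Let clamp s x := Num.min s (Num.max 0 x).

Let clamp_itv s x : 0 <= s -> 0 <= clamp s x <= s.
Proof. by move=> s0; rewrite le_min s0 le_max lexx ge_min lexx. Qed.

Let clamp_id s x : 0 <= x <= s -> clamp s x = x.
Proof. by move=> /andP[x0 xs]; rewrite /clamp max_r// min_r. Qed.

Let clamp_lip s x y : 0 <= s -> `|clamp s x - clamp s y| <= `|x - y|.
Proof.
move=> s0; have := ler_norm (x - y); have := ler_norm (y - x).
rewrite (distrC y) ler_norml /clamp.
case: (leP 0 x) => ?; case: (leP 0 y) => ?; do ?[case: (leP s _) => ?];
  by move=> *; apply/andP; split; lra.
Qed.

Lemma quadratic_primitive_integral s K W r : 0 < s -> 0 <= K ->
  quadratic_primitive s K W r ->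
  {within `[0, s], continuous r} /\
  (\int[lebesgue_measure]_(x in `[0%R, s]) (r x)%:E = (W s - W 0)%:E)%E.
Proof.
move=> s0 K0 Wr.
have dist x y := @quadratic_primitive_dist s K W r x y K0 Wr.
have rlip x y : 0 <= x <= s -> 0 <= y <= s -> `|r x - r y| <= K * `|x - y|.
  move=> /andP[x0 xs] /andP[y0 ys]; have [xy|/ltW yx] := leP x y.
    by rewrite distrC (distrC x) (ger0_norm (_ : 0 <= y - x)) ?subr_ge0//; exact: Wr.2.
  by rewrite (ger0_norm (_ : 0 <= x - y)) ?subr_ge0//; exact: Wr.2.
have rc : {within `[0, s], continuous r}.
  have : {within `[0, s], continuous (r \o clamp s)}.
    apply: continuous_subspaceT => x; apply/cvgrPdist_le => e e0.
    have K1 : 0 < K + 1 by lra.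
    near=> y.
    have h : `|x - y| <= e / (K + 1).
      by near: y; apply: near_dist; [exact: cvg_id|exact: divr_gt0].
    have := rlip _ _ (clamp_itv x (ltW s0)) (clamp_itv y (ltW s0)).
    move=> /le_trans; apply; apply: (@le_trans _ _ ((K + 1) * `|x - y|)).
      by have := ler_wpM2l K0 (clamp_lip x y (ltW s0)); have := normr_ge0 (x - y); lra.
    by rewrite mulrC -ler_pdivlMr.
  apply: subspace_eq_continuous => x; rewrite inE/= in_itv/= => /clamp_id.
  by move=> /(congr1 r).
split=> //.
have Wlip x y : 0 <= x <= s -> 0 <= y <= s -> `|W y - W x| <= (`|r x| + 2 * K * s) * `|y - x|.
  move=> xs ys; have d := dist _ _ xs ys.
  have -> : W y - W x = (W y - W x - (y - x) * r x) + r x * (y - x) by ring.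
  apply: le_trans (ler_normD _ _) _; rewrite [leRHS]mulrDl [leLHS]addrC normrM lerD2l.
  apply: le_trans d _; rewrite -(real_normK (num_real (y - x))) expr2 -!mulrA.
  rewrite ler_pM2l// ler_wpM2l// ler_wpM2r//.
  by move: xs ys => /andP[? ?] /andP[? ?]; rewrite ler_norml; apply/andP; split; lra.
have Wcvg x (xs : 0 <= x <= s) (Fl : set_system R) (FF : Filter Fl) :
    Fl --> x -> (\forall y \near Fl, 0 <= y <= s) -> W y @[y --> Fl] --> W x.
  move=> Flx Fls; apply/cvgrPdist_le => e e0.
  have K1 : 0 < `|r x| + 2 * K * s + 1.
    by have := normr_ge0 (r x); have := mulr_ge0 K0 (ltW s0); lra.
  near=> y.
  have h : `|x - y| <= e / (`|r x| + 2 * K * s + 1).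
    by near: y; apply: near_dist => //; exact: divr_gt0.
  have ys : 0 <= y <= s by near: y.
  rewrite distrC; apply: le_trans (Wlip _ _ xs ys) _; rewrite (distrC y).
  apply: (@le_trans _ _ ((`|r x| + 2 * K * s + 1) * `|x - y|)).
    by rewrite ler_wpM2r//; lra.
  by rewrite mulrC -ler_pdivlMr.
have Wder x : x \in `]0, s[ -> h^-1 *: (W (h + x) - W x) @[h --> 0^'] --> r x.
  rewrite in_itv/= => /andP[x0 xs]; apply/cvgrPdist_le => e e0.
  have K1 : 0 < 2 * K + 1 by lra.
  have hle d : 0 < d -> \forall h \near (0 : R)^', `|h| <= d.
    move=> d0; near=> h'; have : `|0 - h'| <= d.
      by near: h'; apply: near_dist d0; exact: cvg_within.
    by rewrite sub0r normrN.
  near=> h.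
  have hn0 : h != 0 by near: h; exact: nbhs_dnbhs_neq.
  have h1 : `|h| <= x by near: h; exact: hle.
  have h2 : `|h| <= s - x by near: h; apply: hle; rewrite subr_gt0.
  have h3 : `|h| <= e / (2 * K + 1) by near: h; apply: hle; exact: divr_gt0.
  have hx : 0 <= h + x <= s.
    by move: h1 h2; rewrite !ler_norml => /andP[? ?] /andP[? ?]; apply/andP; split; lra.
  have xs' : 0 <= x <= s by rewrite (ltW x0) (ltW xs).
  have := dist _ _ xs' hx; rewrite addrK => d.
  have -> : r x - h^-1 *: (W (h + x) - W x) = - h^-1 * (W (h + x) - W x - h * r x).
    by rewrite /GRing.scale/=; field.
  rewrite normrM normrN normfV ler_pdivrMl ?normr_gt0//.
  apply: le_trans d _; rewrite -(real_normK (num_real h)) expr2 mulrA [leRHS]mulrC.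
  rewrite ler_wpM2r//; apply: (@le_trans _ _ ((2 * K + 1) * `|h|)).
    by rewrite ler_wpM2r//; lra.
  by rewrite mulrC -ler_pdivlMr.
rewrite EFinB; apply: continuous_FTC2 => //.
- split.
  + move=> x /Wder Wx; apply/cvg_ex; exists (r x).
    move: Wx; apply: cvg_trans; apply: near_eq_cvg; near=> h.
    by rewrite /= scaler1.
  + apply: Wcvg; first by rewrite lexx ltW.
      exact: cvg_within.
    near=> y; apply/andP; split; near: y; first exact: nbhs_right_ge.
    exact: nbhs_right_ltW.
  + apply: Wcvg; first by rewrite lexx ltW.
      exact: cvg_within.
    near=> y; apply/andP; split; near: y; last exact: nbhs_left_le.
    exact: nbhs_left_ge.
- by move=> x /Wder /cvg_lim; exact.
Unshelve. all: by end_near. Qed.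

(** The increments are integrals of [r k], to which dominated convergence applies. The constants
    [K k] may grow with [k]; the uniform bound is [L]. *)
Lemma bounded_convergence_primitive s (K : nat -> R) (W r : nat -> R -> R) L : 0 < s ->
  (forall k, 0 <= K k) ->
  (forall k, quadratic_primitive s (K k) (W k) (r k)) ->
  (forall k x, 0 <= x <= s -> `|r k x| <= L) ->
  (forall x, 0 <= x <= s -> r k x @[k --> \oo] --> 0) ->
  W k s - W k 0 @[k --> \oo] --> 0.
Proof.
move=> s0 K0 Wr rL r0.
have int k := quadratic_primitive_integral s0 (K0 k) (Wr k).
have mD : measurable (`[0, s] : set R) by exact: measurable_itv.
suff : (\int[lebesgue_measure]_(x in `[0%R, s]) (r k x)%:E @[k --> \oo] -->
    \int[@lebesgue_measure R]_(x in `[0%R, s]) 0)%E.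
  rewrite integral0.
  rewrite (_ : (fun k => _) = EFin \o (fun k => W k s - W k 0)); last first.
    by apply/funext => k; rewrite (int k).2.
  by move/fine_cvgP => [].
have := @dominated_cvg _ _ R lebesgue_measure _ mD (fun k x => (r k x)%:E) (cst 0%E) (cst L%:E).
apply => //.
- move=> k; apply/measurable_EFinP.
  by apply: subspace_continuous_measurable_fun => //; exact: (int k).1.
- move=> x /=; rewrite in_itv/= => xs; apply: cvg_EFin; first by near=> k.
  exact: r0.
- apply/integrableP; split; first exact: measurable_cst.
  rewrite integral_cst//= lebesgue_measure_itv/=; case: ifP => _.
    by rewrite -EFinB -EFinM ltry.
  by rewrite mule0.
Unshelve. all: by end_near. Qed.

End BoundedConvergence.

(** * Uniform boundedness on bounded discs *)

Section UniformBoundedness.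
Variables (R : realType) (V : lmodType R) (Q : set (V -> R)).
Hypothesis QV : seminorm_system Q.

Definition seminorm_ball (L : (V -> R) -> R) : set V :=
  [set x | forall q, Q q -> q x <= L q].

(* Sokal's gliding hump; sequential completeness is used on the closed bounded
   disc [seminorm_ball L] only. *)
Theorem uniform_boundedness (phi : nat -> V -> R) L :
  (forall k, functional Q (phi k)) ->
  (forall x, exists C, forall k, `|phi k x| <= C) ->
  exists C, forall k x, seminorm_ball L x -> `|phi k x| <= C.
Proof.
move=> fphi bphi; set B := seminorm_ball L.
have [[z Bz]|nB] := pselect (B !=set0); last first.
  by exists 0 => k x Bx; exfalso; apply: nB; exists x.
have L0 q : Q q -> 0 <= L q by move=> Qq; exact: le_trans (sem_ge0 QV z Qq) (Bz _ Qq).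
pose A k := [set `|phi k x| | x in B].
have Asup k : has_sup (A k).
  split; first by exists `|phi k z|, z.
  have [q Qq phiq] := functional_abs QV (fphi k).
  by exists (L q) => _ [x Bx <-]; exact: le_trans (phiq _) (Bx _ Qq).
pose c k := sup (A k).
have le_c k x : B x -> `|phi k x| <= c k.
  by move=> Bx; apply: ub_le_sup; [exact: (Asup k).2|exists x].
apply: contrapT => unbounded.
(* With ratio 3, the tail after the step of index [n] has size [3/2 r n.+1 = r n / 2], against a
   hump of relative height [2/3]. *)
pose r n : R := 3^-1 ^+ n.
have r0 n : 0 < r n by apply: exprn_gt0.
have r3 n : r n = 3 * r n.+1 by rewrite /r exprS mulrA divff// mul1r.
(* The hump exceeds the tail by [(2/3 - 1/2) r n c = r n c / 6], and [k n] is chosen to make this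
   larger than [n]. *)
have /choice[k kP] : forall n, exists k, n%:R * (6 / r n) < c k.
  move=> n; apply: contrapT => nk; apply: unbounded; exists (n%:R * (6 / r n)) => k x Bx.
  by rewrite leNgt; apply/negP => lt; apply: nk; exists k; exact: lt_le_trans lt (le_c _ _ Bx).
have c0 n : 0 < c (k n).
  by apply: le_lt_trans (kP n); rewrite mulr_ge0// divr_ge0// ltW.
have /choice[b bP] : forall n, exists x, B x /\ 2 / 3 * c (k n) <= `|phi (k n) x|.
  move=> n; have lt : 2 / 3 * c (k n) < c (k n) by have := c0 n; lra.
  have [_ [x Bx <-] /ltW h] := sup_gt (Asup (k n)).1 lt.
  by exists x.
(* The sign is chosen so that the image is at least that of [r n *: b n]: both signs cannot fail, by
   the triangle inequality for the difference of the two images. *)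
pose next n x := if `|phi (k n) (r n *: b n)| <= `|phi (k n) (x + r n *: b n)|
  then x + r n *: b n else x - r n *: b n.
pose x := fix x n := if n is m.+1 then next m (x m) else 0.
have next_large n y : `|phi (k n) (r n *: b n)| <= `|phi (k n) (next n y)|.
  rewrite /next; case: ifPn => //; rewrite -ltNge.
  rewrite (functionalD _ _ (fphi _)) (functionalB _ _ (fphi _)).
  set u := phi _ y; set v := phi _ _ => uv.
  have : `|v + v| <= `|u + v| + `|u - v|.
    have -> : v + v = (u + v) - (u - v) by ring.
    exact: ler_normB.
  have := ler_normD v v; rewrite -mulr2n normrMn mulr2n; lra.
have next_close n y q : Q q -> q (next n y - y) <= r n * L q.
  move=> Qq; have [Bb _] := bP n.
  have bq : q (r n *: b n) <= r n * L q.
    by rewrite (sem_hom QV)// gtr0_norm// ler_pM2l//; exact: Bb.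
  rewrite /next; case: ifP => _; first by rewrite addrAC subrr add0r.
  by rewrite addrAC subrr add0r (semN QV).
have x_close n m q : Q q -> (n <= m)%N -> q (x m - x n) <= 3 / 2 * (r n - r m) * L q.
  move=> Qq; elim: m => [|m IH]; first by rewrite leqn0 => /eqP ->; rewrite !subrr (sem0 QV)// mulr0 mul0r.
  rewrite leq_eqVlt => /predU1P[->|]; first by rewrite !subrr (sem0 QV)// mulr0 mul0r.
  rewrite ltnS => /IH nm; apply: le_trans (sem_dist QV (x m) _ _ Qq) _.
  have := next_close m (x m) q Qq; rewrite -/(x m.+1).
  have := r3 m; have := L0 _ Qq; nra.
have [y xy] : exists y, tends Q \oo x y.
  apply: (sem_complete QV) => q e Qq e0.
  have Lq := L0 _ Qq.
  have L1 : 0 < 3 / 2 * (L q + 1) by lra.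
  have : r n @[n --> \oo] --> 0.
    by apply: cvg_expr; rewrite ger0_norm// invf_lt1// ltr1n.
  move=> /cvgrPdist_lt /(_ (e / (3 / 2 * (L q + 1))) (divr_gt0 e0 L1)).
  apply: filterS => m; rewrite sub0r normrN gtr0_norm// ltr_pdivlMr// => rm n mn.
  apply: le_lt_trans (x_close _ _ _ Qq mn) _.
  have := r0 n; have := r0 m; nra.
have y_close n q : Q q -> q (y - x n) <= 3 / 2 * r n * L q.
  move=> Qq; have h : tends Q \oo (fun m => x m - x n) (y - x n).
    by apply: (tendsD QV xy); exact: (tends_cst QV).
  apply: (tends_le QV Qq h); near=> m.
  have nm : (n <= m)%N by near: m; exact: nbhs_infty_ge.
  apply: le_trans (x_close _ _ _ Qq nm) _.
  have := r0 m; have := L0 _ Qq; nra.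
have [C yC] := bphi y.
have [n nC] : exists n : nat, C < n%:R.
  have m0 : 0 <= Num.max C 0 by rewrite le_max lexx orbT.
  have [_ lt] := andP (truncn_itv m0).
  by eexists; apply: le_lt_trans lt; rewrite le_max lexx.
have tail : `|phi (k n) (y - x n.+1)| <= r n / 2 * c (k n).
  have -> : y - x n.+1 = (r n / 2) *: ((r n / 2)^-1 *: (y - x n.+1)).
    by rewrite scalerA divff ?scale1r// gt_eqF// divr_gt0.
  rewrite (functionalZ _ _ (fphi _)) normrM gtr0_norm ?divr_gt0// ler_pM2l ?divr_gt0//.
  apply: le_c => q Qq; rewrite (sem_hom QV)// gtr0_norm ?invr_gt0 ?divr_gt0//.
  rewrite ler_pdivrMl ?divr_gt0//; apply: le_trans (y_close _ _ Qq) _.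
  by rewrite (r3 n) le_eqVlt; apply/orP; left; apply/eqP; field.
have [_ bn] := bP n.
have large := next_large n (x n); rewrite -/(x n.+1) in large.
rewrite {1}(functionalZ _ _ (fphi _)) normrM gtr0_norm// in large.
have := yC (k n).
have : phi (k n) y = phi (k n) (x n.+1) + phi (k n) (y - x n.+1).
  by rewrite -(functionalD _ _ (fphi _)) subrKC.
move=> ->; set u := phi (k n) (x n.+1) in large *.
set v := phi (k n) (y - x n.+1) in tail *.
have : `|u| <= `|u + v| + `|v| by rewrite -{1}(addrK v u); exact: ler_normB.
have : r n * (2 / 3 * c (k n)) <= r n * `|phi (k n) (b n)| by rewrite ler_pM2l.
have : n%:R < r n * c (k n) / 6.
  have := kP n; rewrite mulrA ltr_pdivrMr// => h.
  rewrite ltr_pdivlMr//; lra.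
lra.
Unshelve. all: by end_near. Qed.

End UniformBoundedness.

(** The second hypothesis says that [P i] survives in any sequence whose terms of rank above [i] are
    terms of [s] of no smaller rank. The diagonal has this relation to each stage of the
    extraction. *)
Lemma diagonal_subsequence (P : nat -> (nat -> nat) -> Prop) :
  (forall i s, {homo s : m n / (m < n)%N} ->
    exists2 t : nat -> nat, {homo t : m n / (m < n)%N} & P i (s \o t)) ->
  (forall i (s s' : nat -> nat), P i s ->
    (forall n, (i < n)%N -> exists2 m, (n <= m)%N & s' n = s m) -> P i s') ->
  exists2 s : nat -> nat, {homo s : m n / (m < n)%N} & forall i, P i s.
Proof.
move=> Pex Psub.
have homo_ge (t : nat -> nat) : {homo t : m n / (m < n)%N} -> forall n, (n <= t n)%N.
  by move=> ht; elim=> // n IH; apply: leq_ltn_trans IH (ht _ _ _).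
have ltn_homo (t : nat -> nat) : (forall n, t n < t n.+1)%N -> {homo t : m n / (m < n)%N}.
  by move=> ht; apply: homo_ltn => //; exact: ltn_trans.
have /choice[t tP] : forall u : nat * {s : nat -> nat | {homo s : m n / (m < n)%N}},
    exists t : nat -> nat, {homo t : m n / (m < n)%N} /\ P u.1 (projT1 u.2 \o t).
  by move=> [i [s hs]]; have [t ht Pt] := Pex i s hs; exists t.
have comp_homo i (s : {s : nat -> nat | {homo s : m n / (m < n)%N}}) :
    {homo projT1 s \o t (i, s) : m n / (m < n)%N}.
  by move=> m n mn; apply: (projT2 s); exact: (tP (i, s)).1.
pose comp i s := exist (fun s : nat -> nat => {homo s : m n / (m < n)%N})
  _ (comp_homo i s).
pose S := fix S i := if i is j.+1 then comp j (S j)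
  else exist (fun s : nat -> nat => {homo s : m n / (m < n)%N}) id (fun m n mn => mn).
pose s i := projT1 (S i).
have hs i : {homo s i : m n / (m < n)%N} := projT2 (S i).
have sS i : s i.+1 = s i \o t (i, S i) by [].
have sub i n : (i <= n)%N -> exists2 rho : nat -> nat,
    {homo rho : m n / (m < n)%N} & s n = s i \o rho.
  elim: n => [|n IH]; first by rewrite leqn0 => /eqP ->; exists id.
  rewrite leq_eqVlt => /predU1P[->|]; first by exists id.
  rewrite ltnS => /IH[rho hrho E]; exists (rho \o t (n, S n)).
    by move=> a b ab /=; apply: hrho; exact: (tP _).1.
  by rewrite sS E.
exists (fun n => s n n).
  apply: ltn_homo => n; rewrite sS /=; apply: hs.
  exact: homo_ge (tP _).1 n.+1.
(* Stage [i.+1] is the one extracted for property [i], and the diagonal is drawn from it from rank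
   [i.+1] on; hence the strict inequality in the hypothesis. *)
move=> i; apply: (Psub i (s i.+1)); first exact: (tP (i, S i)).2.
move=> n ni; have [rho hrho E] := sub i.+1 n ni.
by exists (rho n); [exact: homo_ge|rewrite E].
Qed.

(** * Integrals of Lipschitz vector-valued curves *)

Section LipschitzPrimitive.
Variables (R : realType) (V : lmodType R) (Q : set (V -> R)).
Hypothesis QV : seminorm_system Q.

(** [U] is the limit of left Riemann sums of [u], which exists by sequential completeness; the
    quadratic remainder is inherited from the sums. *)
Lemma lipschitz_primitive S (u : R -> V) (L : (V -> R) -> R) : 0 <= S ->
  (forall q, Q q -> 0 <= L q) ->
  (forall q a b, Q q -> 0 <= a -> a <= b -> b <= S -> q (u b - u a) <= L q * (b - a)) ->
  exists2 U, U 0 = 0 & forall q a b, Q q -> 0 <= a -> a <= b -> b <= S ->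
    q (U b - U a - (b - a) *: u a) <= L q * (b - a) ^+ 2.
Proof.
move=> S0 L0 uL.
pose r h s := h *: \sum_(0 <= j < steps h s) u (j%:R * h).
pose C q := q (u 0) + L q * S.
have uC q a : Q q -> 0 <= a -> a <= S -> q (u a) <= C q.
  move=> Qq a0 aS; apply: le_trans (sem_le QV (u a) (u 0) Qq) _; rewrite addrC lerD2l.
  apply: le_trans (uL _ _ _ Qq (lexx _) a0 aS) _.
  by rewrite subr0 ler_wpM2l// L0.
(* At most [(b - a + h) / h] nodes lie between [a] and [b], each within [b - a + h] of [a]; the last
   term pays for rounding the length to a multiple of [h]. *)
have incr q h a b : Q q -> 0 < h -> 0 <= a -> a <= b -> b <= S ->
    q (r h b - r h a - (b - a) *: u a) <= L q * (b - a + h) ^+ 2 + h * C q.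
  move=> Qq h0 a0 ab bS.
  set d := (steps h b - steps h a)%N.
  have -> : r h b - r h a - (b - a) *: u a =
      h *: (\sum_(steps h a <= j < steps h b) (u (j%:R * h) - u a)) - (b - a - d%:R * h) *: u a.
    rewrite sumrB sumr_const_nat -/d -(scaler_nat d (u a)).
    have -> : r h b = r h a + h *: \sum_(steps h a <= j < steps h b) u (j%:R * h).
      rewrite /r -scalerDr; congr (_ *: _).
      by apply: big_cat_nat => //; exact: le_steps.
    by set A := (\sum_(_ <= _ < _) _); lmod R.
  apply: le_trans (semB QV _ _ Qq) _; apply: lerD; last first.
    rewrite (sem_hom QV)//; apply: ler_pM => //; first exact: (sem_ge0 QV).
      exact: stepsB_dist.
    by apply: uC => //; exact: le_trans ab bS.
  rewrite (sem_hom QV)// gtr0_norm//.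
  apply: (@le_trans _ _ (h * (d%:R * (L q * (b - a + h))))).
    rewrite ler_pM2l// big_nat; apply: le_trans (sem_sum QV _ _ _ Qq) _.
    rewrite -big_nat; apply: (@le_trans _ _ (\sum_(steps h a <= j < steps h b) (L q * (b - a + h)))); last first.
      by rewrite sumr_const_nat -/d mulr_natl.
    rewrite !big_nat; apply: ler_sum => j /andP[aj jb].
    have j0 : 0 <= j%:R * h by rewrite mulr_ge0// ltW.
    have jb' : j%:R * h <= b.
      apply: le_trans (steps_le h0 (le_trans a0 ab)); rewrite ler_pM2r// ler_nat; exact: ltnW.
    have ja' : a < j%:R * h + h.
      apply: lt_le_trans (steps_gt h0 a0) _.
      by rewrite lerD2r ler_pM2r// ler_nat.
    have [ja|/ltW ja] := leP a (j%:R * h).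
      apply: le_trans (uL _ _ _ Qq a0 ja (le_trans jb' bS)) _.
      by rewrite ler_wpM2l ?L0//; lra.
    rewrite (semBC QV)//; apply: le_trans (uL _ _ _ Qq j0 ja (le_trans ab bS)) _.
    by rewrite ler_wpM2l ?L0//; lra.
  have dh := stepsB_le h0 a0 ab; rewrite -/d in dh.
  have -> : h * (d%:R * (L q * (b - a + h))) = L q * (b - a + h) * (d%:R * h) by ring.
  rewrite expr2 [leRHS]mulrA ler_wpM2l//; apply: mulr_ge0; first exact: L0.
  by lra.
pose hs n : R := n.+1%:R^-1.
have hs0 n : 0 < hs n by rewrite invr_gt0.
have hs_cvg : hs n @[n --> \oo] --> 0 by exact: cvg_harmonic.
have near_hs e : 0 < e -> \forall m \near \oo, forall n, (m <= n)%N -> hs n <= e.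
  move=> e0; have := hs_cvg; move=> /cvgrPdist_le /(_ e e0); apply: filterS => m.
  rewrite sub0r normrN gtr0_norm// => me n mn; apply: le_trans me.
  by rewrite lef_pV2 ?posrE// ler_nat.
have r0 h : r h 0 = 0 by rewrite /r steps0 big_geq// scaler0.
have cauchy s : 0 <= s -> s <= S -> exists l, tends Q \oo (fun n => r (hs n) s) l.
  move=> s0 sS; apply: (sem_complete QV) => q e Qq e0.
  have [s00|sp] := eqVneq s 0.
    by near=> m => n mn; rewrite s00 !r0 subrr (sem0 QV).
  have {}sp : 0 < s by rewrite lt_neqAle eq_sym sp.
  have C0 : 0 <= C q by rewrite addr_ge0 ?(sem_ge0 QV)// mulr_ge0// L0.
  (* The mesh is fixed before the step. Once [hs n <= d], each piece costs [8 L d^2], in total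
     [8 L s d <= e / 2]; the two rounding terms are then brought below [e / 8] each. *)
  pose N := (Num.truncn (16 * L q * s ^+ 2 / e)).+1.
  have N0 : 0 < N%:R :> R by [].
  pose d := s / N%:R.
  have d0 : 0 < d by exact: divr_gt0.
  have Nd : N%:R * d = s by rewrite /d mulrCA divff ?mulr1// gt_eqF.
  have Le : 16 * L q * s * d <= e.
    rewrite /d mulrA ler_pdivrMr// [leRHS]mulrC -ler_pdivrMr//.
    have /andP[_ /ltW] := @truncn_itv _ (16 * L q * s ^+ 2 / e)
      (divr_ge0 (mulr_ge0 (mulr_ge0 (ler0n _ _) (L0 _ Qq)) (sqr_ge0 _)) (ltW e0)).
    by rewrite -/N expr2 !mulrA.
  have C1 : 0 < e / 8 / (N%:R * (C q + 1)).
    by apply: divr_gt0; [lra|apply: mulr_gt0 => //; lra].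
  near=> m => n mn.
  have hd k : (m <= k)%N -> hs k <= d.
    by move: k; near: m; exact: (near_hs _ d0).
  have hC k : (m <= k)%N -> hs k * (N%:R * C q) <= e / 8.
    have h k' : (m <= k')%N -> hs k' <= e / 8 / (N%:R * (C q + 1)).
      by move: k'; near: m; exact: (near_hs _ C1).
    move=> /h; rewrite ler_pdivlMr ?mulr_gt0//; last lra.
    apply: le_trans; rewrite ler_pM2l// ler_pM2l//; lra.
  pose t (i : nat) := i%:R * d.
  have t_ge0 i : 0 <= t i by rewrite mulr_ge0// ltW.
  have tS i : t i.+1 = t i + d by rewrite /t -natr1 mulrDl mul1r.
  have t_le i : (i <= N)%N -> t i <= S.
    by move=> iN; apply: le_trans sS; rewrite -[leRHS]Nd ler_wpM2r ?(ltW d0)// ler_nat.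
  have approx i : (i <= N)%N -> q (r (hs n) (t i) - r (hs m) (t i)) <=
      i%:R * (8 * L q * d ^+ 2 + (hs n * C q + hs m * C q)).
    elim: i => [|i IH] iN; first by rewrite /t mul0r !r0 subrr (sem0 QV)// mul0r.
    have tle : t i <= t i.+1 by rewrite tS lerDl ltW.
    have in_ := incr q (hs n) (t i) (t i.+1) Qq (hs0 n) (t_ge0 i) tle (t_le _ iN).
    have im := incr q (hs m) (t i) (t i.+1) Qq (hs0 m) (t_ge0 i) tle (t_le _ iN).
    have tB : t i.+1 - t i = d by rewrite tS addrAC subrr add0r.
    rewrite tB in in_ im.
    have sq k : (m <= k)%N -> L q * (d + hs k) ^+ 2 <= 4 * L q * d ^+ 2.
      move=> mk; rewrite (_ : 4 * L q * d ^+ 2 = L q * (d + d) ^+ 2); last by ring.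
      rewrite ler_wpM2l ?L0// ler_sqr ?nnegrE; [|have := hs0 k; lra|lra].
      by rewrite lerD2l; exact: hd.
    have -> : r (hs n) (t i.+1) - r (hs m) (t i.+1) = (r (hs n) (t i) - r (hs m) (t i)) +
        ((r (hs n) (t i.+1) - r (hs n) (t i) - d *: u (t i)) -
         (r (hs m) (t i.+1) - r (hs m) (t i) - d *: u (t i))) by lmod R.
    apply: le_trans (sem_tri QV _ _ Qq) _; rewrite -natr1 mulrDl mul1r.
    apply: lerD; first exact: IH (ltnW iN).
    apply: le_trans (semB QV _ _ Qq) _.
    have := sq n mn; have := sq m (leqnn _); lra.
  have := approx N (leqnn _); rewrite /t Nd => /le_lt_trans; apply.
  have -> : N%:R * (8 * L q * d ^+ 2 + (hs n * C q + hs m * C q)) =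
    (16 * L q * (N%:R * d) * d) / 2 + (hs n * (N%:R * C q) + hs m * (N%:R * C q)) by field.
  rewrite Nd; have := hC n mn; have := hC m (leqnn _); lra.
have /choice[U UP] : forall s, exists l, 0 <= s -> s <= S -> tends Q \oo (fun n => r (hs n) s) l.
  move=> s; have [s0|s0] := leP 0 s; last by exists 0.
  have [sS|sS] := leP s S; last by exists 0.
  by have [l sl] := cauchy s s0 sS; exists l.
exists U.
  have U0 := UP 0 (lexx _) S0; apply: (tends_unique QV U0).
  rewrite (_ : (fun n => _) = fun=> 0); first exact: (tends_cst QV).
  by apply/funext => n; exact: r0.
move=> q a b Qq a0 ab bS.
apply/ler_addgt0Pr => e e0.
have C0 : 0 <= C q by rewrite addr_ge0 ?(sem_ge0 QV)// mulr_ge0// L0.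
(* For [h <= 1], expanding [(b - a + h)^2] leaves an excess of at most [(2 (b - a) + 1) h]; with the
   rounding term [h C] this stays below [h K]. *)
pose K := L q * (2 * (b - a) + 1) + C q + 1.
have K0 : 0 < K.
  have : 0 <= L q * (2 * (b - a) + 1) by rewrite mulr_ge0 ?L0//; lra.
  by rewrite /K; lra.
have lim : tends Q \oo (fun n => r (hs n) b - r (hs n) a - (b - a) *: u a)
    (U b - U a - (b - a) *: u a).
  apply: (tendsD QV); last exact: (tends_cst QV).
  have Ub := UP b (le_trans a0 ab) bS.
  have Ua : tends Q \oo (fun n => (-1) *: r (hs n) a) (- U a).
    by rewrite -scaleN1r; apply: (tendsZ QV); exact: UP (le_trans ab bS).
  rewrite (_ : (fun n => _) = fun n => r (hs n) b + (-1) *: r (hs n) a); first exact: (tendsD QV Ub Ua).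
  by apply/funext => n; rewrite scaleN1r.
apply: (tends_le QV Qq lim); near=> n.
apply: le_trans (incr _ _ _ _ Qq (hs0 n) a0 ab bS) _.
have h1 : hs n <= 1.
  by near: n; apply: filterS (near_hs _ ltr01) => m /(_ m (leqnn m)).
have h2 : hs n * K <= e.
  by rewrite -ler_pdivlMr//; near: n; apply: filterS (near_hs _ (divr_gt0 e0 K0)) => m /(_ m (leqnn m)).
have h0 := hs0 n.
have : L q * (b - a + hs n) ^+ 2 <= L q * (b - a) ^+ 2 + L q * (2 * (b - a) + 1) * hs n.
  have -> : L q * (b - a) ^+ 2 + L q * (2 * (b - a) + 1) * hs n =
    L q * ((b - a) ^+ 2 + (2 * (b - a) + 1) * hs n) by ring.
  rewrite ler_wpM2l ?L0// sqrrD !expr2; have := L0 _ Qq.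
  have : hs n * hs n <= hs n by rewrite ger_pMl.
  by lra.
by move: h2; rewrite /K; lra.
Unshelve. all: by end_near. Qed.

End LipschitzPrimitive.

(** * Weak limits of the orbits and strong convergence *)

Lemma cvg_bounded (R : realType) (a : nat -> R) (l : R) :
  a n @[n --> \oo] --> l -> exists C, forall n, `|a n| <= C.
Proof.
move=> al; have /cvg_seq_bounded[C [_ aC]] : cvgn (a : nat -> R^o).
  by apply/cvg_ex; exists l.
by exists (C + 1) => n; apply: aC => //; rewrite ltrDl.
Qed.

Lemma cvg_le_limit (R : realType) (a : nat -> R) (l c : R) : a n @[n --> \oo] --> l ->
  (forall e, 0 < e -> \forall n \near \oo, a n <= c + e) -> l <= c.
Proof.
move=> al ac; apply/ler_addgt0Pr => e e0.
apply: (closed_cvg (fun r => r <= c + e)) al; first exact: closed_le.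
exact: ac.
Qed.

Lemma homo_near (P : nat -> Prop) (s : nat -> nat) : {homo s : m n / (m < n)%N} ->
  (\forall n \near \oo, P n) -> \forall n \near \oo, P (s n).
Proof.
move=> hs [N _ NP]; exists N => // n /= Nn; apply: NP => /=.
by apply: leq_trans Nn _; elim: n => // n IH; apply: leq_ltn_trans IH (hs _ _ _).
Qed.

(** * Estimates along discrete orbits *)

Section OrbitEstimates.
Variables (R : realType) (V : lmodType R) (Q : set (V -> R)) (F : R -> V -> V).
Hypothesis QV : seminorm_system Q.
Hypothesis F_linear : forall h, 0 <= h -> linear (F h).
Hypothesis F_bounded : power_bounded Q F.

Let near0 := near0_pos R.

Definition orbit f h s := iter (steps h s) (F h) f.

(** Here [phi'] is the strong derivative of [F^*] at 0 applied to [phi]: the discs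
    [seminorm_ball Q L] absorb all bounded sets, so the convergence is that of the strong
    topology. *)
Definition adjoint_pair (phi phi' : V -> R) :=
  [/\ functional Q phi, functional Q phi'
    & forall L e, 0 < e -> \forall h \near 0^'+, forall x, seminorm_ball Q L x ->
        `|h^-1 * (phi (F h x) - phi x) - phi' x| <= e].

(** Up to [e], [d] iterations displace [f] by a Riemann sum of the orbit of [z], of size [d h q2 z];
    the preceding [m] iterations are absorbed in [q1]. *)
Lemma orbit_increment f z S q : 0 <= S -> sem_closure Q (mef_graph Q F) (f, z) -> Q q ->
  exists2 L, 0 <= L & forall e, 0 < e -> \forall h \near 0^'+,
    forall m d, (m + d)%:R * h <= S ->
      q (iter (m + d) (F h) f - iter m (F h) f) <= L * (d%:R * h) + e.
Proof.
move=> S0 fz Qq.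
have [q1 Qq1 Fq1] := geometric_sum_bounded QV F_bounded S Qq.
have [q2 Qq2 Fq2] := geometric_sum_bounded QV F_bounded S Qq1.
exists (q2 z) => [|e e0]; first exact: (sem_ge0 QV).
near=> h => m d mdS.
have h0 : 0 < h by near: h; exact: near0.
have Fl := F_linear (ltW h0).
have mh : m%:R * h <= S.
  by apply: le_trans mdS; rewrite ler_pM2r// ler_nat leq_addr.
have dh : d%:R * h <= S.
  by apply: le_trans mdS; rewrite ler_pM2r// ler_nat leq_addl.
rewrite iterD -(linear_funB (iter_linear m Fl)).
have approx : forall n, n%:R * h <= S ->
    q1 (iter n (F h) f - f - h *: geometric_sum F h n z) <= e.
  near: h; exact: (iter_mef_closure QV F_linear F_bounded S0 fz Qq1 e0).
have [_ b1] := Fq1 h m (iter d (F h) f - f) (ltW h0) mh.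
have [b2 _] := Fq2 h d z (ltW h0) dh.
have b3 := approx d dh.
have := sem_le QV (iter d (F h) f - f) (h *: geometric_sum F h d z) Qq1.
lra.
Unshelve. all: by end_near. Qed.

(** The orbit is a step function of time, so a Lipschitz bound can hold only up to an error
    vanishing with [h]. Weak limits satisfy it without the error. *)
Lemma orbit_lipschitz f z S q : 0 <= S -> sem_closure Q (mef_graph Q F) (f, z) -> Q q ->
  exists2 L, 0 <= L & forall e, 0 < e -> \forall h \near 0^'+,
    forall a b, 0 <= a -> a <= b -> b <= S ->
      q (orbit f h b - orbit f h a) <= L * (b - a) + e.
Proof.
move=> S0 fz Qq; have [L L0 incr] := orbit_increment S0 fz Qq.
exists L => // e e0.
have e2 : 0 < e / 2 by lra.
have eL : 0 < e / 2 / (L + 1) by apply: divr_gt0 => //; lra.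
near=> h => a b a0 ab bS.
have h0 : 0 < h by near: h; exact: near0.
have hL : h * L <= e / 2.
  have : h <= e / 2 / (L + 1) by near: h; exact: nbhs_right_ltW.
  by rewrite ler_pdivlMr; lra.
have incr_h : forall m d, (m + d)%:R * h <= S ->
    q (iter (m + d) (F h) f - iter m (F h) f) <= L * (d%:R * h) + e / 2.
  near: h; exact: incr.
have E : steps h b = (steps h a + (steps h b - steps h a))%N.
  by rewrite subnKC//; exact: le_steps.
rewrite /orbit E; apply: le_trans (incr_h _ _ _) _.
  by rewrite -E; exact: le_trans (steps_le h0 (le_trans a0 ab)) bS.
have := ler_wpM2l L0 (stepsB_le h0 a0 ab); lra.
Unshelve. all: by end_near. Qed.

Lemma orbit_bounded f S : exists L, forall h m, 0 <= h -> m%:R * h <= S ->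
  seminorm_ball Q L (iter m (F h) f).
Proof.
have /choice[p pP] : forall q, exists p : V -> R, Q q -> forall h m x, 0 <= h ->
    m%:R * h <= S -> q (iter m (F h) x) <= p x.
  move=> q; have [Qq|nQ] := pselect (Q q); last by exists (fun=> 0).
  by have [p _ qp] := F_bounded S Qq; exists p.
by exists (fun q => p q f) => h m h0 mh q Qq; exact: pP.
Qed.

(** One iteration changes [phi] by nearly [h phi'] of the current point, uniformly because the orbit
    stays in one bounded disc. Freezing [phi'] at time [a] costs the Lipschitz bound of the orbit,
    which produces the quadratic term. *)
Lemma adjoint_orbit f z S phi phi' : 0 <= S -> sem_closure Q (mef_graph Q F) (f, z) ->
  adjoint_pair phi phi' ->
  exists2 L, 0 <= L & forall e, 0 < e -> \forall h \near 0^'+,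
    forall a b, 0 <= a -> a <= b -> b <= S ->
      `|phi (orbit f h b) - phi (orbit f h a) - (b - a) * phi' (orbit f h a)|
        <= L * (b - a) ^+ 2 + e.
Proof.
move=> S0 fz [fphi fphi' dphi].
have [q Qq phi'q] := functional_abs QV fphi'.
have [L L0 incr] := orbit_increment S0 fz Qq.
have [B orbitB] := orbit_bounded f S.
exists L => // e0 e00.
have B0 : 0 <= B q.
  apply: le_trans (sem_ge0 QV f Qq) _.
  by apply: (orbitB 0 0%N) => //; rewrite mul0r.
(* [K] collects the coefficients of [e] in [(D + h) (L (D + h) + 2 e) + h B] beyond [L D^2], for
   [h <= e <= 1] and [D = b - a <= S]. *)
pose K := 2 * S * L + L + 2 * S + 2 + B q.
have SL : 0 <= S * L by exact: mulr_ge0.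
have K0 : 0 < K by rewrite /K; lra.
pose e := Num.min 1 (e0 / K).
have e_gt0 : 0 < e by rewrite lt_min ltr01 divr_gt0.
have eK : e * K <= e0 by rewrite -ler_pdivlMr// ge_min lexx orbT.
near=> h => a b a0 ab bS.
have h0 : 0 < h by near: h; exact: near0.
have h1 : h <= 1 by near: h; exact: nbhs_right_ltW.
have he : h <= e by near: h; exact: nbhs_right_ltW.
have incr_h : forall m d, (m + d)%:R * h <= S ->
    q (iter (m + d) (F h) f - iter m (F h) f) <= L * (d%:R * h) + e.
  near: h; exact: incr.
have dphi_h : forall x, seminorm_ball Q B x -> `|h^-1 * (phi (F h x) - phi x) - phi' x| <= e.
  near: h; exact: dphi.
set m := steps h a; set d := (steps h b - m)%N.
have E : steps h b = (m + d)%N by rewrite subnKC//; exact: le_steps.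
have mdS : (m + d)%:R * h <= S by rewrite -E; exact: le_trans (steps_le h0 (le_trans a0 ab)) bS.
pose y j := iter (m + j) (F h) f.
have jS j : (j <= d)%N -> (m + j)%:R * h <= S.
  by move=> jd; apply: le_trans mdS; rewrite ler_pM2r// ler_nat leq_add2l.
have term (j : 'I_d) : `|phi (y j.+1) - phi (y j) - h * phi' (y 0%N)| <=
    h * (L * (d%:R * h) + 2 * e).
  have jd := ltnW (ltn_ord j).
  have yB := orbitB h _ (ltW h0) (jS _ jd).
  have := dphi_h _ yB; rewrite -/(y j).
  have -> : F h (y j) = y j.+1 by rewrite /y addnS.
  have := incr_h m j (jS _ jd); rewrite -/(y j) => yj.
  have y0 : iter m (F h) f = y 0%N by rewrite /y addn0.
  have := phi'q (y j - y 0%N); rewrite (functionalB _ _ fphi') => c1 c2.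
  have -> : phi (y j.+1) - phi (y j) - h * phi' (y 0%N) =
    h * ((h^-1 * (phi (y j.+1) - phi (y j)) - phi' (y j)) + (phi' (y j) - phi' (y 0%N))).
    by field; rewrite gt_eqF.
  rewrite normrM gtr0_norm// ler_pM2l//; apply: le_trans (ler_normD _ _) _.
  have : L * (j%:R * h) <= L * (d%:R * h).
    by rewrite ler_wpM2l// ler_pM2r// ler_nat.
  by rewrite y0 in yj; lra.
have tele : phi (y d) - phi (y 0%N) - d%:R * h * phi' (y 0%N) =
    \sum_(j < d) (phi (y j.+1) - phi (y j) - h * phi' (y 0%N)).
  rewrite sumrB sumr_const card_ord -(big_mkord xpredT (fun j => phi (y j.+1) - phi (y j))).
  by rewrite (telescope_sumr (phi \o y))// -mulrA -[in RHS]mulr_natl.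
have main : `|phi (y d) - phi (y 0%N) - d%:R * h * phi' (y 0%N)| <=
    d%:R * h * (L * (d%:R * h) + 2 * e).
  rewrite tele; apply: le_trans (ler_norm_sum _ _ _) _.
  apply: le_trans (ler_sum _ (fun j _ => term j)) _.
  by rewrite sumr_const card_ord -[leLHS]mulr_natl mulrA.
have y0 : orbit f h a = y 0%N by rewrite /y addn0.
have yd : orbit f h b = y d by rewrite /orbit E.
have dist := stepsB_dist h0 a0 ab; rewrite -/m -/d in dist.
have le_d := stepsB_le h0 a0 ab; rewrite -/m -/d in le_d.
have y0B : `|phi' (y 0%N)| <= B q.
  by apply: le_trans (phi'q _) _; exact: (orbitB h _ (ltW h0) (jS _ (leq0n _))).
have b1 : `|(b - a - d%:R * h) * phi' (y 0%N)| <= h * B q.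
  by rewrite normrM; exact: ler_pM.
rewrite yd y0.
have -> : phi (y d) - phi (y 0%N) - (b - a) * phi' (y 0%N) =
  (phi (y d) - phi (y 0%N) - d%:R * h * phi' (y 0%N)) - (b - a - d%:R * h) * phi' (y 0%N).
  by ring.
apply: le_trans (ler_normB _ _) _.
set D := b - a in le_d *.
have D0 : 0 <= D by rewrite subr_ge0.
have DS : D <= S by rewrite /D; lra.
have dh0 : 0 <= d%:R * h by rewrite mulr_ge0// ltW.
have b2 : d%:R * h * (L * (d%:R * h) + 2 * e) <= (D + h) * (L * (D + h) + 2 * e).
  apply: ler_pM => //; first by rewrite addr_ge0 ?mulr_ge0//; lra.
  by rewrite lerD2r ler_wpM2l.
have b3 : h * B q <= e * B q by exact: ler_wpM2r.
have b4 : h * (D * L) <= e * (S * L) by apply: ler_pM; [exact: ltW|exact: mulr_ge0|exact: he|exact: ler_wpM2r].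
have b5 : h * h * L <= e * L.
  by rewrite ler_wpM2r//; apply: le_trans he; rewrite ger_pMl.
have b6 : e * D <= e * S by rewrite ler_pM2l.
have b7 : e * h <= e by rewrite ger_pMr.
by move: eK; rewrite /K expr2; lra.
Unshelve. all: by end_near. Qed.

(** [phi] applied to the quotient of [F] at [f_ h] is the quotient of [F^*] at [phi], evaluated at
    [f_ h]. Passing to a sequence matters: the convergent sequence [f_ (hs n)] lies in one bounded
    disc, where the latter quotients converge uniformly. *)
Lemma adjoint_mef (hs : nat -> R) phi phi' x w : hs n @[n --> \oo] --> 0^'+ ->
  adjoint_pair phi phi' -> sem_closure Q (mef_graph Q F) (x, w) -> phi w = phi' x.
Proof.
move=> hs0 [fphi fphi' dphi] xw.
have fN : functional Q (fun x => - phi' x).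
  have [q Qq phi'q] := functional_abs QV fphi'.
  split; first by move=> a u v; rewrite (functionalD _ _ fphi') (functionalZ _ _ fphi'); ring.
  by exists q => // u; apply: le_trans (phi'q u); rewrite -normrN ler_norm.
suff ann u : mef_graph Q F u -> - phi' u.1 + phi u.2 = 0.
  have := sem_closure_functional QV fN fphi ann xw => /=; lra.
case: u => {x w xw}x w [f_ /= fx Dw].
have near_hs P : (\forall h \near 0^'+, P h) -> \forall n \near \oo, P (hs n) by exact: hs0.
have fx' : tends Q \oo (fun n => f_ (hs n)) x by move=> q e Qq e0; apply: (near_hs (fun h => q (f_ h - x) < e)); exact: fx.
have /choice[L LP] : forall q, exists C, Q q -> forall n, q (f_ (hs n)) <= C.
  move=> q; have [Qq|nQ] := pselect (Q q); last by exists 0.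
  have [|C qC] := @cvg_bounded R (fun n => q (f_ (hs n) - x)) 0.
    apply/cvgrPdist_lt => e e0; near=> n.
    by rewrite sub0r normrN ger0_norm ?(sem_ge0 QV)//; near: n; exact: fx'.
  exists (C + q x) => _ n; apply: le_trans (sem_le QV (f_ (hs n)) x Qq) _.
  by rewrite lerD2r; exact: le_trans (ler_norm _) (qC n).
have c1 : phi' (f_ (hs n)) @[n --> \oo] --> phi' x by exact: tends_weakly fx' _ fphi'.
have Dw' : tends Q \oo (fun n => (hs n)^-1 *: (F (hs n) (f_ (hs n)) - f_ (hs n))) w.
  by move=> q e Qq e0; apply: (near_hs (fun h => q (h^-1 *: (F h (f_ h) - f_ h) - w) < e)); exact: Dw.
have c2 := tends_weakly QV Dw' fphi.
apply/eqP; rewrite addrC subr_eq0; apply/eqP.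
apply: (cvg_unique (@Rhausdorff R) (c2 _)).
apply/cvgrPdist_le => e e0.
have e2 : 0 < e / 2 by lra.
near=> n.
have d1 : `|phi' x - phi' (f_ (hs n))| <= e / 2.
  by near: n; move/cvgrPdist_le: c1; exact.
have fB : seminorm_ball Q L (f_ (hs n)) by move=> q Qq; exact: LP.
have d2 : forall y, seminorm_ball Q L y ->
    `|(hs n)^-1 * (phi (F (hs n) y) - phi y) - phi' y| <= e / 2.
  near: n; apply: (near_hs (fun h => forall y, seminorm_ball Q L y ->
      `|h^-1 * (phi (F h y) - phi y) - phi' y| <= e / 2)); exact: dphi.
have := d2 _ fB; rewrite (functionalZ _ _ fphi) (functionalB _ _ fphi) distrC.
have -> : phi' x - (hs n)^-1 * (phi (F (hs n) (f_ (hs n))) - phi (f_ (hs n))) =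
  (phi' x - phi' (f_ (hs n))) +
  (phi' (f_ (hs n)) - (hs n)^-1 * (phi (F (hs n) (f_ (hs n))) - phi (f_ (hs n)))) by ring.
move=> d3; apply: le_trans (ler_normD _ _) _; lra.
Unshelve. all: by end_near. Qed.

End OrbitEstimates.

(** * Weak limits of orbits and their integrals *)

Section WeakOrbitLimit.
Variables (R : realType) (V : lmodType R) (Q : set (V -> R)) (F : R -> V -> V).
Hypothesis QV : seminorm_system Q.
Hypothesis F_linear : forall h, 0 <= h -> linear (F h).
Hypothesis F_bounded : power_bounded Q F.
Variable hs : nat -> R.
Hypothesis hs_cvg : hs n @[n --> \oo] --> 0^'+.
Variable G : set (V * V).
Hypothesis G_subspace : subspace_rel G.
Hypothesis G_mef : G `<=` mef_graph Q F.

Definition weakly_compact_seq (v : nat -> V) :=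
  forall s : nat -> nat, {homo s : m n / (m < n)%N} ->
    exists2 t : nat -> nat, {homo t : m n / (m < n)%N}
      & exists l, weakly_tends Q \oo (v \o s \o t) l.

Let near_hs (P : R -> Prop) : (\forall h \near 0^'+, P h) -> \forall n \near \oo, P (hs n).
Proof. by move=> h; exact: hs_cvg. Qed.

Let G_clos : sem_closure Q G `<=` sem_closure Q (mef_graph Q F).
Proof. exact: sem_closure_mono. Qed.

Variables (f z : V).
Hypothesis fz : G (f, z).

Let fz_clos : sem_closure Q (mef_graph Q F) (f, z).
Proof. by apply: G_clos; exact: (sem_closure_sub QV). Qed.

Hypothesis f_compact : forall s, 0 <= s -> exists f_ w_ : nat -> V,
  [/\ forall n, sem_closure Q G (f_ n, w_ n),
      weakly_tends Q \oo (fun n => orbit F f (hs n) s - f_ n) 0,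
      weakly_compact_seq w_ & weakly_compact_seq f_].

Lemma weakly_tends_sub (v : nat -> V) l (s : nat -> nat) :
  {homo s : m n / (m < n)%N} -> weakly_tends Q \oo v l -> weakly_tends Q \oo (v \o s) l.
Proof. by move=> hs' vl phi fphi P Pl; exact: (homo_near hs' (vl _ fphi _ Pl)). Qed.

Lemma weakly_tends_diff (u v : nat -> V) l : weakly_tends Q \oo (fun n => u n - v n) 0 ->
  weakly_tends Q \oo v l -> weakly_tends Q \oo u l.
Proof.
move=> uv vl phi fphi.
rewrite (_ : (fun n => phi (u n)) = (fun n => phi (u n - v n)) \+ (phi \o v)); last first.
  by apply/funext => n /=; rewrite (functionalB _ _ fphi) subrK.
rewrite -[phi l]add0r; apply: cvgD; last exact: vl.
have <- : phi 0 = 0 by rewrite -(subrr f) (functionalB _ _ fphi) subrr.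
exact: uv.
Qed.

(* Along one subsequence for which the orbit converges at all rational times,
   it converges at every time, as the orbits are asymptotically Lipschitz. *)
Lemma weak_orbit_limit :
  exists2 sg : nat -> nat, {homo sg : m n / (m < n)%N} &
  exists u w : R -> V, forall s, 0 <= s ->
    sem_closure Q G (u s, w s) /\
    weakly_tends Q \oo (fun n => orbit F f (hs (sg n)) s) (u s).
Proof.
(* An enumeration of the rationals; [odflt 0] serves the indices that code none, and negative times
   satisfy [P] vacuously. *)
pose rt i : R := ratr (odflt 0 (unpickle i)).
pose P i (sg : nat -> nat) := 0 <= rt i ->
  exists l, weakly_tends Q \oo (fun n => orbit F f (hs (sg n)) (rt i)) l.
have [||sg hsg Psg] := @diagonal_subsequence P.
- move=> i s hs'; have [r0|r0] := leP 0 (rt i); last first.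
    by exists id => //; rewrite /P leNgt r0.
  have [f_ [w_ [_ of_ _ fc]]] := f_compact r0.
  have [t ht [l fl]] := fc s hs'; exists t => // _; exists l.
  apply: (weakly_tends_diff _ fl).
  by apply: (weakly_tends_sub (s := s \o t) _ of_) => m n mn; apply: hs'; exact: ht.
- move=> i s s' Ps ss' r0; have [l sl] := Ps r0; exists l => phi fphi.
  apply/cvgrPdist_lt => e e0.
  have /cvgrPdist_lt/(_ e e0)[N _ NP] := sl _ fphi.
  exists (maxn N i.+1) => // n /=; rewrite geq_max => /andP[Nn i_n].
  have [m nm ->] := ss' _ i_n; apply: NP => /=; exact: leq_trans nm.
exists sg => //.
suff /choice[u uP] : forall s, exists l : V * V, 0 <= s ->
    sem_closure Q G l /\ weakly_tends Q \oo (fun n => orbit F f (hs (sg n)) s) l.1.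
  exists (fst \o u), (snd \o u) => s s0 /=.
  by rewrite -surjective_pairing; exact: uP.
move=> s; have [s0|s0] := leP 0 s; last by exists 0.
(* At the given time compactness provides only a further subsequence [t], with limits [(l1, l2)] in
   the closed graph. That the orbit along [sg] itself tends to [l1] follows by comparison with a
   nearby rational time, where it is known to converge. *)
have [f_ [w_ [fw of_ wc fc]]] := f_compact s0.
have [t1 ht1 [l1 fl1]] := fc _ hsg.
have hst1 : {homo sg \o t1 : m n / (m < n)%N} by move=> m n mn; apply: hsg; exact: ht1.
have [t2 ht2 [l2 wl2]] := wc _ hst1.
pose t := t1 \o t2.
have ht : {homo t : m n / (m < n)%N} by move=> m n mn; apply: ht1; exact: ht2.
have hst : {homo sg \o t : m n / (m < n)%N} by move=> m n mn; apply: hsg; exact: ht.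
have fl : weakly_tends Q \oo (f_ \o sg \o t) l1 by exact: (weakly_tends_sub ht2 fl1).
have ol : weakly_tends Q \oo (fun n => orbit F f (hs (sg (t n))) s) l1.
  by apply: (weakly_tends_diff _ fl); exact: (weakly_tends_sub hst of_).
exists (l1, l2) => _; split.
  by apply: (sem_closure_weakly QV G_subspace _ fl wl2) => n; exact: fw.
move=> phi fphi /=; have [q Qq phiq] := functional_abs QV fphi.
have S0 : 0 <= s + 1 by lra.
have [L L0 lip] := orbit_lipschitz QV F_linear F_bounded S0 fz_clos Qq.
apply/cvgrPdist_le => e e0.
have e8 : 0 < e / 8 by lra.
pose d := Num.min 1 (e / 8 / (L + 1)).
have d0 : 0 < d by rewrite lt_min ltr01 divr_gt0//; lra.
have [r] : exists r : rat, ratr r \in `]s, s + d[ by apply: rat_in_itvoo; rewrite ltrDl.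
rewrite in_itv/= => /andP[sr rd].
have d1 : d <= 1 by rewrite ge_min lexx.
have Ld : L * (ratr r - s) <= e / 8.
  have dL : d <= e / 8 / (L + 1) by rewrite ge_min lexx orbT.
  rewrite ler_pdivlMr in dL; last lra.
  have : L * (ratr r - s) <= L * d by rewrite ler_wpM2l//; lra.
  lra.
have rtr : rt (pickle r) = ratr r by rewrite /rt pickleK.
have r0 : 0 <= rt (pickle r) by rewrite rtr; lra.
have [lr] := Psg _ r0; rewrite rtr => olr.
have close : \forall n \near \oo,
    `|phi (orbit F f (hs (sg n)) (ratr r)) - phi (orbit F f (hs (sg n)) s)| <= e / 4.
  have := homo_near hsg (near_hs (lip _ e8)); apply: filterS => n lipn.
  rewrite -(functionalB _ _ fphi); apply: le_trans (phiq _) _.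
  apply: le_trans (lipn _ _ s0 (ltW sr) _) _; lra.
have l1r : `|phi lr - phi l1| <= e / 4.
  have cv : `|phi (orbit F f (hs (sg (t n))) (ratr r)) - phi (orbit F f (hs (sg (t n))) s)|
      @[n --> \oo] --> `|phi lr - phi l1|.
    apply: cvg_norm; apply: cvgB; last exact: (ol _ fphi).
    by have := weakly_tends_sub ht olr fphi; exact.
  apply: (cvg_le_limit cv) => e' e'0; apply: filterS (homo_near ht close) => n.
  by move=> /le_trans; apply; rewrite lerDl ltW.
have e4 : 0 < e / 4 by lra.
near=> n.
have c1 : `|phi (orbit F f (hs (sg n)) (ratr r)) - phi (orbit F f (hs (sg n)) s)| <= e / 4.
  by near: n.
have c2 : `|phi lr - phi (orbit F f (hs (sg n)) (ratr r))| <= e / 4.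
  by near: n; move/cvgrPdist_le: (olr phi fphi); exact.
have -> : phi l1 - phi (orbit F f (hs (sg n)) s) = - (phi lr - phi l1) +
  ((phi lr - phi (orbit F f (hs (sg n)) (ratr r))) +
  (phi (orbit F f (hs (sg n)) (ratr r)) - phi (orbit F f (hs (sg n)) s))) by ring.
apply: le_trans (ler_normD _ _) _; rewrite normrN.
have := ler_normD (phi lr - phi (orbit F f (hs (sg n)) (ratr r)))
  (phi (orbit F f (hs (sg n)) (ratr r)) - phi (orbit F f (hs (sg n)) s)).
lra.
Unshelve. all: by end_near. Qed.

Hypothesis adjoint_dense : forall phi, functional Q phi ->
  exists phi_ phi'_ : nat -> V -> R, (forall k, adjoint_pair Q F (phi_ k) (phi'_ k)) /\
    forall x, phi_ k x @[k --> \oo] --> phi x.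

Hypothesis mef_dense : sem_dense Q [set x | exists w, mef_graph Q F (x, w)].

(* The weak limit [u] of the orbits satisfies [u s - f = Z (\int_0^s u)] for
   the closure of [G]: a functional [(eta, xi)] vanishing on [G] is tested on
   both sides, and [xi] is approximated by elements of the adjoint domain, for
   which the derivative of [xi \o u] is known. *)
Lemma orbit_integral s : 0 <= s -> exists x y,
  [/\ sem_closure Q G (x, y - f),
      tends Q 0^'+ (fun h => h *: geometric_sum F h (steps h s) f) x
    & exists2 sg : nat -> nat, {homo sg : m n / (m < n)%N} &
        weakly_tends Q \oo (fun n => orbit F f (hs (sg n)) s) y].
Proof.
move=> s0; have [sg hsg [u [w uwP]]] := weak_orbit_limit.
pose ob n := orbit F f (hs (sg n)).
have obu a : 0 <= a -> weakly_tends Q \oo (ob^~ a) (u a) by move=> a0; have [] := uwP _ a0.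
have uwG a : 0 <= a -> sem_closure Q G (u a, w a) by move=> a0; have [] := uwP _ a0.
have near_sg P : (\forall h \near 0^'+, P h) -> \forall n \near \oo, P (hs (sg n)).
  by move=> /near_hs /(homo_near hsg).
have u0 : u 0 = f.
  apply: (weakly_tends_unique QV (obu 0 (lexx _))).
  rewrite (_ : ob^~ 0 = fun=> f); first by move=> phi _; exact: cvg_cst.
  by apply/funext => n; rewrite /ob /orbit steps0.
(* One unit of time beyond [s] leaves room for right difference quotients of [u] at all times up to
   [s]. *)
have S0 : 0 <= s + 1 by lra.
have /choice[L LP] : forall q, exists L, Q q -> 0 <= L /\ forall a b, 0 <= a -> a <= b ->
    b <= s + 1 -> q (u b - u a) <= L * (b - a).
  move=> q; have [Qq|nQ] := pselect (Q q); last by exists 0.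
  have [L L0 lip] := orbit_lipschitz QV F_linear F_bounded S0 fz_clos Qq.
  exists L => _; split=> // a b a0 ab bS.
  have ba : weakly_tends Q \oo (fun n => ob n b - ob n a) (u b - u a).
    move=> phi fphi; rewrite (functionalB _ _ fphi).
    rewrite (_ : (fun n => _) = (fun n => phi (ob n b)) \- (fun n => phi (ob n a))); last first.
      by apply/funext => n; rewrite (functionalB _ _ fphi).
    by apply: cvgB; apply: obu => //; exact: le_trans ab.
  apply: (weakly_tends_le QV Qq ba) => e e0.
  by apply: filterS (near_sg _ (lip e e0)) => n; exact.
have L0 q : Q q -> 0 <= L q by move=> /LP[].
have Llip q a b : Q q -> 0 <= a -> a <= b -> b <= s + 1 -> q (u b - u a) <= L q * (b - a).
  by move=> /LP[_]; exact.
have [U U0 Uder] := lipschitz_primitive QV S0 L0 Llip.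
have adj_der phi phi' : adjoint_pair Q F phi phi' -> exists2 K, 0 <= K &
    forall a b, 0 <= a -> a <= b -> b <= s + 1 ->
      `|phi (u b) - phi (u a) - (b - a) * phi' (u a)| <= K * (b - a) ^+ 2.
  move=> adj; have [fphi fphi' _] := adj.
  have [K K0 der] := adjoint_orbit QV F_linear F_bounded S0 fz_clos adj.
  exists K => // a b a0 ab bS.
  have cv : `|phi (ob n b) - phi (ob n a) - (b - a) * phi' (ob n a)| @[n --> \oo] -->
      `|phi (u b) - phi (u a) - (b - a) * phi' (u a)|.
    have b0 := le_trans a0 ab.
    apply: cvg_norm; apply: cvgB; first by apply: cvgB; exact: obu.
    by apply: cvgMr; exact: obu.
  apply: (cvg_le_limit cv) => e e0.
  by apply: filterS (near_sg _ (der e e0)) => n; exact.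
have UG c : 0 <= c -> c <= s -> sem_closure Q G (U c, u c - f).
  rewrite le_eqVlt => /predU1P[<- _|c0 cs].
    by rewrite U0 u0 subrr; apply: (sem_closure_sub QV); exact: G_subspace.1.
  apply: (sem_closure_separation QV G_subspace) => eta xi feta fxi ann.
  have ann' := sem_closure_functional QV feta fxi ann.
  have [psi [psi' [adj psi_xi]]] := adjoint_dense fxi.
  have fpsi k : functional Q (psi k) by have [] := adj k.
  have fpsi' k : functional Q (psi' k) by have [] := adj k.
  have psi'w k a : 0 <= a -> psi' k (u a) = psi k (w a).
    by move=> a0; apply/esym/(adjoint_mef QV hs_cvg (adj k))/G_clos/uwG.
  have [q1 Qq1 etaq] := functional_abs QV feta.
  have /choice[K1 K1P] : forall k, exists K, 0 <= K /\
      (forall a b, 0 <= a -> a <= b -> b <= s + 1 ->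
        `|psi k (u b) - psi k (u a) - (b - a) * psi' k (u a)| <= K * (b - a) ^+ 2) /\
      (forall a b, 0 <= a -> a <= b -> b <= s + 1 ->
        `|psi' k (u b) - psi' k (u a)| <= K * (b - a)).
    move=> k; have [K K0 der] := adj_der _ _ (adj k).
    have [q Qq psiq] := functional_abs QV (fpsi' k).
    exists (K + L q); split; first by rewrite addr_ge0 ?L0.
    split=> a b a0 ab bS; rewrite [leRHS]mulrDl.
      apply: le_trans (der _ _ a0 ab bS) _; rewrite lerDl.
      by rewrite mulr_ge0 ?L0 ?sqr_ge0.
    rewrite -(functionalB _ _ (fpsi' k)); apply: le_trans (psiq _) _.
    apply: le_trans (Llip _ _ _ Qq a0 ab bS) _; rewrite lerDr.
    by rewrite mulr_ge0 ?subr_ge0.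
  (* As [k] grows, the derivative [r k a] of [W k] tends to [xi (w a) + eta (u a) = 0]. The
     increment of [W k] over [[0, c]] then tends to 0, which reads
     [xi (u c - f) + eta (U c) = 0]. *)
  pose W k a := psi k (u a) + eta (U a).
  pose r k a := psi' k (u a) + eta (u a).
  have Wr k : quadratic_primitive c (K1 k + L q1) (W k) (r k).
    have [K0 [der lip]] := K1P k.
    split=> a b a0 ab bs; rewrite [leRHS]mulrDl.
      have bS : b <= s + 1 by lra.
      have -> : W k b - W k a - (b - a) * r k a =
          (psi k (u b) - psi k (u a) - (b - a) * psi' k (u a)) +
          eta (U b - U a - (b - a) *: u a).
        rewrite !(functionalB _ _ feta) (functionalZ _ _ feta) /W /r; ring.
      apply: le_trans (ler_normD _ _) _; apply: lerD; first exact: der.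
      by apply: le_trans (etaq _) _; exact: Uder.
    have bS : b <= s + 1 by lra.
    have -> : r k b - r k a = (psi' k (u b) - psi' k (u a)) + eta (u b - u a).
      by rewrite (functionalB _ _ feta) /r; ring.
    apply: le_trans (ler_normD _ _) _; apply: lerD; first exact: lip.
    by apply: le_trans (etaq _) _; exact: Llip.
  have K0 k : 0 <= K1 k + L q1 by have [K0 _] := K1P k; rewrite addr_ge0 ?L0.
  (* The values of [L] are the Lipschitz constants of [u], so this disc contains all its difference
     quotients. *)
  have [C psiC] : exists C, forall k x, seminorm_ball Q L x -> `|psi k x| <= C.
    apply: (uniform_boundedness QV L fpsi) => x; exact: cvg_bounded (psi_xi x).
  have C0 : 0 <= C.
    have h : `|psi 0%N 0| <= C by apply: psiC => q Qq; rewrite (sem0 QV)// L0.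
    exact: le_trans (normr_ge0 _) h.
  (* [psi' k (u a)] is the right derivative of [psi k \o u], hence a limit of values of [psi k] on
     the disc. The step [d] may depend on [k], the resulting bound [C] does not. *)
  have psi'C k a : 0 <= a -> a <= c -> `|psi' k (u a)| <= C.
    move=> a0 as_; apply/ler_addgt0Pr => e e0.
    have [Kk [der _]] := K1P k.
    pose d := Num.min 1 (e / (K1 k + 1)).
    have d0 : 0 < d by rewrite lt_min ltr01 divr_gt0//; lra.
    have d1 : d <= 1 by rewrite ge_min lexx.
    have Kd : K1 k * d <= e.
      have : d <= e / (K1 k + 1) by rewrite ge_min lexx orbT.
      rewrite ler_pdivlMr; lra.
    have ad : a <= a + d by rewrite lerDl ltW.
    have adS : a + d <= s + 1 by lra.
    have dE : a + d - a = d by rewrite addrAC subrr add0r.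
    have := der a (a + d) a0 ad adS; rewrite dE => b1.
    have b2 : `|psi k (u (a + d) - u a)| <= d * C.
      have -> : u (a + d) - u a = d *: (d^-1 *: (u (a + d) - u a)).
        by rewrite scalerA divff ?scale1r// gt_eqF.
      rewrite (functionalZ _ _ (fpsi k)) normrM gtr0_norm// ler_pM2l//.
      apply: psiC => q Qq; rewrite (sem_hom QV)// gtr0_norm ?invr_gt0//.
      by rewrite ler_pdivrMl// mulrC -{2}dE; exact: Llip.
    rewrite (functionalB _ _ (fpsi k)) in b2.
    have : d * `|psi' k (u a)| <= d * (C + e).
      have -> : d * `|psi' k (u a)| = `|d * psi' k (u a)| by rewrite normrM gtr0_norm.
      have -> : d * psi' k (u a) = (psi k (u (a + d)) - psi k (u a)) -
          (psi k (u (a + d)) - psi k (u a) - d * psi' k (u a)) by ring.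
      apply: le_trans (ler_normB _ _) _; rewrite mulrDr; apply: lerD => //.
      apply: le_trans b1 _; rewrite expr2 mulrA [leLHS]mulrC.
      by rewrite ler_pM2l.
    by rewrite ler_pM2l.
  have rC k a : 0 <= a <= c -> `|r k a| <= C + (q1 (u 0) + L q1 * c).
    move=> /andP[a0 as_]; apply: le_trans (ler_normD _ _) _; apply: lerD.
      exact: psi'C.
    apply: le_trans (etaq _) _; apply: le_trans (sem_le QV (u a) (u 0) Qq1) _.
    rewrite addrC lerD2l; have aS : a <= s + 1 by lra.
    apply: le_trans (Llip _ _ _ Qq1 (lexx _) a0 aS) _.
    by rewrite subr0 ler_wpM2l ?L0.
  have r0 a : 0 <= a <= c -> r k a @[k --> \oo] --> 0.
    move=> /andP[a0 _].
    have -> : 0 = xi (w a) + eta (u a) by have /= := ann' _ (uwG _ a0); lra.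
    rewrite /r; apply: cvgD; last exact: cvg_cst.
    by rewrite (_ : (fun k => psi' k (u a)) = fun k => psi k (w a));
      [exact: psi_xi|apply/funext => k; exact: psi'w].
  have lim0 := bounded_convergence_primitive c0 K0 Wr rC r0.
  have lim1 : W k c - W k 0 @[k --> \oo] --> xi (u c) + eta (U c) - (xi (u 0) + eta (U 0)).
    by apply: cvgB; (apply: cvgD; [exact: psi_xi|exact: cvg_cst]).
  have lim : 0 = xi (u c) + eta (U c) - (xi (u 0) + eta (U 0)).
    exact: cvg_unique lim0 lim1.
  have etaU0 : eta (U 0) = 0 by rewrite U0 -(subrr f) (functionalB _ _ feta) subrr.
  by move: lim; rewrite etaU0 u0 (functionalB _ _ fxi); lra.
exists (U s), (u s); split; [exact: UG| |]; last by exists sg => //; exact: obu.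
have Ulip : uniformly_derivable Q s U (fun a => (u a - f) + f).
  move=> q e Qq e0; have Lq := L0 _ Qq.
  exists (e / (L q + 1)); first by apply: divr_gt0 => //; lra.
  move=> a b a0 ab bs bae; have bS : b <= s + 1 by lra.
  rewrite subrK; apply: le_trans (Uder _ _ _ Qq a0 ab bS) _.
  rewrite expr2 mulrA ler_wpM2r ?subr_ge0//.
  move: bae; rewrite ler_pdivlMr; last lra.
  have : 0 <= b - a by rewrite subr_ge0.
  lra.
have ulip : uniformly_continuous Q s (fun a => u a - f).
  move=> q e Qq e0; have Lq := L0 _ Qq.
  exists (e / (L q + 1)); first by apply: divr_gt0 => //; lra.
  move=> a b a0 ab bs bae; have bS : b <= s + 1 by lra.
  have -> : u b - f - (u a - f) = u b - u a by lmod R.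
  apply: le_trans (Llip _ _ _ Qq a0 ab bS) _.
  move: bae; rewrite ler_pdivlMr; last lra.
  have : 0 <= b - a by rewrite subr_ge0.
  lra.
have UM tau : 0 <= tau <= s -> sem_closure Q (mef_graph Q F) (U tau, u tau - f).
  by move=> /andP[t0 ts]; apply: G_clos; exact: UG.
(* Here [U' = (u - f) + f], with [u - f] the value of the closure at [U]: the Duhamel estimate for
   [g = f] and initial value [U 0 = 0]. *)
have lim := chernoff_duhamel QV F_linear F_bounded mef_dense s0 UM ulip Ulip.
move=> q e Qq e0; near=> h.
have h0 : 0 < h by near: h; exact: near0_pos.
have : q (iter (steps h s) (F h) (U 0) + h *: geometric_sum F h (steps h s) f - U s) < e.
  by near: h; exact: lim.
by rewrite U0 (linear_fun0 (iter_linear _ (F_linear (ltW h0)))) add0r.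
Unshelve. all: by end_near. Qed.

End WeakOrbitLimit.

(** * Strong convergence and the limit semigroup *)

Section SemigroupConstruction.
Variables (R : realType) (V : lmodType R) (Q : set (V -> R)) (F : R -> V -> V).
Hypothesis QV : seminorm_system Q.
Hypothesis F_linear : forall h, 0 <= h -> linear (F h).
Hypothesis F_bounded : power_bounded Q F.
Variable hs : nat -> R.
Hypothesis hs_cvg : hs n @[n --> \oo] --> 0^'+.
Variable G : set (V * V).
Hypothesis G_subspace : subspace_rel G.
Hypothesis G_mef : G `<=` mef_graph Q F.
Hypothesis adjoint_dense : forall phi, functional Q phi ->
  exists phi_ phi'_ : nat -> V -> R, (forall k, adjoint_pair Q F (phi_ k) (phi'_ k)) /\
    forall x, phi_ k x @[k --> \oo] --> phi x.
Variable A : set V.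
Hypothesis A_dense : sem_dense Q A.
Hypothesis A_dom : forall f, A f -> exists z, G (f, z).
Hypothesis A_compact : forall f, A f -> forall s, 0 <= s -> exists f_ w_ : nat -> V,
  [/\ forall n, sem_closure Q G (f_ n, w_ n),
      weakly_tends Q \oo (fun n => orbit F f (hs n) s - f_ n) 0,
      weakly_compact_seq Q w_ & weakly_compact_seq Q f_].

Let near_hs (P : R -> Prop) : (\forall h \near 0^'+, P h) -> \forall n \near \oo, P (hs n).
Proof. by move=> h; exact: hs_cvg. Qed.

Let hs_pos : \forall n \near \oo, 0 < hs n.
Proof. exact: near_hs (near0_pos R). Qed.

Let mef_dense : sem_dense Q [set x | exists w, mef_graph Q F (x, w)].
Proof.
move=> q x e Qq e0; have [a /A_dom[z az] xa] := A_dense x Qq e0.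
by exists a => //; exists z; exact: G_mef.
Qed.

Let G_clos : sem_closure Q G `<=` sem_closure Q (mef_graph Q F).
Proof. exact: sem_closure_mono. Qed.

(** The approximation half of Banach-Steinhaus: a uniform bound on differences and convergence on a
    dense set make every sequence [O n x] Cauchy. *)
Lemma tends_dense (O : nat -> V -> V) : (forall q, Q q -> exists2 q', Q q' &
    \forall n \near \oo, forall x y, q (O n x - O n y) <= q' (x - y)) ->
  (forall a, A a -> exists l, tends Q \oo (O^~ a) l) ->
  forall x, exists l, tends Q \oo (O^~ x) l.
Proof.
move=> Obnd OA x; apply: (sem_complete QV) => q e Qq e0.
have [q' Qq' Oq'] := Obnd _ Qq.
have e4 : 0 < e / 4 by lra.
have [a Aa xa] := A_dense x Qq' e4.
have [l al] := OA _ Aa.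
have close : \forall n \near \oo, q (O n x - l) < e / 2.
  near=> n.
  have b1 : forall x y, q (O n x - O n y) <= q' (x - y) by near: n.
  have b2 : q (O n a - l) < e / 4 by near: n; exact: al.
  have := sem_dist QV (O n a) (O n x) l Qq; have := b1 x a; lra.
have [N _ closeN] := close; exists N => // m /= Nm n mn.
have h1 := closeN _ Nm; have h2 := closeN _ (leq_trans Nm mn).
have /= := sem_dist QV l (O n x) (O m x) Qq; rewrite (semBC QV l (O m x) Qq).
by move: h1 h2 => /=; lra.
Unshelve. all: by end_near. Qed.

Let it n s x := iter (steps (hs n) s) (F (hs n)) x.
Let sm n s x := hs n *: geometric_sum F (hs n) (steps (hs n) s) x.

Let it_sm_bounded S q : Q q -> exists2 q', Q q' & \forall n \near \oo,
  forall s x y, 0 <= s <= S ->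
    q (it n s x - it n s y) <= q' (x - y) /\ q (sm n s x - sm n s y) <= s * q' (x - y).
Proof.
move=> Qq; have [q' Qq' Fq'] := geometric_sum_bounded QV F_bounded S Qq.
exists q' => //; near=> n => s x y /andP[s0 sS].
have h0 : 0 < hs n by near: n; exact: hs_pos.
have sh := steps_le h0 s0.
have [b1 b2] := Fq' _ _ (x - y) (ltW h0) (le_trans sh sS).
split; first by rewrite /it -(linear_funB (iter_linear _ (F_linear (ltW h0)))).
rewrite /sm -scalerBr (geometric_sumB F_linear _ _ _ (ltW h0)).
by apply: le_trans b1 _; rewrite ler_wpM2r// (sem_ge0 QV).
Unshelve. all: by end_near. Qed.

Let sm_tends s x : 0 <= s -> exists l, tends Q \oo (fun n => sm n s x) l.
Proof.
move=> s0; apply: (@tends_dense (fun n => sm n s)).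
  move=> q Qq; have [q' Qq' b] := it_sm_bounded s Qq.
  exists (fun x => s * q' x); first exact: (sem_scale QV).
  by apply: filterS b => n b y z; have [] := b s y z; rewrite ?s0 ?lexx.
move=> a Aa; have [z az] := A_dom Aa.
have [l [_ [_ tl _]]] := orbit_integral QV F_linear F_bounded hs_cvg G_subspace G_mef
  az (A_compact Aa) adjoint_dense mef_dense s0.
by exists l => q e Qq e0; apply: near_hs (tl q e Qq e0).
Qed.

Let it_closure s x z : 0 <= s -> sem_closure Q G (x, z) ->
  tends Q \oo (fun n => it n s x - x - sm n s z) 0.
Proof.
move=> s0 xz q e Qq e0; have e2 : 0 < e / 2 by lra.
near=> n; rewrite subr0.
have h0 : 0 < hs n by near: n; exact: hs_pos.
have /(_ _ (steps_le h0 s0)) : forall m, m%:R * hs n <= s ->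
    q (iter m (F (hs n)) x - x - hs n *: geometric_sum F (hs n) m z) <= e / 2.
  near: n.
  exact: (near_hs (iter_mef_closure QV F_linear F_bounded s0 (G_clos xz) Qq e2)).
by rewrite /it /sm; lra.
Unshelve. all: by end_near. Qed.

(** Up to a null sequence, the iterates at [a] are [a] plus the Riemann sums of [z]. As [z] may lie
    outside [A], this relies on the convergence of the sums at every vector. *)
Let it_tends s x : 0 <= s -> exists l, tends Q \oo (fun n => it n s x) l.
Proof.
move=> s0; apply: (@tends_dense (fun n => it n s)).
  move=> q Qq; have [q' Qq' b] := it_sm_bounded s Qq.
  by exists q' => //; apply: filterS b => n b y z; have [] := b s y z; rewrite ?s0 ?lexx.
move=> a Aa; have [z az] := A_dom Aa.
have [l zl] := sm_tends z s0.
have az' : sem_closure Q G (a, z) by exact: (sem_closure_sub QV).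
exists (0 + (a + l)).
rewrite (_ : (fun n => it n s a) = fun n => (it n s a - a - sm n s z) + (a + sm n s z)).
  by apply: (tendsD QV); [exact: it_closure|apply: (tendsD QV) => //; exact: (tends_cst QV)].
by apply/funext => n; lmod R.
Qed.

(** With [I s x] the limit of the Riemann sums, [(I s x, T s x - x)] lies in the closure of [G] for
    every [x]; dividing by [s] shows that the generator is contained in this closure. Conversely,
    [T s x - x = I s y] for [(x, y)] in the closure, and [I s y / s] tends to [y]. *)
Theorem chernoff_generation : exists T : R -> V -> V,
  [/\ forall s x, 0 <= s -> tends Q \oo (fun n => iter (steps (hs n) s) (F (hs n)) x) (T s x),
      forall a b x, 0 <= a -> 0 <= b -> T (a + b) x = T a (T b x),
      forall S q, Q q -> exists2 q', Q q' & forall s x, 0 <= s <= S -> q (T s x) <= q' x,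
      forall x, tends Q 0^'+ (fun h => T h x) x
    & forall x y, tends Q 0^'+ (fun h => h^-1 *: (T h x - x)) y <-> sem_closure Q G (x, y)].
Proof.
have /choice[T' TP'] : forall u : R * V, exists l, 0 <= u.1 -> tends Q \oo (fun n => it n u.1 u.2) l.
  move=> [s x]; have [s0|s0] := leP 0 s; last by exists 0.
  by have [l xl] := it_tends x s0; exists l.
have /choice[I' IP'] : forall u : R * V, exists l, 0 <= u.1 -> tends Q \oo (fun n => sm n u.1 u.2) l.
  move=> [s x]; have [s0|s0] := leP 0 s; last by exists 0.
  by have [l xl] := sm_tends x s0; exists l.
pose T s x := T' (s, x); pose I s x := I' (s, x).
have TP s x : 0 <= s -> tends Q \oo (fun n => it n s x) (T s x) := TP' (s, x).
have IP s x : 0 <= s -> tends Q \oo (fun n => sm n s x) (I s x) := IP' (s, x).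
have T_bounded S q : Q q -> exists2 q', Q q' & forall s x, 0 <= s <= S -> q (T s x) <= q' x.
  move=> Qq; have [q' Qq' Fq'] := F_bounded S Qq; exists q' => // s x /andP[s0 sS].
  apply: (tends_le QV Qq (TP s x s0)); near=> n.
  have h0 : 0 < hs n by near: n; exact: hs_pos.
  by apply: Fq'; [exact: ltW|exact: le_trans (steps_le h0 s0) sS].
have small_time q x e : Q q -> 0 < e -> exists2 d, 0 < d & forall s, 0 <= s -> s <= d ->
    q (T s x - x) <= e /\ q (I s x - s *: x) <= s * e.
  move=> Qq e0; have [d d0 small] := iter_small_time QV F_linear F_bounded mef_dense x Qq e0.
  exists d => // s s0 sd.
  have small' : \forall n \near \oo, forall m, m%:R * hs n <= s ->
      q (iter m (F (hs n)) x - x) <= e.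
    apply: filterS (near_hs small) => n h m ms; apply: h; exact: le_trans ms sd.
  split.
    have lim : tends Q \oo (fun n => it n s x - x) (T s x - x).
      by apply: (tendsD QV); [exact: TP|exact: (tends_cst QV)].
    apply: (tends_le QV Qq lim); near=> n.
    have h0 : 0 < hs n by near: n; exact: hs_pos.
    have sm_ : forall m, m%:R * hs n <= s -> q (iter m (F (hs n)) x - x) <= e by near: n.
    by apply: sm_; exact: steps_le.
  apply/ler_addgt0Pr => e1 e10.
  have lim : tends Q \oo (fun n => sm n s x - s *: x) (I s x - s *: x).
    by apply: (tendsD QV); [exact: IP|exact: (tends_cst QV)].
  have qx1 : 0 < q x + 1 by have := sem_ge0 QV x Qq; lra.
  apply: (tends_le QV Qq lim); near=> n.
  have h0 : 0 < hs n by near: n; exact: hs_pos.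
  have sm_ : forall m, m%:R * hs n <= s -> q (iter m (F (hs n)) x - x) <= e by near: n.
  have hq : hs n * q x <= e1.
    have : hs n <= e1 / (q x + 1).
      near: n; exact: (near_hs (nbhs_right_ltW (divr_gt0 e10 qx1))).
    by rewrite ler_pdivlMr//; lra.
  have sh := steps_le h0 s0; have sh' := steps_gt h0 s0.
  have b1 : q (sm n s x - ((steps (hs n) s)%:R * hs n) *: x) <= (steps (hs n) s)%:R * hs n * e.
    apply: (geometric_sum_near QV (ltW h0) Qq) => j js; apply: sm_.
    by apply: le_trans sh; rewrite ler_pM2r// ler_nat ltnW.
  have -> : sm n s x - s *: x = (sm n s x - ((steps (hs n) s)%:R * hs n) *: x) -
      (s - (steps (hs n) s)%:R * hs n) *: x by lmod R.
  apply: le_trans (semB QV _ _ Qq) _; rewrite (sem_hom QV)// ger0_norm; last lra.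
  apply: lerD.
    by apply: le_trans b1 _; rewrite ler_pM2r.
  by apply: le_trans hq; rewrite ler_wpM2r ?(sem_ge0 QV)//; lra.
(* The step count of [a + b] exceeds the sum of the two counts by at most one, and one more
   iteration is negligible by the estimate for small times. *)
have T_semigroup a b x : 0 <= a -> 0 <= b -> T (a + b) x = T a (T b x).
  move=> a0 b0; have ab0 := addr_ge0 a0 b0.
  apply: (tends_unique QV (TP _ x ab0)) => q e Qq e0.
  have [q1 Qq1 Fq1] := F_bounded (a + b) Qq.
  have e3 : 0 < e / 3 by lra.
  have [d d0 small] := iter_small_time QV F_linear F_bounded mef_dense x Qq1 e3.
  near=> n.
  have h0 : 0 < hs n by near: n; exact: hs_pos.
  have Fl := F_linear (ltW h0).
  have hd : hs n <= d by near: n; exact: (near_hs (nbhs_right_ltW d0)).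
  have sm_ : forall m, m%:R * hs n <= d -> q1 (iter m (F (hs n)) x - x) <= e / 3.
    by near: n; exact: (near_hs small).
  have ha := steps_le h0 a0; have ha' := steps_gt h0 a0.
  have hb := steps_le h0 b0; have hb' := steps_gt h0 b0.
  have hab := steps_le h0 ab0; have hab' := steps_gt h0 ab0.
  set m := steps (hs n) a in ha ha' *; set k := steps (hs n) b in hb hb' *.
  have mk : (m + k <= steps (hs n) (a + b))%N.
    rewrite -ltnS -(ltr_nat R) -natr1 natrD -(ltr_pM2r h0).
    by lra.
  have km : (steps (hs n) (a + b) - (m + k))%:R * hs n <= d.
    apply: le_trans hd; rewrite ger_pMl// lern1 leq_subLR addn1 -ltnS.
    rewrite -(ltr_nat R) -(ltr_pM2r h0) -addn2 !natrD.
    by lra.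
  set r := (_ - _)%N in km.
  have rE : steps (hs n) (a + b) = (m + k + r)%N by rewrite subnKC.
  have b1 : q (it n (a + b) x - iter m (F (hs n)) (iter k (F (hs n)) x)) <= e / 3.
    rewrite /it rE (iterD (m + k) r) -(iterD m k) -(linear_funB (iter_linear (m + k) Fl)).
    apply: le_trans (Fq1 _ _ _ (ltW h0) _) (sm_ _ km).
    by rewrite natrD mulrDl; lra.
  have b2 : q (iter m (F (hs n)) (iter k (F (hs n)) x) - it n a (T b x)) < e / 3.
    rewrite /it -(linear_funB (iter_linear m Fl)).
    apply: (le_lt_trans (Fq1 _ _ _ (ltW h0) _)); first lra.
    by rewrite /k; near: n; exact: (TP b x b0 _ _ Qq1 e3).
  have b3 : q (it n a (T b x) - T a (T b x)) < e / 3.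
    by near: n; exact: (TP a (T b x) a0 _ _ Qq e3).
  apply: le_lt_trans (sem_dist QV (it n a (T b x)) _ _ Qq) _.
  have := sem_dist QV (iter m (F (hs n)) (iter k (F (hs n)) x)) (it n (a + b) x) (it n a (T b x)) Qq.
  lra.
have T_cont x : tends Q 0^'+ (fun h => T h x) x.
  move=> q e Qq e0; have e2 : 0 < e / 2 by lra.
  have [d d0 small] := small_time q x _ Qq e2.
  near=> h.
  have [] := small h; [exact: ltW|exact: ltW|lra].
have I_mean x : tends Q 0^'+ (fun h => h^-1 *: I h x) x.
  move=> q e Qq e0; have e2 : 0 < e / 2 by lra.
  have [d d0 small] := small_time q x _ Qq e2.
  near=> h.
  have h0 : 0 < h by near: h; exact: near0_pos.
  have hd : h <= d by near: h; exact: nbhs_right_ltW.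
  have [_ b] := small h (ltW h0) hd.
  have -> : h^-1 *: I h x - x = h^-1 *: (I h x - h *: x).
    by rewrite scalerBr scalerA mulVf ?gt_eqF// scale1r.
  rewrite (sem_hom QV)// gtr0_norm ?invr_gt0//.
  by apply: (@le_lt_trans _ _ (e / 2)); [rewrite ler_pdivrMl|lra].
have TI s x : 0 <= s -> sem_closure Q G (I s x, T s x - x).
  move=> s0; apply: (sem_closure_idem QV) => q e Qq e0.
  have [q' Qq' b] := it_sm_bounded s Qq.
  have e1 : 0 < e / 3 / (s + 1) by apply: divr_gt0; lra.
  have emin : 0 < Num.min (e / 3) (e / 3 / (s + 1)) by rewrite lt_min e1 andbT; lra.
  have [a Aa] := A_dense x (sem_add QV Qq Qq') emin.
  rewrite !lt_min => /andP[xa1 xa2].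
  have qx := sem_ge0 QV (x - a) Qq; have q'x := sem_ge0 QV (x - a) Qq'.
  have [z az] := A_dom Aa.
  (* The strong limits already obtained identify [l] as [I s a] and the weak limit [y] of a
     subsequence as [T s a]. *)
  have [l [y [ly tl [sg hsg ty]]]] := orbit_integral QV F_linear F_bounded hs_cvg G_subspace G_mef
    az (A_compact Aa) adjoint_dense mef_dense s0.
  have lE : l = I s a.
    by apply: (tends_unique QV _ (IP s a s0)) => p c Qp c0; apply: near_hs (tl p c Qp c0).
  have yE : y = T s a.
    apply: (weakly_tends_unique QV ty) => phi fphi.
    by have := weakly_tends_sub hsg (tends_weakly QV (TP s a s0)) fphi; exact.
  rewrite {}lE {}yE in ly.
  exists (I s a, T s a - a) => //=; split.
    have lim : tends Q \oo (fun n => sm n s x - sm n s a) (I s x - I s a).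
      apply: (tendsD QV); first exact: IP.
      rewrite -[X in tends _ _ _ X]scaleN1r (_ : (fun n => _) = fun n => (-1) *: sm n s a).
        by apply: (tendsZ QV); exact: IP.
      by apply/funext => n; rewrite scaleN1r.
    apply: (@le_lt_trans _ _ (e / 3)); last lra.
    apply: (tends_le QV Qq lim); apply: filterS b => n /(_ s x a) []; first by rewrite s0 lexx.
    move=> _ /le_trans; apply; apply: (@le_trans _ _ ((s + 1) * q' (x - a))).
      by rewrite ler_wpM2r//; lra.
    by rewrite mulrC -ler_pdivlMr; lra.
  have lim : tends Q \oo (fun n => it n s x - it n s a) (T s x - T s a).
    apply: (tendsD QV); first exact: TP.
    rewrite -[X in tends _ _ _ X]scaleN1r (_ : (fun n => _) = fun n => (-1) *: it n s a).
      by apply: (tendsZ QV); exact: TP.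
    by apply/funext => n; rewrite scaleN1r.
  have b1 : q (T s x - T s a) <= e / 3.
    apply: (tends_le QV Qq lim); apply: filterS b => n /(_ s x a) []; first by rewrite s0 lexx.
    by move=> /le_trans h _; apply: h; lra.
  have -> : T s x - x - (T s a - a) = (T s x - T s a) - (x - a) by lmod R.
  apply: le_lt_trans (semB QV _ _ Qq) _; lra.
exists T; split=> // x y; split=> [xy|xy].
  apply: (sem_closure_tends QV _ (I_mean x) xy); near=> h.
  have h0 : 0 < h by near: h; exact: near0_pos.
  have Gc := sem_closure_subspace QV G_subspace.
  by have := Gc.2 h^-1 _ _ 0 0 (TI h x (ltW h0)) Gc.1; rewrite !addr0.
have TE s : 0 <= s -> T s x - x = I s y.
  move=> s0; apply/eqP; rewrite -subr_eq0; apply/eqP.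
  apply: (tends_unique QV _ (it_closure s0 xy)).
  apply: (tendsD QV); first by apply: (tendsD QV); [exact: TP|exact: (tends_cst QV)].
  rewrite -scaleN1r (_ : (fun n => _) = fun n => (-1) *: sm n s y).
    by apply: (tendsZ QV); exact: IP.
  by apply/funext => n; rewrite scaleN1r.
move=> q e Qq e0; near=> h.
have h0 : 0 < h by near: h; exact: near0_pos.
by rewrite TE ?(ltW h0)//; near: h; exact: I_mean.
Unshelve. all: by end_near. Qed.

End SemigroupConstruction.

(** * Real and complex scalars *)

Section Scalars.
Variables (R : realType) (k : scalar_kind).
Local Notation K := (scalar_field R k).

Lemma of_realD (a b : R) : of_real (a + b) = of_real a + of_real b :> K.
Proof. by case: k => //=; exact: rmorphD. Qed.

Lemma of_realM (a b : R) : of_real (a * b) = of_real a * of_real b :> K.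
Proof. by case: k => //=; exact: rmorphM. Qed.

Lemma of_real0 : of_real 0 = 0 :> K.
Proof. by case: k. Qed.

Lemma of_real1 : of_real 1 = 1 :> K.
Proof. by case: k. Qed.

Lemma of_realV (a : R) : of_real a^-1 = (of_real a)^-1 :> K.
Proof. by case: k => //=; exact: fmorphV. Qed.

Lemma ler_of_real (a b : R) : (of_real a <= of_real b :> K) = (a <= b).
Proof. by case: k => //=; exact: lecR. Qed.

Lemma ltr_of_real (a b : R) : (of_real a < of_real b :> K) = (a < b).
Proof. by case: k => //=; exact: ltcR. Qed.

Definition real_part : K -> R :=
  match k return scalar_field R k -> R with
  | RealScalars => id
  | ComplexScalars => @complex.Re R
  end.

Lemma real_partD (z w : K) : real_part (z + w) = real_part z + real_part w.
Proof. by rewrite /real_part; case: k z w => //= -[a b] [c d]. Qed.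

Lemma real_partZ (a : R) (z : K) : real_part (of_real a * z) = a * real_part z.
Proof.
rewrite /real_part; case: k z => //= -[b c] /=; by rewrite mul0r subr0.
Qed.

Lemma of_realK : cancel of_real real_part.
Proof. by rewrite /real_part; case: k. Qed.

Lemma real_partK (z : K) : 0 <= z -> of_real (real_part z) = z.
Proof.
rewrite /real_part; case: k z => //= -[a b]; rewrite lecE/= => /andP[/eqP b0 _].
by rewrite [b]b0.
Qed.

Definition real_norm (z : K) : R := real_part `|z|.

Lemma real_normE (z : K) : of_real (real_norm z) = `|z|.
Proof. by rewrite real_partK. Qed.

Lemma real_norm_of_real (a : R) : real_norm (of_real a) = `|a|.
Proof.
by rewrite /real_norm /real_part; case: k => //=; rewrite expr0n/= addr0 sqrtr_sqr.
Qed.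

Lemma real_part_le_norm (z : K) : `|real_part z| <= real_norm z.
Proof.
rewrite /real_norm /real_part; case: k z => //= -[a b] /=.
by rewrite -sqrtr_sqr ler_wsqrtr// lerDl sqr_ge0.
Qed.

Lemma gt0_of_real (e : K) : 0 < e -> exists2 d : R, 0 < d & of_real d = e.
Proof.
move=> e0; exists (real_part e); last by rewrite real_partK// ltW.
by rewrite -ltr_of_real real_partK ?ltW// of_real0.
Qed.

End Scalars.

(** Restriction of scalars to the reals, on an alias of [X] so that the two module structures do not
    compete. *)
Definition realify (R : realType) (k : scalar_kind)
  (X : lmodType (scalar_field R k)) : Type := X.

Section Realify.
Variables (R : realType) (k : scalar_kind) (X : lmodType (scalar_field R k)).

HB.instance Definition _ := GRing.Zmodule.on (realify X).

Let realify_scale (a : R) (x : realify X) : realify X := (of_real a : scalar_field R k) *: (x : X).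

Let realify_scaleA a b x : realify_scale a (realify_scale b x) = realify_scale (a * b) x.
Proof. by rewrite /realify_scale scalerA of_realM. Qed.

Let realify_scale1 : left_id 1 realify_scale.
Proof. by move=> x; rewrite /realify_scale of_real1 scale1r. Qed.

Let realify_scaleDr : right_distributive realify_scale +%R.
Proof. by move=> a x y; rewrite /realify_scale; exact: scalerDr. Qed.

Let realify_scaleDl x : {morph realify_scale^~ x : a b / a + b}.
Proof. by move=> a b; rewrite /realify_scale of_realD scalerDl. Qed.

HB.instance Definition _ := GRing.Zmodule_isLmodule.Build R (realify X)
  realify_scaleA realify_scale1 realify_scaleDr realify_scaleDl.

Lemma realify_scaleE (a : R) (x : X) :
  a *: (x : realify X) = (of_real a : scalar_field R k) *: x.
Proof. by []. Qed.

End Realify.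

(** * The topology described by its continuous seminorms *)

Section ContinuousSeminorms.
Variables (R : realType) (k : scalar_kind).
Local Notation K := (scalar_field R k).
Variables (X : tvsType K) (Omega : Type) (p : Omega -> X -> K).
Hypothesis p_seminorm : forall a, seminorm (p a).

Definition real_seminorm a (x : X) : R := real_part (p a x).

(* The continuous seminorms, read as functions on the underlying real vector
   space; homogeneity is kept over the scalar field. *)
Definition continuous_seminorms : set (realify X -> R) := [set q |
  [/\ forall x y : X, q (x + y) <= q x + q y,
      forall (a : K) (x : X), q (a *: x) = real_norm a * q x
    & exists (n : nat) (alpha : 'I_n -> Omega) (C : R), 0 <= C /\
        forall x, q x <= C * \sum_(i < n) real_seminorm (alpha i) x]].
Local Notation Q := continuous_seminorms.

Lemma real_seminormE a x : of_real (real_seminorm a x) = p a x.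
Proof. by rewrite real_partK//; have [] := p_seminorm a. Qed.

Lemma real_seminorm_ge0 a x : 0 <= real_seminorm a x.
Proof.
by rewrite -(ler_of_real k) real_seminormE of_real0; have [] := p_seminorm a.
Qed.

Lemma real_seminorm_continuous a : Q (real_seminorm a).
Proof.
have [p0 pD pZ] := p_seminorm a; split.
- by move=> x y; rewrite -(ler_of_real k) of_realD !real_seminormE.
- move=> c x; apply: (can_inj (@of_realK R k)).
  by rewrite of_realM !real_seminormE pZ real_normE.
- exists 1%N, (fun=> a), 1; split=> // x.
  by rewrite big_ord_recl big_ord0 addr0 mul1r.
Qed.

Lemma continuous_seminorm0 : Q (fun=> 0).
Proof.
split=> [x y|a x|]; [by rewrite addr0|by rewrite mulr0|].
exists 0%N, (fun i : 'I_0 => False_rect Omega (notF (ltn_ord i))), 0.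
by split=> // x; rewrite mul0r.
Qed.

Lemma continuous_seminormD q1 q2 : Q q1 -> Q q2 -> Q (fun x => q1 x + q2 x).
Proof.
move=> [t1 h1 [n1 [a1 [C1 [C10 b1]]]]] [t2 h2 [n2 [a2 [C2 [C20 b2]]]]]; split.
- by move=> x y; rewrite addrACA; exact: lerD.
- by move=> a x; rewrite h1 h2 mulrDr.
exists (n1 + n2)%N, (fun i => match fintype.split i with inl j => a1 j | inr j => a2 j end), (C1 + C2).
split=> [|x]; first exact: addr_ge0.
rewrite big_split_ord/=.
under eq_bigr => i _ do rewrite (unsplitK (inl i)).
under [X in _ * (_ + X)]eq_bigr => i _ do rewrite (unsplitK (inr i)).
have s1 : 0 <= \sum_(i < n1) real_seminorm (a1 i) x.
  by apply: sumr_ge0 => i _; exact: real_seminorm_ge0.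
have s2 : 0 <= \sum_(i < n2) real_seminorm (a2 i) x.
  by apply: sumr_ge0 => i _; exact: real_seminorm_ge0.
have := b1 x; have := b2 x; have := mulr_ge0 C10 s2; have := mulr_ge0 C20 s1; lra.
Qed.

Lemma continuous_seminormZ c q : 0 <= c -> Q q -> Q (fun x => c * q x).
Proof.
move=> c0 [t h [n [a [C [C0 b]]]]]; split.
- by move=> x y; rewrite -mulrDr ler_wpM2l.
- by move=> d x; rewrite h mulrCA.
exists n, a, (c * C); split; first exact: mulr_ge0.
by move=> x; rewrite -mulrA ler_wpM2l.
Qed.

Lemma continuous_seminorm_sum n (q : 'I_n -> realify X -> R) : (forall i, Q (q i)) ->
  Q (fun x => \sum_(i < n) q i x).
Proof.
elim: n q => [|n IH] q Qq.
  rewrite (_ : (fun x => _) = fun=> 0); first exact: continuous_seminorm0.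
  by apply/funext => x; rewrite big_ord0.
rewrite (_ : (fun x => _) = fun x => \sum_(i < n) q (widen_ord (leqnSn n) i) x + q ord_max x).
  by apply: continuous_seminormD => //; exact: IH.
by apply/funext => x; rewrite big_ord_recr.
Qed.

Lemma continuous_seminorm_ge0 q x : Q q -> 0 <= q x.
Proof.
move=> [t h _].
have q00 : q 0 = 0.
  by rewrite -(scale0r (0 : X)) h -of_real0 real_norm_of_real normr0 mul0r.
have qN : q (- x) = q x.
  rewrite -[- x](scaleN1r (x : X)) h.
  have -> : (-1 : K) = of_real (-1).
    apply/eqP; rewrite -subr_eq0 -opprD oppr_eq0 -{1}(of_real1 R k) -of_realD subrr.
    by rewrite of_real0.
  by rewrite real_norm_of_real normrN1 mul1r.
have := t x (- x); rewrite qN [x - x]subrr q00; lra.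
Qed.

Hypothesis p_generates : generates_topology p.

(** Finite intersections and radii are absorbed into one seminorm, by sums and scaling, so the unit
    balls form a base. *)
Lemma nbhs_seminorm (x : X) (U : set X) :
  nbhs x U <-> exists2 q, Q q & forall y : X, q (y - x) < 1 -> U y.
Proof.
split.
  move=> /p_generates[n [alpha [e [e0 eU]]]].
  have [d d0 de] := gt0_of_real e0.
  pose q (y : realify X) := d^-1 * \sum_(i < n) real_seminorm (alpha i) y.
  exists q.
    apply: continuous_seminormZ; first by rewrite invr_ge0 ltW.
    by apply: continuous_seminorm_sum => i; exact: real_seminorm_continuous.
  move=> y; rewrite /q ltr_pdivrMl// mulr1 => sd; apply: eU => i /=.
  rewrite -real_seminormE -de ltr_of_real; apply: le_lt_trans sd.
  rewrite (bigD1 i)//= lerDl; apply: sumr_ge0 => j _; exact: real_seminorm_ge0.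
move=> [q [_ _ [n [alpha [C [C0 qC]]]]] qU]; apply/p_generates.
(* The summand 1 keeps [D] positive and makes [C n / D < 1] strict. *)
pose D : R := C * n%:R + 1.
have D0 : 0 < D by rewrite ltr_wpDl// mulr_ge0.
exists n, alpha, (of_real D^-1); split.
  by rewrite -(of_real0 R k) ltr_of_real invr_gt0.
move=> y /= yD; apply: qU; apply: le_lt_trans (qC _) _.
apply: (@le_lt_trans _ _ (C * (n%:R * D^-1))).
  rewrite ler_wpM2l//.
  apply: (@le_trans _ _ (\sum_(i < n) D^-1)); last by rewrite sumr_const card_ord mulr_natl.
  apply: ler_sum => i _; rewrite -(ler_of_real k) real_seminormE.
  exact: ltW (yD i).
by rewrite mulrA ltr_pdivrMr// mul1r /D ltrDl.
Qed.

Lemma nbhs_seminorm_lt (x : X) q e : Q q -> 0 < e -> nbhs x [set y : X | q (y - x) < e].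
Proof.
move=> Qq e0; apply/nbhs_seminorm; exists (fun y => e^-1 * q y).
  by apply: continuous_seminormZ => //; rewrite invr_ge0 ltW.
by move=> y /=; rewrite ltr_pdivrMl// mulr1.
Qed.

Lemma cvg_tends (T : Type) (Fl : set_system T) {FF : Filter Fl} (u : T -> X) (l : X) :
  u x @[x --> Fl] --> l <-> tends Q Fl (u : T -> realify X) l.
Proof.
split=> [ul q e Qq e0|ul U]; first exact: ul (nbhs_seminorm_lt l Qq e0).
move=> /nbhs_seminorm[q Qq qU]; apply: filterS (ul q 1 Qq ltr01) => x; exact: qU.
Qed.

Lemma dense_sem_dense (A : set X) : dense A <-> sem_dense Q (A : set (realify X)).
Proof.
split=> [dA q x e Qq e0|dA U [x Ux] oU].
  have Ux := nbhs_seminorm_lt x Qq e0.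
  have [|y [yU Ay]] := dA (interior [set y : X | q (y - x) < e]) _ (open_interior _).
    by exists x; exact: Ux.
  exists y => //; have /= := interior_subset yU.
  have [_ h _] := Qq; rewrite -[x - y]opprB -(scaleN1r (y - x : X)) h.
  by rewrite /real_norm normrN1 -(of_real1 R k) of_realK mul1r.
have /nbhs_seminorm[q Qq qU] : nbhs x U by exact: open_nbhs_nbhs.
have [a Aa xa] := dA q x 1 Qq ltr01; exists a; split=> //; apply: qU.
have [_ h _] := Qq; rewrite -[a - x]opprB -(scaleN1r (x - a : X)) h.
by rewrite /real_norm normrN1 -(of_real1 R k) of_realK mul1r.
Qed.

Hypothesis X_hausdorff : hausdorff_space X.
Hypothesis X_complete : tvs_complete X.

Lemma continuous_seminorms_system : seminorm_system Q.
Proof.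
split.
- by move=> q x y [t _ _]; exact: t.
- by move=> q a x [_ h _]; rewrite realify_scaleE h real_norm_of_real.
- exact: continuous_seminormD.
- exact: continuous_seminormZ.
- move=> x q0; apply: X_hausdorff => A B Ax /nbhs_seminorm[q Qq qB].
  exists x; split; first exact: nbhs_singleton.
  by apply: qB; rewrite subr0 q0.
move=> u cauchy.
have [|l ul] := @X_complete (u @ \oo) _.
  move=> U /nbhs_seminorm[q Qq qU].
  have h0 : 0 < 1 / 2 :> R by [].
  have [N _ /(_ N (leqnn _)) NP] := cauchy q _ Qq h0.
  exists [set x : X | q (x - u N) < 1 / 2]; first by exists N.
  move=> x y /= xN yN; apply: qU; rewrite subr0.
  have [t h _] := Qq; have := t (x - u N) (u N - y); rewrite subrKA.
  have : q (u N - y) = q (y - u N).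
    rewrite -[u N - y]opprB -(scaleN1r (y - u N : X)) h.
    by rewrite /real_norm normrN1 -(of_real1 R k) of_realK mul1r.
  by move=> -> ; lra.
by exists l; apply/cvg_tends.
Qed.

Lemma closure_sem_closure (G : set (X * X)) (u : X * X) :
  closure G u <-> sem_closure Q (G : set (realify X * realify X)) u.
Proof.
have QV := continuous_seminorms_system.
split=> [uG q e Qq e0|uG B].
  have [|v [Gv [v1 v2]]] := uG ([set y : X | q (y - u.1) < e] `*` [set y : X | q (y - u.2) < e]).
    exists ([set y : X | q (y - u.1) < e], [set y : X | q (y - u.2) < e]) => //.
    by split; exact: nbhs_seminorm_lt.
  by exists v => //; rewrite (semBC QV u.1)// (semBC QV u.2).
case=> -[B1 B2] /= [/nbhs_seminorm[q1 Qq1 qB1] /nbhs_seminorm[q2 Qq2 qB2]] B12.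
have [v Gv [v1 v2]] := uG _ _ (continuous_seminormD Qq1 Qq2) ltr01.
have h1 := continuous_seminorm_ge0 (u.1 - v.1) Qq2.
have h2 := continuous_seminorm_ge0 (u.2 - v.2) Qq1.
exists v; split=> //; apply: B12; split=> /=; [apply: qB1|apply: qB2].
  by rewrite (semBC QV)//; lra.
by rewrite (semBC QV)//; lra.
Qed.

Lemma equicontinuous_dominated (B : set (X -> X)) q : equicontinuous_family p B -> Q q ->
  exists2 q', Q q' & forall G x, B G -> q (G x) <= q' x.
Proof.
move=> eqB [_ _ [n [alpha [C [C0 qC]]]]].
have /choice[r rP] : forall i : 'I_n, exists r, Q r /\
    forall G x, B G -> real_seminorm (alpha i) (G x) <= r x.
  move=> i; have [m [beta [b [b0 bB]]]] := eqB (alpha i).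
  exists (fun x => \sum_(j < m) real_part (b j) * real_seminorm (beta j) x); split.
    apply: continuous_seminorm_sum => j; apply: continuous_seminormZ.
      by rewrite -(ler_of_real k) of_real0 real_partK ltW.
    exact: real_seminorm_continuous.
  move=> G x BG; rewrite -(ler_of_real k) real_seminormE.
  rewrite (big_morph (@of_real R k) (@of_realD R k) (of_real0 R k)).
  apply: le_trans (bB G x BG) _; apply: ler_sum => j _.
  by rewrite of_realM real_partK ?real_seminormE// ltW.
exists (fun x => C * \sum_(i < n) r i x).
  by apply: continuous_seminormZ => //; apply: continuous_seminorm_sum => i; have [] := rP i.
move=> G x BG; apply: le_trans (qC _) _; rewrite ler_wpM2l//.
by apply: ler_sum => i _; have [_] := rP i; exact.
Qed.

Lemma dominated_equicontinuous (B : set (X -> X)) :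
  (forall q, Q q -> exists2 q', Q q' & forall G x, B G -> q (G x) <= q' x) ->
  equicontinuous_family p B.
Proof.
move=> dB a; have [q' [_ _ [n [alpha [C [C0 qC]]]]] qB] := dB _ (real_seminorm_continuous a).
exists n, alpha, (fun=> of_real (C + 1)); split.
  by move=> i; rewrite -(of_real0 R k) ltr_of_real; lra.
move=> G x BG; rewrite -real_seminormE.
apply: (@le_trans _ _ (of_real (C * \sum_(i < n) real_seminorm (alpha i) x))).
  by rewrite ler_of_real; exact: le_trans (qB G x BG) (qC x).
rewrite mulr_sumr (big_morph (@of_real R k) (@of_realD R k) (of_real0 R k)).
apply: ler_sum => i _; rewrite -real_seminormE -of_realM ler_of_real.
by rewrite ler_wpM2r ?real_seminorm_ge0//; lra.
Qed.

End ContinuousSeminorms.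

Lemma initial_topology_cvgP (S : choiceType) (T : topologicalType) (f : S -> T)
    (Fl : set_system S) (s : S) : Filter Fl ->
  Fl --> (s : initial_topology f) <-> f @ Fl --> f s.
Proof.
move=> FF; split=> [Fs A /initial_continuous Af|fs A]; first exact: Fs Af.
move=> /= [_ [[B Bop <-] Bfs sBfA]]; rewrite nbhs_filterE.
by apply: filterS sBfA _; apply: fs; exact: open_nbhs_nbhs.
Qed.

Lemma ptws_cvgP (U : Type) (V : topologicalType) (Fl : set_system (U -> V)) (f : U -> V) :
  Filter Fl -> {ptws, Fl --> f} <-> forall t, g t @[g --> Fl] --> f t.
Proof.
move=> FF; rewrite cvg_sup; split=> [Ff t|Ff t].
  by have /initial_topology_cvgP := Ff t; exact.
by apply/initial_topology_cvgP; exact: Ff.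
Qed.

(** * Real and complex functionals, and weak convergence *)

Section ComplexFunctionals.
Variables (R : realType) (k : scalar_kind).
Local Notation K := (scalar_field R k).

Lemma real_partB (z w : K) : real_part (z - w) = real_part z - real_part w.
Proof. by have := real_partD (z - w) w; rewrite subrK => ->; rewrite addrK. Qed.

Lemma real_normD (z w : K) : real_norm (z + w) <= real_norm z + real_norm w.
Proof. by rewrite -(ler_of_real k) of_realD !real_normE; exact: ler_normD. Qed.

Lemma real_normM (z w : K) : real_norm (z * w) = real_norm z * real_norm w.
Proof. by apply: (can_inj (@of_realK R k)); rewrite of_realM !real_normE normrM. Qed.

Lemma real_normN (z : K) : real_norm (- z) = real_norm z.
Proof. by rewrite /real_norm normrN. Qed.

Lemma real_norm_ge0 (z : K) : 0 <= real_norm z.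
Proof. exact: le_trans (normr_ge0 _) (real_part_le_norm z). Qed.

Lemma real_normV (z : K) : real_norm z^-1 = (real_norm z)^-1.
Proof. by apply: (can_inj (@of_realK R k)); rewrite of_realV !real_normE normfV. Qed.

(** The value 0 for real scalars makes [complexify] the identity there, so that both kinds of
    scalars share their statements. *)
Definition imaginary_unit : K :=
  match k return scalar_field R k with
  | RealScalars => 0
  | ComplexScalars => 'i%C
  end.

Lemma real_norm_imaginary_unit : real_norm imaginary_unit <= 1.
Proof.
rewrite /real_norm /real_part /imaginary_unit; case: k => /=; first by rewrite normr0.
by rewrite expr0n expr1n/= add0r sqrtr1.
Qed.

End ComplexFunctionals.
Arguments imaginary_unit {R k}.

(** The classical correspondence [phi x - i phi (i x)] between real-linear functionals and
    complex-linear ones with real part [phi]. *)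
Definition complexify (R : realType) (k : scalar_kind) (X : lmodType (scalar_field R k))
    (phi : X -> R) : X -> (scalar_field R k)^o :=
  fun x => of_real (phi x) - imaginary_unit * of_real (phi (imaginary_unit *: x)).

Lemma real_part_complexify (R : realType) (k : scalar_kind)
    (X : lmodType (scalar_field R k)) (phi : X -> R) x :
  real_part (complexify phi x) = phi x.
Proof.
rewrite /complexify /imaginary_unit; case: k X phi x => /= X phi x.
  by rewrite mul0r subr0.
by rewrite mul0r mul1r subr0 oppr0 addr0.
Qed.

Lemma complexify_real_part (R : realType) (k : scalar_kind)
    (X : lmodType (scalar_field R k)) (psi : X -> (scalar_field R k)^o) x : linear psi ->
  complexify (fun x => real_part (psi x)) x = psi x.
Proof.
rewrite /complexify /imaginary_unit; case: k X psi x => /= X psi x psil.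
  by rewrite mul0r subr0.
rewrite (linear_funZ psil); case: (psi x) => a b.
by apply/eqP; rewrite eq_complex/=; apply/andP; split; apply/eqP; ring.
Qed.

Lemma complexify_linear (R : realType) (k : scalar_kind)
    (X : lmodType (scalar_field R k)) (phi : X -> R) :
  (forall a x y, phi (of_real a *: x + y) = a * phi x + phi y) ->
  linear (complexify phi).
Proof.
rewrite /complexify /imaginary_unit; case: k X phi => /= X phi phil a x y.
  by rewrite !mul0r !subr0 phil.
case: a => a b.
have phi0 : phi 0 = 0.
  by have := phil (-1) 0 0; rewrite scaler0 addr0 mulN1r addNr.
have phiZ c u : phi ((c%:C)%C *: u) = c * phi u.
  by have := phil c u 0; rewrite !addr0 phi0 addr0.
have -> : (a +i* b)%C *: x + y = (a%:C)%C *: x + ((b%:C)%C *: ('i%C *: x) + y).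
  rewrite addrA scalerA -scalerDl; congr (_ *: _ + _).
  by apply/eqP; rewrite eq_complex/=; apply/andP; split; apply/eqP; ring.
have -> : 'i%C *: ((a%:C)%C *: x + ((b%:C)%C *: ('i%C *: x) + y)) =
    (a%:C)%C *: ('i%C *: x) + (((- b)%:C)%C *: x + 'i%C *: y).
  rewrite !scalerDr !scalerA; congr (_ *: _ + (_ *: _ + _)).
    by apply/eqP; rewrite eq_complex/=; apply/andP; split; apply/eqP; ring.
  by apply/eqP; rewrite eq_complex/=; apply/andP; split; apply/eqP; ring.
rewrite !phil; apply/eqP; rewrite eq_complex/=.
by apply/andP; split; apply/eqP; ring.
Qed.

Section Dual.
Variables (R : realType) (k : scalar_kind).
Local Notation K := (scalar_field R k).
Variables (X : tvsType K) (Omega : Type) (p : Omega -> X -> K).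
Hypothesis p_seminorm : forall a, seminorm (p a).
Hypothesis p_generates : generates_topology p.
Local Notation Q := (continuous_seminorms p).

Lemma cvg_real_norm (T : Type) (Fl : set_system T) {FF : Filter Fl} (z : T -> K) (w : K) :
  z x @[x --> Fl] --> (w : K^o) <->
  forall e, 0 < e -> \forall x \near Fl, real_norm (w - z x) <= e.
Proof.
split=> [zw e e0|zw].
  have e0' : 0 < of_real e :> K by rewrite -(of_real0 R k) ltr_of_real.
  have /cvgrPdist_le/(_ _ e0') := zw; apply: filterS => x.
  by rewrite -(ler_of_real k) real_normE.
apply/cvgrPdist_le => e /gt0_of_real[d d0 <-]; apply: filterS (zw d d0) => x.
by rewrite -(ler_of_real k) real_normE.
Qed.

Lemma dual_bounded (psi : X -> K^o) : linear psi ->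
  (exists2 q, Q q & forall x, real_norm (psi x) <= q x) -> dual X psi.
Proof.
move=> psil [q Qq psiq]; split=> // x; apply/cvg_real_norm => e e0.
apply: filterS (nbhs_seminorm_lt p_seminorm p_generates x Qq e0) => y /= /ltW qe.
rewrite -real_normN opprB -(linear_funB psil).
exact: le_trans qe.
Qed.

Lemma dual_functional (psi : X -> K^o) : dual X psi ->
  functional Q (fun x : realify X => real_part (psi x)).
Proof.
move=> [psil psic]; split.
  move=> a x y; rewrite -real_partZ -real_partD; congr real_part.
  exact: psil.
have /cvg_real_norm/(_ _ (ltr01 : 0 < (1 : R)))/(nbhs_seminorm p_seminorm p_generates) := psic 0.
move=> [q Qq psiq]; exists q => // x.
apply: le_trans (ler_norm _) _; apply: le_trans (real_part_le_norm _) _.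
apply/ler_addgt0Pr => e e0.
have q0 := continuous_seminorm_ge0 x Qq.
(* [q x] may vanish, so the vector is scaled into the unit ball by the slightly larger [c]. *)
pose c := q x + e.
have c0 : 0 < c by rewrite /c; lra.
have : real_norm (psi 0 - psi ((of_real c)^-1 *: x)) <= 1.
  apply: psiq; rewrite subr0; have [_ h _] := Qq.
  rewrite h real_normV real_norm_of_real gtr0_norm// ltr_pdivrMl// mulr1 /c; lra.
rewrite (linear_fun0 psil) sub0r real_normN (linear_funZ psil).
rewrite [_ *: _](_ : _ = (of_real c)^-1 * psi x)// real_normM real_normV.
by rewrite real_norm_of_real gtr0_norm// ler_pdivrMl// mulr1.
Qed.

Lemma functional_dual (phi : X -> R) : functional Q (phi : realify X -> R) ->
  dual X (complexify phi).
Proof.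
move=> fphi; have [phil [q Qq phiq]] := fphi.
apply: dual_bounded; first exact: (complexify_linear phil).
exists (fun x => q x + q x); first exact: (continuous_seminormD p_seminorm Qq Qq).
have phiN x : `|phi x| <= q x.
  rewrite ler_norml phiq andbT.
  have [_ h _] := Qq.
  have := phiq (- x).
  have -> : phi (- x) = - phi x by exact: (linear_funN (f := phi : realify X -> R^o) phil).
  have -> : q (- x) = q x.
    rewrite -(scaleN1r (x : X)) h /real_norm normrN1 -(of_real1 R k) of_realK mul1r//.
  lra.
move=> x; apply: le_trans (real_normD _ _) _; rewrite real_norm_of_real; apply: lerD => //.
rewrite real_normN real_normM real_norm_of_real.
have [_ h _] := Qq; have q0 := continuous_seminorm_ge0 x Qq.
have := phiN (imaginary_unit *: x); rewrite h => b1.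
have b2 := real_norm_imaginary_unit R k.
have b3 := real_norm_ge0 (imaginary_unit : K).
apply: (@le_trans _ _ (1 * q x)); last by rewrite mul1r.
apply: ler_pM => //; apply: le_trans b1 _.
by rewrite -[leRHS]mul1r; exact: ler_wpM2r.
Qed.

(** The scalar-valued functionals and their real parts define the same weak convergence, since each
    determines the other through [complexify]. *)
Lemma weak_cvgP (u : nat -> X) (l : X) :
  weak_cvg u l <-> weakly_tends Q \oo (u : nat -> realify X) l.
Proof.
rewrite /weak_cvg initial_topology_cvgP; split=> [ul phi fphi|ul].
  pose psi : set_type (dual X) := SigSub (mem_set (functional_dual fphi)).
  have {}ul : complexify phi (u n) @[n --> \oo] --> complexify phi l.
    by have /ptws_cvgP/(_ psi) := ul.
  have /cvg_real_norm ul' := ul.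
  apply/cvgrPdist_le => e e0; apply: filterS (ul' e e0) => n; apply: le_trans.
  rewrite -(real_part_complexify phi l) -(real_part_complexify phi (u n)).
  by rewrite -real_partB; exact: real_part_le_norm.
apply/ptws_cvgP => psi.
suff : val psi (u n) @[n --> \oo] --> val psi l by [].
apply/cvg_real_norm => e e0.
have [psil _] : dual X (val psi) by exact: set_mem (valP psi).
have dpsi : dual X (val psi) by exact: set_mem (valP psi).
have fpsi := dual_functional dpsi.
have [fl [q Qq fq]] := fpsi.
(* Up to sign this is the imaginary part of [psi] for complex scalars; for real scalars it is 0. *)
have fpsii : functional Q (fun x : realify X => real_part (val psi (imaginary_unit *: (x : X)))).
  split.
    move=> a x y; rewrite -fl; congr (real_part (val psi _)).
    by rewrite realify_scaleE scalerDr scalerA mulrC -scalerA.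
  exists q => // x; apply: le_trans (fq _) _; have [_ h _] := Qq; rewrite h -[leRHS]mul1r.
  apply: ler_wpM2r; first exact: continuous_seminorm_ge0 Qq.
  exact: real_norm_imaginary_unit.
have e2 : 0 < e / 2 by lra.
have /cvgrPdist_le/(_ _ e2) := ul _ fpsi; have /cvgrPdist_le/(_ _ e2) := ul _ fpsii.
apply: filterS2 => n h1 h2.
change (real_norm (val psi l - val psi (u n)) <= e).
rewrite -(linear_funB psil) -(complexify_real_part _ psil) /complexify.
apply: le_trans (real_normD _ _) _; rewrite real_norm_of_real real_normN real_normM.
rewrite real_norm_of_real scalerBr !(linear_funB psil).
rewrite !real_partB.
have b := real_norm_imaginary_unit R k.
have b0 := real_norm_ge0 (imaginary_unit : K).
have := ler_pM b0 (normr_ge0 _) b h1; lra.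
Qed.

End Dual.

(** * Closed operators and generators *)

Section OperatorGraphs.
Variables (K : numFieldType) (E : lmodType K).

Lemma graph_operator_of (G : set (E * E)) :
  (forall x y z, G (x, y) -> G (x, z) -> y = z) -> graph (operator_of G) = G.
Proof.
move=> Gfun; apply/seteqP; split=> -[x y] /=.
  by move=> [[z Gxz] /= ->]; exact: (@xgetPex _ 0 [set y | G (x, y)]) (ex_intro _ z Gxz).
move=> Gxy; split; first by exists y.
by apply: (Gfun x) => //; apply: (@xgetPex _ 0 [set y | G (x, y)]); exists y.
Qed.

Lemma operator_of_linear (G : set (E * E)) :
  (forall x y z, G (x, y) -> G (x, z) -> y = z) ->
  G (0, 0) -> (forall a x y z w, G (x, y) -> G (z, w) -> G (a *: x + z, a *: y + w)) ->
  linear_operator (operator_of G).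
Proof.
move=> Gfun G0 Gl.
have appE x y : G (x, y) -> operator_of G x = y.
  by move=> Gxy; apply: (Gfun x) => //; apply: (@xgetPex _ 0 [set y | G (x, y)]); exists y.
split; first split; first by exists 0.
  by move=> a x z [y xy] [w zw]; exists (a *: y + w); exact: Gl.
move=> a x z [y xy] [w zw].
by rewrite (appE _ _ xy) (appE _ _ zw); apply: appE; exact: Gl.
Qed.

End OperatorGraphs.

(** * Transfer of the hypotheses to real seminorms *)

Section Transfer.
Variables (R : realType) (k : scalar_kind).
Local Notation K := (scalar_field R k).
Variables (X : tvsType K) (Omega : Type) (p : Omega -> X -> K).
Hypothesis p_seminorm : forall a, seminorm (p a).
Hypothesis p_generates : generates_topology p.
Hypothesis X_hausdorff : hausdorff_space X.
Hypothesis X_complete : tvs_complete X.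
Local Notation Q := (continuous_seminorms p).

Let QV : seminorm_system Q := continuous_seminorms_system p_seminorm p_generates X_hausdorff X_complete.

Lemma linear_realify (S : X -> X) : linear S -> linear (S : realify X -> realify X).
Proof. by move=> Sl a x y; exact: Sl. Qed.

Lemma difference_quotientE (S : R -> X -> X) (x : X) h : S 0 = id ->
  difference_quotient S x h = h^-1 *: ((S h x : realify X) - x).
Proof. by move=> S0; rewrite /difference_quotient S0 realify_scaleE of_realV. Qed.

Lemma mef_derivativeE (F : R -> X -> X) : F 0 = id ->
  mef_derivative F = mef_graph Q (F : R -> realify X -> realify X) :> set (X * X).
Proof.
move=> F0; apply/seteqP; split=> -[x w] /=.
  move=> [f_ [/(cvg_tends p_seminorm p_generates) fx]].
  move=> /(cvg_tends p_seminorm p_generates) Dw; exists f_ => // q e Qq e0.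
  apply: filterS (Dw q e Qq e0) => h.
  by rewrite difference_quotientE.
move=> [f_ fx Dw]; exists f_; split; apply/(cvg_tends p_seminorm p_generates) => //.
move=> q e Qq e0; apply: filterS (Dw q e Qq e0) => h.
by rewrite difference_quotientE.
Qed.

Lemma generator_graph (T : R -> X -> X) : T 0 = id ->
  graph (generator T) = [set u | tends Q 0^'+
    (fun h => h^-1 *: ((T h u.1 : realify X) - u.1)) u.2].
Proof.
move=> T0; rewrite /generator /strong_derivative.
have E (x w : X) : difference_quotient T x h @[h --> 0^'+] --> w <->
    tends Q 0^'+ (fun h => h^-1 *: ((T h x : realify X) - x)) w.
  rewrite (cvg_tends p_seminorm p_generates); split=> h q e Qq e0;
    by apply: filterS (h q e Qq e0) => t; rewrite difference_quotientE.
rewrite graph_operator_of; last first.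
  by move=> x y z /E xy /E xz; exact: (tends_unique QV xy xz).
by apply/seteqP; split=> -[x w] /E.
Qed.

Lemma class_E_bounded (F : R -> X -> X) : class_E p F ->
  power_bounded Q (F : R -> realify X -> realify X).
Proof.
move=> [_ _ eqF] S q Qq.
(* [S] may be negative, whereas equicontinuity is given for nonnegative times. *)
have S0 : 0 <= Num.max S 0 by rewrite le_max lexx orbT.
have [q' Qq' qF] := equicontinuous_dominated p_seminorm (eqF _ S0) Qq.
(* [iterates] contains positive powers only; the summand [q x] covers the power 0. *)
exists (fun x => q' x + q x) => [|h m x h0 mh].
  exact: (continuous_seminormD p_seminorm Qq' Qq).
have q0 := continuous_seminorm_ge0 x Qq; have q'0 := continuous_seminorm_ge0 x Qq'.
case: m mh => [|m] mh; first by rewrite /= lerDr.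
rewrite -[leLHS]addr0; apply: lerD => //; apply: qF; exists h, 1%N, m.+1; split=> //.
  by rewrite divr1; apply: le_trans mh _; rewrite le_max lexx.
by rewrite divr1.
Qed.

(** The discs are bounded for the seminorms [p a], so strong convergence in the dual is uniform on
    them, and taking real parts does not increase distances. *)
Lemma adjoint_derivative_pair (F : R -> X -> X) (psi psi' : X -> K^o) : F 0 = id ->
  dual X psi -> dual X psi' ->
  {family bounded_subset p,
    difference_quotient (adjoint_function F) psi h @[h --> 0^'+] --> psi'} ->
  adjoint_pair Q (F : R -> realify X -> realify X)
    (fun x => real_part (psi x)) (fun x => real_part (psi' x)).
Proof.
move=> F0 dpsi dpsi' lim.
split; [exact: dual_functional|exact: dual_functional|move=> L e e0].
have Lb : bounded_subset p (seminorm_ball Q L : set X).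
  move=> a; exists (of_real (L (real_seminorm p a))) => x xL.
  rewrite -(real_seminormE p_seminorm) ler_of_real.
  by apply: xL; exact: real_seminorm_continuous.
have e0' : 0 < of_real e :> K by rewrite -(of_real0 R k) ltr_of_real.
have entE : entourage [set uv : K^o * K^o | ball uv.1 (of_real e) uv.2].
  by rewrite -entourage_ballE; exists (of_real e).
have limE : \forall h \near 0^'+, forall x, seminorm_ball Q L x ->
    ball (psi' x) (of_real e) (difference_quotient (adjoint_function F) psi h x).
  exact: (lim _ (fam_nbhs (psi' : {family bounded_subset p, X -> K^o}) entE Lb)).
apply: filterS limE => h hL x xL; have /= := hL x xL.
rewrite -ball_normE /= /difference_quotient /adjoint_function F0 => lt.
rewrite distrC; apply: le_trans (_ : real_norm (psi' x - (of_real h)^-1 * (psi (F h x) - psi x)) <= _).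
  apply: le_trans (real_part_le_norm _).
  by rewrite real_partB -of_realV real_partZ real_partB.
by rewrite -(ler_of_real k) real_normE; exact: ltW.
Qed.

Lemma star_dense_adjoint (F : R -> X -> X) : F 0 = id ->
  star_dense (dom (adjoint_strong_derivative p F)) ->
  forall phi, functional Q phi -> exists phi_ phi'_ : nat -> realify X -> R,
    (forall j, adjoint_pair Q (F : R -> realify X -> realify X) (phi_ j) (phi'_ j)) /\
    forall x, phi_ j x @[j --> \oo] --> phi x.
Proof.
move=> F0 dF phi fphi.
have [psi_ [psi_dom psi_phi]] := dF _ (functional_dual p_seminorm p_generates fphi).
have /choice[psi'_ psi'P] : forall j, exists psi', [/\ dual X (psi_ j), dual X psi' &
  {family bounded_subset p,
    difference_quotient (adjoint_function F) (psi_ j) h @[h --> 0^'+] --> psi'}].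
  by move=> j; have [psi' h] := psi_dom j; exists psi'.
exists (fun j x => real_part (psi_ j x)), (fun j x => real_part (psi'_ j x)); split.
  by move=> j; have [d1 d2 lim] := psi'P j; exact: adjoint_derivative_pair.
move=> x; apply/cvgrPdist_le => e e0.
have /cvg_real_norm/(_ e e0) := psi_phi x; apply: filterS => j; apply: le_trans.
rewrite -(real_part_complexify phi x) -real_partB; exact: real_part_le_norm.
Qed.

Lemma weakly_compact_seqP (v : nat -> X) :
  weakly_subseq_compact v <-> weakly_compact_seq Q (v : nat -> realify X).
Proof.
split=> h s hs; have [t ht [l vl]] := h s hs; exists t => //; exists l;
  exact/(weak_cvgP p_seminorm p_generates).
Qed.

Lemma closure_graph (Z : operator X) :
  closure (graph Z) = sem_closure Q (graph Z : set (realify X * realify X)).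
Proof.
apply/seteqP; split=> u;
  by move/(closure_sem_closure p_seminorm p_generates X_hausdorff X_complete).
Qed.

Section Closability.
Variables (Z : operator X) (F : R -> X -> X).
Hypothesis Z_linear : linear_operator Z.
Hypothesis F_class : class_F p F.
Hypothesis F_dom : dom Z `<=` dom (effective_derivative F).
Hypothesis F_Z : forall g, dom Z g -> effective_derivative F g = Z g.

Let F0 : F 0 = id. Proof. by case: F_class => -[]. Qed.

Lemma class_F_linear h : 0 <= h -> linear (F h).
Proof. by case: F_class => -[Fb _ _] _ /Fb[]. Qed.

(** [effective_derivative] selects a value of the many-valued derivative wherever there is one, so
    [(x, Z x)] belongs to the relation itself. *)
Lemma graph_mef : graph Z `<=` mef_graph Q (F : R -> realify X -> realify X).
Proof.
move=> [x y] [/= Zx ->]; rewrite -mef_derivativeE// -F_Z//.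
have [z xz] := F_dom Zx.
exact: (@xgetPex _ 0 [set y | mef_derivative F (x, y)]) (ex_intro _ z xz).
Qed.

Lemma class_F_dense : sem_dense Q
  [set x | exists w, mef_graph Q (F : R -> realify X -> realify X) (x, w)].
Proof.
case: F_class => _ /(dense_sem_dense p_seminorm p_generates).
move=> dF q x e Qq e0; have [a [w aw] xa] := dF q x e Qq e0; exists a => //; exists w.
by rewrite -mef_derivativeE.
Qed.

Lemma graph_subspace a (x y z w : X) :
  graph Z (x, y) -> graph Z (z, w) -> graph Z (a *: x + z, a *: y + w).
Proof.
have [[_ dl] Zl] := Z_linear.
by move=> [/= Zx ->] [/= Zz ->]; split; [exact: dl|rewrite Zl].
Qed.

Lemma graph0 : graph Z (0, 0).
Proof.
have [[d0 _] Zl] := Z_linear; split=> //=.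
by have := Zl (-1) 0 0 d0 d0; rewrite scaler0 addr0 scaleN1r addNr.
Qed.

Lemma graph_subspace_rel : subspace_rel (graph Z : set (realify X * realify X)).
Proof. by split; [exact: graph0|move=> a x y z w; exact: graph_subspace]. Qed.

Lemma closure_graph_functional (x y z : X) :
  closure (graph Z) (x, y) -> closure (graph Z) (x, z) -> y = z.
Proof.
rewrite closure_graph => xy xz; apply/eqP; rewrite -subr_eq0; apply/eqP.
have [_ Gl] := sem_closure_subspace QV graph_subspace_rel.
apply: (mef_closure_functional QV (fun h h0 => linear_realify (class_F_linear h0))
  (class_E_bounded F_class.1) class_F_dense).
have GM : sem_closure Q (graph Z : set (realify X * realify X)) `<=`
    sem_closure Q (mef_graph Q (F : R -> realify X -> realify X)).
  by apply: (@sem_closure_mono R (realify X)); exact: graph_mef.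
apply: GM.
have := Gl (-1) _ _ _ _ xz xy; rewrite !scaleN1r addNr addrC; exact.
Qed.

Lemma graph_operator_closure : graph (operator_closure Z) = closure (graph Z).
Proof. by apply: graph_operator_of => x y z; exact: closure_graph_functional. Qed.

Lemma effective_closable : closable Z.
Proof.
exists (operator_closure Z); split; last by rewrite graph_operator_closure.
apply: operator_of_linear.
- exact: closure_graph_functional.
- by apply: subset_closure; exact: graph0.
move=> a x y z w; rewrite closure_graph => xy zw.
have [_ Gl] := sem_closure_subspace QV graph_subspace_rel.
(* [subspace_rel] speaks of real scalars; homogeneity over the scalar field comes from that of the
   seminorms. *)
suff axy : sem_closure Q (graph Z : set (realify X * realify X)) (a *: x, a *: y).
  by have := Gl 1 _ _ _ _ axy zw; rewrite !scale1r.
move=> q e Qq e0.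
have [[x' y'] Zxy [/= h1 h2]] := xy _ e (continuous_seminormZ (real_norm_ge0 a) Qq) e0.
have [_ h _] := Qq.
exists (a *: x', a *: y') => /=.
  by have := graph_subspace a Zxy graph0; rewrite !addr0.
by rewrite -!(scalerBr a (_ : X)) !h.
Qed.

End Closability.
End Transfer.

Lemma cvg_step0 (R : realType) (t : R) : 0 < t -> t / n.+1%:R @[n --> \oo] --> 0^'+.
Proof.
move=> t0 P /near0E[d d0 dP].
have dt : 0 < d / t by exact: divr_gt0.
have /cvgrPdist_le/(_ _ dt) : (n.+1%:R^-1 : R) @[n --> \oo] --> (0 : R) by exact: cvg_harmonic.
apply: filterS => n; rewrite sub0r normrN gtr0_norm ?invr_gt0// => nd.
apply: dP; first exact: divr_gt0.
by move: nd; rewrite ler_pdivlMr// mulrC.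
Qed.

(** Matches [steps] with the exponent [[ns/t]], the index being shifted by one. *)
Lemma steps_divr (R : realType) (t s : R) n :
  steps (t / n.+1%:R) s = Num.truncn (n.+1%:R * s / t).
Proof. by rewrite /steps invf_div mulrCA mulrA. Qed.

(** * Two descriptions of $lC_0$-semigroups *)

Section LC0Semigroups.
Variables (R : realType) (k : scalar_kind).
Local Notation K := (scalar_field R k).
Variables (X : tvsType K) (Omega : Type) (p : Omega -> X -> K).
Hypothesis p_seminorm : forall a, seminorm (p a).
Hypothesis p_generates : generates_topology p.
Hypothesis X_hausdorff : hausdorff_space X.
Hypothesis X_complete : tvs_complete X.
Local Notation Q := (continuous_seminorms p).
Variable T : R -> X -> X.
Local Notation TV := (T : R -> realify X -> realify X).

Let QV : seminorm_system Q := continuous_seminorms_system p_seminorm p_generates X_hausdorff X_complete.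

Definition bounded_semigroup (T : R -> realify X -> realify X) :=
  [/\ forall S q, Q q -> exists2 q', Q q' & forall s x, 0 <= s <= S -> q (T s x) <= q' x,
      forall x, T 0 x = x,
      forall a b x, 0 <= a -> 0 <= b -> T (a + b) x = T a (T b x)
    & forall x, tends Q 0^'+ (fun h => T h x) x].

Lemma lC0_bounded_semigroup : lC0_semigroup p T ->
  (forall s, 0 <= s -> linear (T s)) /\ bounded_semigroup TV.
Proof.
move=> [Tc T0 TD TE]; have [Tb _ _] := TE.
split=> [s /Tb[]//|]; split.
- move=> S q Qq.
  have [q' Qq' Tq'] := class_E_bounded p_seminorm TE S Qq.
  by exists q' => // s x /andP[s0 sS]; apply: (Tq' s 1%N) => //; rewrite mul1r.
- by move=> x; rewrite T0.
- by move=> a b x a0 b0; rewrite TD.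
move=> x; apply/(cvg_tends p_seminorm p_generates).
have /subspace_continuousP/(_ 0) := Tc.
rewrite /= in_itv/= lexx => /(_ isT) /ptws_cvgP/(_ x) Tx'.
have Tx : T h x @[h --> within `[0, +oo[ (nbhs (0 : R))] --> T 0 x by exact: Tx'.
rewrite T0 in Tx; apply: cvg_trans Tx => P [e /= e0 eP]; exists e => //= h he h0; apply: eP => //=.
by rewrite in_itv/= andbT ltW.
Qed.

Lemma semigroup_iter d m x : bounded_semigroup TV -> 0 <= d ->
  iter m (T d) x = T (m%:R * d) x.
Proof.
move=> [_ T0 TD _] d0; elim: m => [|m IH]; first by rewrite mul0r T0.
by rewrite iterS IH -natr1 addrC mulrDl mul1r TD// mulr_ge0.
Qed.

(** The powers [T(d/n)^m] equal [T(m d / n)], so the iterates up to time [s] belong to the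
    equicontinuous family of the [T r] with [r <= s]. *)
Lemma bounded_semigroup_lC0 : (forall s, 0 <= s -> linear (T s)) ->
  bounded_semigroup TV -> lC0_semigroup p T.
Proof.
move=> Tl TS; have [Tb T0 TD Tc] := TS; split.
- apply/subspace_continuousP => s; rewrite /= in_itv/= andbT => s0.
  apply/ptws_cvgP => x.
  suff : T r x @[r --> within `[0, +oo[ (nbhs s)] --> T s x by [].
  apply/(cvg_tends p_seminorm p_generates) => q e Qq e0.
  have e2 : 0 < e / 2 by lra.
  have [d d0 dT] := semigroup_uniformly_continuous QV (fun r r0 => linear_realify (Tl r r0))
    Tb TD Tc (s + 1) x Qq e2.
  exists (Num.min d 1); first by rewrite /= lt_min d0 ltr01.
  move=> r /=; rewrite lt_min => /andP[rd r1]; rewrite in_itv/= andbT => r0.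
  apply: (@le_lt_trans _ _ (e / 2)); last lra.
  move: rd r1; rewrite !ltr_norml => /andP[? ?] /andP[? ?].
  have [sr|/ltW rs] := leP s r; first by apply: dT => //; lra.
  by rewrite (semBC QV)//; apply: dT => //; lra.
- by apply/funext => x; exact: T0.
- by move=> a b a0 b0; apply/funext => x /=; exact: TD.
have dom B S : (forall G, B G -> exists2 s, 0 <= s <= S & G = T s) ->
    equicontinuous_family p B.
  move=> BT; apply: (dominated_equicontinuous p_seminorm) => q Qq.
  have [q' Qq' Tq'] := Tb S q Qq; exists q' => // G x /BT[s sS ->]; exact: Tq'.
split.
- move=> s s0; split; first exact: Tl.
  move=> A Ab a.
  have /(_ a)[n [alpha [b [b0 bT]]]] : equicontinuous_family p [set T s].
    by apply: (dom [set T s] s) => _ ->; exists s => //; rewrite s0 lexx.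
  have /choice[M AM] : forall i, exists M, forall x, A x -> p (alpha i) x <= M.
    by move=> i; exact: Ab.
  exists (\sum_(i < n) b i * M i) => _ [x Ax <-].
  apply: le_trans (bT _ _ erefl) _; apply: ler_sum => i _.
  by rewrite ler_pM2l//; exact: AM.
- by apply/funext => x; exact: T0.
move=> s s0; apply: (dom (iterates T s) s) => G [d [n [m [d0 n0 m0 mds ->]]]].
have dn0 : 0 <= d / n%:R by rewrite divr_ge0.
exists (m%:R * (d / n%:R)).
  by rewrite mulr_ge0//= mulrA.
by apply/funext => x; rewrite semigroup_iter.
Qed.

End LC0Semigroups.

(** * The two implications *)

Section Equivalence.
Variables (R : realType) (k : scalar_kind).
Local Notation K := (scalar_field R k).
Variables (X : tvsType K) (Omega : Type) (p : Omega -> X -> K).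
Hypothesis p_seminorm : forall a, seminorm (p a).
Hypothesis p_generates : generates_topology p.
Hypothesis X_hausdorff : hausdorff_space X.
Hypothesis X_complete : tvs_complete X.
Variables (Z : operator X) (F : R -> X -> X).
Hypothesis Z_linear : linear_operator Z.
Hypothesis F_class : class_F p F.
Hypothesis F_dom : dom Z `<=` dom (effective_derivative F).
Hypothesis F_Z : forall g, dom Z g -> effective_derivative F g = Z g.
Local Notation Q := (continuous_seminorms p).

Let QV : seminorm_system Q := continuous_seminorms_system p_seminorm p_generates X_hausdorff X_complete.
Let F_linear h : 0 <= h -> linear (F h : realify X -> realify X).
Proof. by move=> h0; exact/linear_realify/(class_F_linear F_class). Qed.
Let F_bounded : power_bounded Q (F : R -> realify X -> realify X).
Proof. exact: class_E_bounded F_class.1. Qed.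
Let mef_dense := class_F_dense p_seminorm p_generates F_class.
Let closureE : graph (operator_closure Z) = sem_closure Q (graph Z : set (realify X * realify X)).
Proof.
rewrite (graph_operator_closure p_seminorm p_generates X_hausdorff X_complete Z_linear F_class)//.
exact: closure_graph.
Qed.

(** [T a] commutes with the generator, so the orbit of [f] stays in the graph of the closure with
    value [T a (Z f)], hence in the closure of the effective derivative, where Chernoff's estimate
    applies. *)
Lemma chernoff_of_generator (T : R -> X -> X) (f : X) (s : R) : lC0_semigroup p T ->
  graph (operator_closure Z) = graph (generator T) -> dom Z f -> 0 <= s ->
  graph (operator_closure Z) (T s f, T s (Z f)) /\
  tends Q 0^'+ (fun h => iter (steps h s) (F h : realify X -> realify X) f) (T s f).
Proof.
move=> TC Zgen Zf s0.
have [Tl TS] := lC0_bounded_semigroup p_seminorm p_generates TC.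
have [Tb T0 TD Tc] := TS.
have TlV r : 0 <= r -> linear (T r : realify X -> realify X) by move=> r0; exact/linear_realify/Tl.
have T0' : T 0 = id by apply/funext.
have genE := generator_graph p_seminorm p_generates X_hausdorff X_complete T0'.
have fz : tends Q 0^'+ (fun h => h^-1 *: ((T h f : realify X) - f)) (Z f).
  have : graph (operator_closure Z) (f, Z f).
    by rewrite closureE; apply: (sem_closure_sub QV).
  by rewrite Zgen genE.
have orbit_graph a : 0 <= a -> graph (operator_closure Z) (T a f, T a (Z f)).
  move=> a0; rewrite Zgen genE /= => q e Qq e0.
  have [q' Qq' Tq'] := Tb a q Qq.
  near=> h.
  have h0 : 0 < h by near: h; exact: near0_pos.
  rewrite -(TD _ _ _ (ltW h0) a0) (addrC h a) (TD _ _ _ a0 (ltW h0)).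
  rewrite -(linear_funB (TlV _ a0)) -(linear_funZ (TlV _ a0)) -(linear_funB (TlV _ a0)).
  apply: le_lt_trans (Tq' _ _ _) _; first by rewrite a0 lexx.
  by near: h; exact: fz.
split; first exact: orbit_graph.
apply: (chernoff_semigroup QV F_linear F_bounded mef_dense TlV Tb T0 TD Tc s0 fz) => a a0.
have := orbit_graph a a0; rewrite closureE.
apply: (@sem_closure_mono R (realify X)); exact: graph_mef.
Unshelve. all: by end_near. Qed.

Lemma generation_of_compactness (t : R) (A : set X) : 0 < t ->
  star_dense (dom (adjoint_strong_derivative p F)) ->
  dense A -> A `<=` dom Z ->
  (forall (f : X) (s : R), A f -> 0 <= s -> exists f_ : nat -> X,
     [/\ forall n, dom (operator_closure Z) (f_ n),
         weak_cvg (fun n =>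
           iter (Num.truncn (n.+1%:R * s / t)) (F (t / n.+1%:R)) f - f_ n) 0,
         weakly_subseq_compact (fun n => operator_closure Z (f_ n))
       & weakly_subseq_compact f_]) ->
  exists T : R -> X -> X,
    lC0_semigroup p T /\ graph (operator_closure Z) = graph (generator T).
Proof.
move=> t0 F_adjoint A_dense A_dom A_compact.
have F0 : F 0 = id by case: F_class => -[].
have GM : (graph Z : set (realify X * realify X)) `<=`
    mef_graph Q (F : R -> realify X -> realify X) by exact: graph_mef.
have [||T [Tlim TD Tb Tc Tgen]] := chernoff_generation QV F_linear F_bounded (cvg_step0 t0)
  (graph_subspace_rel Z_linear) GM (star_dense_adjoint p_seminorm p_generates F0 F_adjoint)
  ((dense_sem_dense p_seminorm p_generates A).1 A_dense).
- by move=> f /A_dom Zf; exists (Z f).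
- move=> f Af s s0; have [f_ [fdom fw wc fc]] := A_compact f s Af s0.
  exists f_, (fun n => operator_closure Z (f_ n)); split.
  + move=> n; rewrite -closureE; split=> //; exact: fdom.
  + move/(weak_cvgP p_seminorm p_generates): fw.
    rewrite (_ : (fun n => _) = (fun n => orbit (F : R -> realify X -> realify X) f
      (t / n.+1%:R) s - f_ n))//.
    by apply/funext => n; rewrite /orbit steps_divr.
  + exact/(weakly_compact_seqP p_seminorm p_generates).
  + exact/(weakly_compact_seqP p_seminorm p_generates).
have T0 x : T 0 x = x.
  apply: (tends_unique QV (Tlim 0 x (lexx _))).
  rewrite (_ : (fun n => _) = fun=> x); first exact: (tends_cst QV).
  by apply/funext => n; rewrite steps0.
(* The abstract construction sees real scalars; linearity over the full field is inherited from the
   approximants. *)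
have Tlin s : 0 <= s -> linear (T s : X -> X).
  move=> s0 a x y.
  have FlK n : linear (iter (steps (t / n.+1%:R) s) (F (t / n.+1%:R))).
    by apply: iter_linear; apply: (class_F_linear F_class); rewrite divr_ge0// ltW.
  apply: (tends_unique QV (Tlim s (a *: x + y) s0)).
  rewrite (_ : (fun n => _) = fun n => (a *: (iter (steps (t / n.+1%:R) s) (F (t / n.+1%:R)) x : X)
      + iter (steps (t / n.+1%:R) s) (F (t / n.+1%:R)) y)).
    apply: (tendsD QV); last exact: Tlim.
    move=> q e Qq e0; have [_ h _] := Qq.
    have := Tlim s x s0 _ e (continuous_seminormZ (real_norm_ge0 a) Qq) e0.
    by apply: filterS => n; rewrite -(scalerBr a (_ : X)) h.
  by apply/funext => n; exact: FlK.
exists T; split.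
  exact: (bounded_semigroup_lC0 p_seminorm p_generates X_hausdorff X_complete Tlin).
rewrite closureE (generator_graph p_seminorm p_generates X_hausdorff X_complete); last first.
  by apply/funext.
by apply/seteqP; split=> -[x y] /Tgen.
Qed.

End Equivalence.

Theorem theorem8p2 (R : realType) (k : scalar_kind)
    (X : tvsType (scalar_field R k))
    (Omega : Type) (p : Omega -> X -> scalar_field R k)
    (p_seminorm : forall a, seminorm (p a))
    (p_generates : generates_topology p)
    (X_hausdorff : hausdorff_space X)
    (X_complete : tvs_complete X)
    (Z : operator X) (Z_linear : linear_operator Z)
    (Z_dense : dense (dom Z))
    (t : R) (t_gt0 : 0 < t)
    (F : R -> X -> X)
    (F_class : class_F p F)
    (F_dom : dom Z `<=` dom (effective_derivative F))
    (F_Z : forall g, dom Z g -> effective_derivative F g = Z g)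
    (F_adjoint : star_dense (dom (adjoint_strong_derivative p F))) :
  (closable Z /\
   exists T : R -> X -> X,
     lC0_semigroup p T /\ graph (operator_closure Z) = graph (generator T))
  <->
  (exists A : set X,
    [/\ linear_subspace A, dense A, A `<=` dom Z
      & forall (f : X) (s : R), A f -> 0 <= s ->
        (* [f_ n] is the term of index n + 1 of the sequence *)
        exists f_ : nat -> X,
          [/\ forall n, dom (operator_closure Z) (f_ n),
              weak_cvg (fun n =>
                iter (Num.truncn (n.+1%:R * s / t)) (F (t / n.+1%:R)) f
                - f_ n) 0,
              weakly_subseq_compact (fun n => operator_closure Z (f_ n))
            & weakly_subseq_compact f_]]).
Proof.
pose Q := continuous_seminorms p.
have QV : seminorm_system Q by exact: continuous_seminorms_system.
split=> [[_ [T [TC Zgen]]]|[A [_ A_dense A_dom A_compact]]]; last first.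
  split; first exact: (@effective_closable _ _ _ _ p _ _ _ _ _ F).
  exact: (generation_of_compactness p_seminorm p_generates X_hausdorff X_complete
    Z_linear F_class F_dom F_Z t_gt0 F_adjoint A_dense A_dom A_compact).
(* Every orbit issued from [dom Z] stays in the domain of the closure, so the whole of [dom Z]
   serves as [A]. *)
exists (dom Z); split=> //; first by case: Z_linear.
move=> f s Zf s0.
have [Tsf lim] := chernoff_of_generator p_seminorm p_generates X_hausdorff X_complete
  Z_linear F_class F_dom F_Z TC Zgen Zf s0.
have cst_compact (l : X) : weakly_subseq_compact (fun=> l).
  move=> sg _; exists id => //; exists l; apply/(weak_cvgP p_seminorm p_generates).
  by apply: (tends_weakly QV); exact: (tends_cst QV).
exists (fun=> T s f); split=> //; first by move=> _; exact: Tsf.1.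
apply/(weak_cvgP p_seminorm p_generates); apply: (tends_weakly QV).
suff : tends Q \oo (fun n =>
    (iter (Num.truncn (n.+1%:R * s / t)) (F (t / n.+1%:R)) f : realify X) - T s f)
    ((T s f : realify X) - T s f).
  by move=> lim0; rewrite subrr in lim0; exact: lim0.
apply: (tendsD QV); last exact: (tends_cst QV).
move=> q e Qq e0.
have lim_step : \forall n \near \oo, q ((iter (steps (t / n.+1%:R) s) (F (t / n.+1%:R)) f
    : realify X) - T s f) < e by exact: (cvg_step0 t_gt0 (lim q e Qq e0)).
by apply: filterS lim_step => n; rewrite steps_divr.
Qed.
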